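(* There exist universal constants $C, C' > 0$ such that the following holds. Let $R > 0$, let $\mathcal{D} = \{\mathbf{x}_i\}_{i \in [n]} \subset \mathbb{B}^d(R)$, let $0 < r \le 4r^{(0.9)}(\mathcal{D})$, and let $(\epsilon, \delta) \in [0, 1]^2$. Suppose that \[n \ge C \cdot \left(\frac{\sqrt{d}\log(\frac 1 \delta)}{\epsilon} + \frac{\log\left(\frac {\log(\frac R r)} {\delta} \right)}{\epsilon} \right).\] Then there is an $(\epsilon, \delta)$-differentially private algorithm (taking $\mathcal{D}$ as private input and $r, R, \epsilon, \delta$ as public inputs) that returns a pair $(\hat{\mathbf{x}}, \hat{r}) \in \mathbb{R}^d \times \mathbb{R}_{>0}$ such that with probability $\ge 1 - \delta$, \[f_{\mathcal{D}}(\hat{\mathbf{x}}) \le (40C' + 1) f_{\mathcal{D}}(\mathbf{x}_\star(\mathcal{D})),\quad \hat{r} \le 4r^{(0.9)}(\mathcal{D}),\quad \text{and}\quad \|\mathbf{x}_\star(\mathcal{D}) - \hat{\mathbf{x}}\| \le C' \hat{r}.\] The algorithm runs in time \[O\left(nd\log\left(\frac R r\right)\log\left(\frac{n\log(\frac R r)} \delta\right)\right).\]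
   Context: $\mathbb{B}^d(\boldsymbol{\mu}, s) = \{\mathbf{x} \in \mathbb{R}^d : \|\mathbf{x} - \boldsymbol{\mu}\| \le s\}$ (Euclidean norm), and $\mathbb{B}^d(s) = \mathbb{B}^d(\mathbf{0}, s)$. For a dataset $\mathcal{D} = \{\mathbf{x}_i\}_{i\in[n]} \subset \mathbb{R}^d$, the geometric median objective is $f_{\mathcal{D}}(\mathbf{x}) = \frac1n\sum_{i\in[n]}\|\mathbf{x} - \mathbf{x}_i\|$ and $\mathbf{x}_\star(\mathcal{D})$ denotes a minimizer of $f_{\mathcal{D}}$ over $\mathbb{R}^d$. For $\tau \in [0,1]$, the quantile radius $r^{(\tau)}(\mathcal{D})$ is the smallest $s \ge 0$ such that at least $\tau n$ of the points $\mathbf{x}_i$ satisfy $\|\mathbf{x}_i - \mathbf{x}_\star(\mathcal{D})\| \le s$. Two datasets in $\mathbb{B}^d(R)^n$ are neighboring if they differ in exactly one entry. A randomized algorithm $\mathcal{A}$ is $(\epsilon,\delta)$-differentially private if for all neighboring $\mathcal{D}, \mathcal{D}'$ and all measurable events $\mathcal{E}$, $\Pr[\mathcal{A}(\mathcal{D}) \in \mathcal{E}] \le e^{\epsilon}\Pr[\mathcal{A}(\mathcal{D}') \in \mathcal{E}] + \delta$. *)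

(* Defs.v *)
From HB Require Import structures.
From mathcomp Require Import all_boot all_order all_algebra.
From mathcomp Require Import all_classical all_reals all_analysis.

Set Implicit Arguments.
Unset Strict Implicit.
Unset Printing Implicit Defensive.

Import Order.TTheory GRing.Theory Num.Theory.
Local Open Scope classical_set_scope.
Local Open Scope ring_scope.

(* A point of R^d is a d-tuple: the library equips [d.-tuple R] with the product
   (i.e. Borel) sigma-algebra, and its norms on ['rV[R]_d] are sup norms, so the
   Euclidean distance has to be spelled out anyway. *)
Section Geometry.
Variable R : realType.

Definition euclid_dist d (x y : d.-tuple R) : R :=
  Num.sqrt (\sum_(j < d) (tnth x j - tnth y j) ^+ 2).

Definition in_eball d (c : d.-tuple R) (s : R) (x : d.-tuple R) : bool :=
  euclid_dist x c <= s.

Definition origin d : d.-tuple R := [tuple 0 | _ < d].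

Definition dataset n d := 'I_n -> d.-tuple R.

Definition bounded_dataset n d (radius : R) (D : dataset n d) : Prop :=
  forall i, in_eball (origin d) radius (D i).

Definition gm_objective n d (D : dataset n d) (x : d.-tuple R) : R :=
  n%:R^-1 * \sum_(i < n) euclid_dist x (D i).

Definition geometric_median n d (D : dataset n d) (x : d.-tuple R) : Prop :=
  forall y, gm_objective D x <= gm_objective D y.

(* Geometric medians need not be unique, so the one from which distances are
   measured is the parameter [xstar].  For n > 0 and tau <= 1 the infimum is
   attained: the count is a right-continuous step function of s. *)
Definition quantile_radius n d (tau : R) (D : dataset n d)
    (xstar : d.-tuple R) : R :=
  inf [set s : R | 0 <= s /\
    tau * n%:R <= #|[pred i : 'I_n | in_eball xstar s (D i)]|%:R].

Definition neighboring n d (D D' : dataset n d) : Prop :=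
  exists2 i, D i <> D' i & forall j, j != i -> D j = D' j.

Definition differentially_private n d (radius eps delta : R) disp
    (T : measurableType disp) (A : dataset n d -> probability T R) : Prop :=
  forall D D', bounded_dataset radius D -> bounded_dataset radius D' ->
    neighboring D D' ->
  forall E : set T, measurable E ->
    (A D E <= (expR eps)%:E * A D' E + delta%:E)%E.

End Geometry.

(* Randomized real RAM.  Memory consists of natural-number cells [N_a[i]] and
   real cells [X_a[i, j]]; the array name [a] is a literal, the indices are
   computed.  A program is a finite piece of syntax whose only literals are
   natural numbers, so it cannot hide parameter-dependent precomputation.
   Arithmetic, sqrt, exp, ln, comparisons and draws from Uniform[0,1], N(0,1)
   and the uniform law on {0, ..., m} are primitive.  Every executed command
   costs one step: the expressions of a fixed program have bounded size, so this
   is the unit-cost measure up to a constant.  There is no rounding of reals to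
   naturals. *)
Inductive nexp :=
| NLit of nat
| NCell of nat & nexp
| NAdd of nexp & nexp
| NSub of nexp & nexp
| NMul of nexp & nexp.

Inductive rexp :=
| RNat of nexp
| RCell of nat & nexp & nexp
| RAdd of rexp & rexp
| RSub of rexp & rexp
| RMul of rexp & rexp
| RDiv of rexp & rexp
| RSqrt of rexp
| RExp of rexp
| RLn of rexp.

Inductive bexp :=
| BNatLe of nexp & nexp
| BRealLe of rexp & rexp
| BNot of bexp
| BAnd of bexp & bexp.

Inductive cmd :=
| Skip
| SetN of nat & nexp & nexp
| SetR of nat & nexp & nexp & rexp
| SampleUniform of nat & nexp & nexp
| SampleGaussian of nat & nexp & nexp
| SampleIndex of nat & nexp & nexp
| Seq of cmd & cmd
| If of bexp & cmd & cmd
| While of bexp & cmd.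

Section Semantics.
Variable R : realType.

Record state := State {
  ncell : nat -> nat -> nat;
  rcell : nat -> nat -> nat -> R }.

Definition setn (s : state) (a i v : nat) : state :=
  State (fun a' i' => if (a' == a) && (i' == i) then v else ncell s a' i')
        (rcell s).

Definition setr (s : state) (a i j : nat) (v : R) : state :=
  State (ncell s)
        (fun a' i' j' => if [&& a' == a, i' == i & j' == j] then v
                         else rcell s a' i' j').

Fixpoint neval (s : state) (e : nexp) : nat :=
  match e with
  | NLit k => k
  | NCell a i => ncell s a (neval s i)
  | NAdd e1 e2 => (neval s e1 + neval s e2)%N
  | NSub e1 e2 => (neval s e1 - neval s e2)%N
  | NMul e1 e2 => (neval s e1 * neval s e2)%N
  end.

Fixpoint reval (s : state) (e : rexp) : R :=
  match e with
  | RNat e1 => (neval s e1)%:R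
  | RCell a i j => rcell s a (neval s i) (neval s j)
  | RAdd e1 e2 => reval s e1 + reval s e2
  | RSub e1 e2 => reval s e1 - reval s e2
  | RMul e1 e2 => reval s e1 * reval s e2
  | RDiv e1 e2 => reval s e1 / reval s e2
  | RSqrt e1 => Num.sqrt (reval s e1)
  | RExp e1 => expR (reval s e1)
  | RLn e1 => ln (reval s e1)
  end.

Fixpoint beval (s : state) (b : bexp) : bool :=
  match b with
  | BNatLe e1 e2 => (neval s e1 <= neval s e2)%N
  | BRealLe e1 e2 => reval s e1 <= reval s e2
  | BNot b1 => ~~ beval s b1
  | BAnd b1 b2 => beval s b1 && beval s b2
  end.

(* A configuration is the stack of commands still to be run and the memory. *)
Definition config := (seq cmd * state)%type.

Variant transition :=
| Det of config
| DrawUniform of (R -> config)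
| DrawGaussian of (R -> config)
| DrawIndex of nat & (nat -> config).

Definition step (c : cmd) (k : seq cmd) (s : state) : transition :=
  match c with
  | Skip => Det (k, s)
  | SetN a i e => Det (k, setn s a (neval s i) (neval s e))
  | SetR a i j e =>
      Det (k, setr s a (neval s i) (neval s j) (reval s e))
  | SampleUniform a i j =>
      DrawUniform (fun u => (k, setr s a (neval s i) (neval s j) u))
  | SampleGaussian a i j =>
      DrawGaussian (fun u => (k, setr s a (neval s i) (neval s j) u))
  | SampleIndex a i e =>
      DrawIndex (neval s e) (fun v => (k, setn s a (neval s i) v))
  | Seq c1 c2 => Det (c1 :: c2 :: k, s)
  | If b c1 c2 => Det ((if beval s b then c1 else c2) :: k, s)
  | While b c1 => Det (if beval s b then c1 :: c :: k else k, s)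
  end.

(* Probability that the configuration halts within [T] steps in a state
   belonging to [E]. *)
Fixpoint halting_prob (T : nat) (cf : config) (E : set state) : \bar R :=
  match cf, T with
  | ([::], s), _ => (\1_E s)%:E
  | (_ :: _, _), 0%N => 0%E
  | (c :: k, s), T'.+1 =>
      match step c k s with
      | Det cf' => halting_prob T' cf' E
      | DrawUniform f =>
          \int[uniform_prob (@ltr01 R)]_u halting_prob T' (f u) E
      | DrawGaussian f => \int[normal_prob 0 1]_u halting_prob T' (f u) E
      | DrawIndex m f =>
          ((m.+1%:R^-1)%:E *
             \sum_(v < m.+1) halting_prob T' (f v) E)%E
      end
  end.

(* Worst case over all random draws: every run from the configuration halts
   within [T] steps, in a state satisfying [Q]. *)
Fixpoint always_halts (T : nat) (cf : config) (Q : state -> Prop) : Prop :=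
  match cf, T with
  | ([::], s), _ => Q s
  | (_ :: _, _), 0%N => False
  | (c :: k, s), T'.+1 =>
      match step c k s with
      | Det cf' => always_halts T' cf' Q
      | DrawUniform f => forall u, 0 <= u <= 1 -> always_halts T' (f u) Q
      | DrawGaussian f => forall u, always_halts T' (f u) Q
      | DrawIndex m f => forall v, (v <= m)%N -> always_halts T' (f v) Q
      end
  end.

(* Calling convention.  Input: N_0[0] = n, N_1[0] = d, X_0[i, j] = j-th
   coordinate of the i-th data point, X_1[0, 0] = R, X_2[0, 0] = r,
   X_3[0, 0] = eps, X_4[0, 0] = delta, and 0 in every other cell.
   Output: xhat in X_5[0, 0 .. d - 1] and rhat in X_6[0, 0]. *)
Definition input n d (D : dataset R n d) (radius r eps delta : R) : state :=
  State
    (fun a i =>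
       match a, i with
       | 0, 0 => n
       | 1, 0 => d
       | _, _ => 0
       end%N)
    (fun a i j =>
       match a, i, j with
       | 0%N, _, _ =>
           match insub i : option 'I_n, insub j : option 'I_d with
           | Some i', Some j' => tnth (D i') j'
           | _, _ => 0
           end
       | 1%N, 0%N, 0%N => radius
       | 2%N, 0%N, 0%N => r
       | 3%N, 0%N, 0%N => eps
       | 4%N, 0%N, 0%N => delta
       | _, _, _ => 0
       end).

Definition output d (s : state) : d.-tuple R * R :=
  ([tuple rcell s 5 0 j | j < d], rcell s 6 0 0).

(* On every dataset in the ball of radius [radius], the program [P] always halts
   within [T] steps with rhat > 0, and its output has law [A D]. *)
Definition implements (P : cmd) n d (radius r eps delta : R) (T : nat)
    (A : dataset R n d -> probability (d.-tuple R * R)%type R) : Prop :=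
  forall D, bounded_dataset radius D ->
    let cf := ([:: P], input D radius r eps delta) in
    always_halts T cf (fun s => 0 < (output d s).2) /\
    forall E, measurable E -> A D E = halting_prob T cf (@output d @^-1` E).

End Semantics.

(* Main.v *)
(** Let s_k = r 2^k for k <= K, with K least such that s_K >= 2R.  Draw m = 3q
    random cyclic shifts t_l, let deg_i be the number of l such that x_i and
    x_(i + t_l) are within s_k of each other, and Q_k the sum of the deg_i.
    Comparing points along a few shifts rather than in all pairs costs O(nmd)
    per scale, and still one data point enters Q_k in at most 2m comparisons,
    whatever the shifts are.  If the ball of radius s_k / 2 about the geometric
    median holds 9/10 of the points, then Q_k >= (12/5) q n; conversely, by
    Chernoff's bound, with high probability each i with deg_i > 2q has at least
    (11/20) n points within s_k, hence lies within 11 s_k of the geometric median.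
    The exponential mechanism selects k with Q_k > (11/5) q n and
    Q_(k-1) < (12/5) q n; then s_k <= 4 r^(0.9), and the mean of the data weighted
    by max(deg_i - 2q, 0) moves by at most 200 s_k / n when one point changes.
    Gaussian noise of norm about s_k is added to it.

    Neither the scale selection nor the noise depends on eps: the noise is as
    large as utility allows, and the lower bound on n makes this private.  If
    delta >= 3/4 that bound is void, and (0, r) is output instead with
    probability 1/4, which alone is (0, 3/4)-private.  If R <= 5r, then (0, r) is
    a valid answer.  The bound on the objective follows from the other two
    conclusions because r^(0.9) is at most 10 times the optimum. *)

Require Import Defs.
From HB Require Import structures.
From mathcomp Require Import all_boot all_order all_algebra.
From mathcomp Require Import all_classical all_reals all_analysis.
From mathcomp Require Import measurable_realfun.
From mathcomp Require Import zify ring lra.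

Set Implicit Arguments.
Unset Strict Implicit.
Unset Printing Implicit Defensive.

Import Order.TTheory GRing.Theory Num.Theory.
Import numFieldNormedType.Exports.
Local Open Scope classical_set_scope.
Local Open Scope ring_scope.

(** * Gaussian measure on tuples *)

(** The two terms of the sample size belong to the two releases, each of which gets eps / 2. In the
    selection one data point moves a score by at most 6q, against a gap of qn/10 on either side of
    the middle level (23/10)qn. Both are proportional to q, so q cancels and n of order ln((K +
    1)/delta)/eps is enough: the number of shifts, which grows with ln n, costs time but no samples.
    In the release of the mean, the displacement 200 s_k/n is (400/n) sqrt(d + ln(10/delta)) noise
    deviations at every scale. Privacy wants this to be of order eps/sqrt(ln(4/delta)), which n >= C
    sqrt(d) ln(1/delta)/eps gives once ln(1/delta) is bounded below; hence the separate treatment of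
    delta near 1.

    The shifts do not depend on the data, so neighbouring data sets are compared under the same
    shifts, and shifts that mislead for either one are charged to delta.

    The semantics yields the law of a run as a set function made of nested averages and integrals.
    The laws studied below are built with the same nesting, and measurability is needed only to
    identify the two. *)

Section Density.
Context d (T : measurableType d) (R : realType).
Variables (mu nu : {measure set T -> \bar R}) (p : T -> R).
Hypothesis mp : measurable_fun setT p.
Hypothesis p0 : forall x, 0 <= p x.
Hypothesis nuE : forall A, measurable A -> nu A = (\int[mu]_(x in A) (p x)%:E)%E.
Import HBNNSimple.

Lemma integral_density_indic A : measurable A ->
  (\int[nu]_x (\1_A x)%:E = \int[mu]_x ((\1_A x)%:E * (p x)%:E))%E.
Proof.
move=> mA; rewrite integral_indic// setIT nuE// [LHS]integral_mkcond.
apply: eq_integral => x _; rewrite patchE indicE; case: ifPn => xA.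
  by rewrite mul1e.
by rewrite mul0e.
Qed.

Let integral_density_nnsfun (f : {nnsfun T >-> R}) :
  (\int[nu]_x (f x)%:E = \int[mu]_x ((f x)%:E * (p x)%:E))%E.
Proof.
under [LHS]eq_integral do rewrite fimfunE -fsumEFin//.
rewrite [LHS]ge0_integral_fsum//; last 2 first.
  - by move=> r; exact/measurable_EFinP/measurableT_comp.
  - by move=> n x _; rewrite EFinM nnfun_muleindic_ge0.
under [RHS]eq_integral.
  move=> x xD; rewrite fimfunE -fsumEFin// ge0_mule_fsuml; last first.
    by move=> r; rewrite EFinM nnfun_muleindic_ge0.
  over.
rewrite [RHS]ge0_integral_fsum//; last 2 first.
  - move=> r; apply: emeasurable_funM; last exact/measurable_EFinP.
    by apply/measurable_EFinP; do 2 apply/measurableT_comp => //.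
  - move=> n x _; apply: mule_ge0; last by rewrite lee_fin.
    by rewrite EFinM nnfun_muleindic_ge0.
apply: eq_fsbigr => r _.
have [r0|r0] := leP 0 r; last first.
  rewrite preimage_nnfun0//.
  under eq_integral do rewrite indic0 mulr0.
  under [RHS]eq_integral do rewrite indic0 mulr0 mul0e.
  by rewrite !integral0.
under eq_integral do rewrite EFinM.
under [RHS]eq_integral do rewrite EFinM -muleA.
rewrite ge0_integralZl//; last exact/measurable_EFinP/measurable_indic.
rewrite [RHS]ge0_integralZl//; first by rewrite integral_density_indic.
  apply: emeasurable_funM; last exact/measurable_EFinP.
  exact/measurable_EFinP/measurable_indic.
by move=> x _; rewrite mule_ge0 ?lee_fin.
Qed.

(** By monotone limits of simple functions. It turns integrals against a normal law into Lebesgue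
    integrals, where translation is available. *)
Lemma ge0_integral_density (f : T -> \bar R) :
  measurable_fun setT f -> (forall x, 0 <= f x)%E ->
  (\int[nu]_x f x = \int[mu]_x (f x * (p x)%:E))%E.
Proof.
move=> mf f0.
pose f_ := nnsfun_approx measurableT mf.
transitivity (lim (\int[nu]_x (f_ n x)%:E @[n --> \oo])%E).
  rewrite -monotone_convergence//=.
  - apply: eq_integral => ? /[!inE] xD; apply/esym/cvg_lim => //=.
    exact: cvg_nnsfun_approx.
  - by move=> n; exact/measurable_EFinP/measurable_funTS.
  - by move=> n ? _; rewrite lee_fin.
  - by move=> ? _ ? ? mn; rewrite lee_fin; exact/lefP/nd_nnsfun_approx.
under eq_fun do rewrite integral_density_nnsfun.
rewrite -monotone_convergence//=.
- apply: eq_integral => x _; apply/cvg_lim => //=.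
  apply: cvgeZr => //.
  exact: cvg_nnsfun_approx.
- move=> n; apply: emeasurable_funM; last exact/measurable_EFinP.
  exact/measurable_EFinP/measurable_funTS.
- by move=> n ? _; rewrite mule_ge0 ?lee_fin.
- move=> x _ a b ab; rewrite lee_wpmul2r ?lee_fin//.
  exact/lefP/nd_nnsfun_approx.
Qed.
End Density.

Section GaussianLine.
Variable R : realType.
Local Notation mu := (@lebesgue_measure R).
Local Notation N01 := (@normal_prob R 0 1).

Lemma integral_lebesgue_translation (f : R -> \bar R) (v : R) :
  measurable_fun setT f -> (forall x, 0 <= f x)%E ->
  (\int[mu]_x f (x + v)%R = \int[mu]_x f x)%E.
Proof.
move=> mf f0.
pose tr := (fun x => x + v) : measurableTypeR R -> measurableTypeR R.
have mv : measurable_fun setT tr by exact: measurable_funD.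
have -> : (\int[mu]_x f x = \int[pushforward mu tr]_x f x)%E.
  apply: eq_measure_integral => A mA _.
  apply: lebesgue_measure_unique => //= _ [[a b]] _ <-.
  have pE : tr @^-1` `]a, b] = `]a - v, b - v]%classic.
    by apply/seteqP; split => x /=; rewrite /tr !in_itv/= ltrBlDr lerBrDr.
  rewrite /pushforward pE !lebesgue_measure_itv/= !lte_fin ltrD2r.
  by case: ifP => // _; rewrite -!EFinB; congr EFin; ring.
by rewrite ge0_integral_pushforward.
Qed.

Lemma ge0_integral_normal (m s : R) (f : R -> \bar R) :
  measurable_fun setT f -> (forall x, 0 <= f x)%E ->
  (\int[normal_prob m s]_x f x = \int[mu]_x (f x * (normal_pdf m s x)%:E))%E.
Proof.
move=> mf f0; apply: ge0_integral_density => //.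
- exact: measurable_normal_pdf.
- by move=> x; exact: normal_pdf_ge0.
Qed.

(** Translation invariance of Lebesgue measure moves the shift into the density;
    [v * x - v ^+ 2 / 2] is the log-ratio of the densities of N(v, 1) and N(0, 1). *)
Lemma integral_normal_shift (f : R -> \bar R) (v : R) :
  measurable_fun setT f -> (forall x, 0 <= f x)%E ->
  (\int[N01]_x f (x + v)%R =
   \int[N01]_x (f x * (expR (v * x - v ^+ 2 / 2))%:E))%E.
Proof.
move=> mf f0.
have mE : measurable_fun setT (fun x : R => (expR (v * x - v ^+ 2 / 2))%:E).
  apply/measurable_EFinP; apply: measurableT_comp => //.
  by apply: measurable_funB => //; exact: measurable_funM.
rewrite !ge0_integral_normal//.
- pose g x := (f x * (normal_pdf 0 1 (x - v))%:E)%E.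
  transitivity (\int[mu]_x g (x + v)%R)%E.
    by apply: eq_integral => x _; rewrite /g addrK.
  rewrite integral_lebesgue_translation//.
  + apply: eq_integral => x _; rewrite /g -muleA; congr (_ * _)%E.
    rewrite -EFinM !normal_pdfE ?oner_neq0// mulrCA; congr (_ * _)%:E.
    rewrite /normal_fun -expRD; congr expR.
    by field.
  + apply: emeasurable_funM => //; apply/measurable_EFinP.
    apply: measurableT_comp; first exact: measurable_normal_pdf.
    exact: measurable_funB.
  + by move=> x; rewrite mule_ge0// lee_fin normal_pdf_ge0.
- exact: emeasurable_funM.
- by move=> x; rewrite mule_ge0// lee_fin expR_ge0.
- by apply: measurableT_comp => //; exact: measurable_funD.
Qed.

(** The factor e^(x^2/4) turns the standard density into sqrt 2 times the centred normal density of
    variance 2. *)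
Lemma integral_normal_expR_sqr :
  (\int[N01]_x (expR (x ^+ 2 / 4))%:E = (Num.sqrt 2)%:E)%E.
Proof.
have mE : measurable_fun setT (fun x : R => (expR (x ^+ 2 / 4))%:E).
  apply/measurable_EFinP; apply: measurableT_comp => //.
  by apply: measurable_funM => //; exact: measurable_funX.
rewrite ge0_integral_normal//.
transitivity (\int[mu]_x ((Num.sqrt 2)%:E * (normal_pdf 0 (Num.sqrt 2) x)%:E))%E.
  apply: eq_integral => x _; rewrite -!EFinM; congr EFin.
  have s2 : Num.sqrt 2 != 0 :> R by rewrite gt_eqF// sqrtr_gt0.
  rewrite !normal_pdfE ?oner_neq0// mulrCA.
  have -> : normal_peak 1 = Num.sqrt 2 * normal_peak (Num.sqrt 2) :> R.
    rewrite /normal_peak expr1n mul1r sqr_sqrtr// -mulrnAr sqrtrM//.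
    by rewrite invfM mulrA divff// mul1r.
  rewrite -mulrA; congr (_ * (_ * _)).
  rewrite /normal_fun -expRD sqr_sqrtr// subr0; congr expR.
  by field.
rewrite ge0_integralZl//.
- by rewrite integral_normal_pdf mule1.
- apply/measurable_EFinP; exact: measurable_normal_pdf.
- by move=> x _; rewrite lee_fin normal_pdf_ge0.
Qed.
End GaussianLine.

Section GaussianTuple.
Variable R : realType.
Local Notation N01 := (@normal_prob R 0 1).

Definition tcons d (p : measurableTypeR R * d.-tuple R) : d.+1.-tuple R := [tuple of p.1 :: p.2].

Lemma measurable_tcons d : measurable_fun setT (@tcons d).
Proof.
exact: (@measurable_cons _ _ (measurableTypeR R * d.-tuple R)%type R fst d snd).
Qed.

HB.instance Definition _ d :=
  isMeasurableFun.Build _ _ _ _ (@tcons d) (@measurable_tcons d).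

(** Built one coordinate at a time, so that Tonelli's theorem unfolds its integrals into those
    produced by successive [SampleGaussian] commands. *)
Fixpoint gauss d : probability (d.-tuple R) R :=
  match d with
  | 0 => \d_[tuple]
  | d'.+1 => distribution (N01 \x gauss d')%E (@tcons d')
  end.

Lemma integral_gauss0 (f : 0.-tuple R -> \bar R) :
  measurable_fun setT f -> (forall x, 0 <= f x)%E ->
  (\int[gauss 0]_g f g = f [tuple])%E.
Proof. by move=> mf f0; rewrite integral_dirac// diracT mul1e. Qed.

Lemma integral_gaussS d (f : d.+1.-tuple R -> \bar R) :
  measurable_fun setT f -> (forall x, 0 <= f x)%E ->
  (\int[gauss d.+1]_g f g = \int[N01]_u \int[gauss d]_g f [tuple of u :: g])%E.
Proof.
move=> mf f0; rewrite /= /distribution ge0_integral_pushforward//.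
rewrite preimage_setT fubini_tonelli1//.
  by apply: measurableT_comp => //; exact: measurable_tcons.
by move=> x; exact: f0.
Qed.

Lemma measurable_gauss_section d (f : d.+1.-tuple R -> \bar R) :
  measurable_fun setT f -> (forall x, 0 <= f x)%E ->
  measurable_fun setT (fun u : R => \int[gauss d]_g f [tuple of u :: g])%E.
Proof.
move=> mf f0.
apply: (@measurable_fun_fubini_tonelli_F _ _ _ _ _ (gauss d)
  (fun p => f (tcons p))) => //.
by apply: measurableT_comp => //; exact: measurable_tcons.
Qed.

Lemma measurable_tuple_cons d (u : R) :
  measurable_fun setT (fun g : d.-tuple R => [tuple of u :: g]).
Proof. exact: (@measurable_cons _ _ (d.-tuple R) R (cst u) d id). Qed.

(** The integral in the form in which a run produces it, draw after draw. Sequences rather than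
    tuples allow an induction to keep the draws already made as a prefix. *)
Fixpoint igauss d (F : seq R -> \bar R) : \bar R :=
  match d with
  | 0 => F [::]
  | d'.+1 => (\int[N01]_u igauss d' (fun g => F (u :: g)))%E
  end.

Lemma igaussE d (F : seq R -> \bar R) :
  measurable_fun setT (fun g : d.-tuple R => F g) -> (forall x, 0 <= F x)%E ->
  (igauss d F = \int[gauss d]_g F g)%E.
Proof.
elim: d F => [|d IH] F mF F0.
  by rewrite integral_gauss0.
rewrite integral_gaussS//=; apply: eq_integral => u _; rewrite IH//.
by apply: (measurableT_comp mF); exact: measurable_tuple_cons.
Qed.

Definition tadd d (g v : d.-tuple R) : d.-tuple R :=
  [tuple tnth g j + tnth v j | j < d].

Lemma measurable_tadd d (v : d.-tuple R) : measurable_fun setT (fun g => tadd g v).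
Proof.
apply/measurable_fun_tnthP => i.
rewrite (_ : _ \o _ = fun g => tnth g i + tnth v i); last first.
  by apply/funext => g /=; rewrite tnth_mktuple.
by apply: measurable_funD => //; exact: measurable_tnth.
Qed.

(** Log-density of the Gaussian law centred at [v] relative to the one centred at the origin. *)
Definition gratio d (v g : d.-tuple R) : R :=
  \sum_(j < d) (tnth v j * tnth g j - tnth v j ^+ 2 / 2).

Lemma measurable_gratio d (v : d.-tuple R) : measurable_fun setT (gratio v).
Proof.
apply: measurable_sum => j; apply: measurable_funB => //.
by apply: measurable_funM => //; exact: measurable_tnth.
Qed.

Lemma tadd_cons d (u a : R) (g v : d.-tuple R) :
  tadd [tuple of u :: g] [tuple of a :: v] = [tuple of u + a :: tadd g v].
Proof.
apply: eq_from_tnth => i; rewrite tnth_mktuple.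
by case: (unliftP ord0 i) => [j|] ->; rewrite ?tnthS ?tnth0 ?tnth_mktuple.
Qed.

Lemma gratio_cons d (u a : R) (g v : d.-tuple R) :
  gratio [tuple of a :: v] [tuple of u :: g] = a * u - a ^+ 2 / 2 + gratio v g.
Proof.
rewrite /gratio big_ord_recl !tnth0; congr (_ + _).
by apply: eq_bigr => i _; rewrite !tnthS.
Qed.

Lemma measurable_expR_EFin d (T : measurableType d) (h : T -> R) :
  measurable_fun setT h -> measurable_fun setT (fun x => (expR (h x))%:E).
Proof. by move=> mh; apply/measurable_EFinP; apply: measurableT_comp. Qed.

(** Cameron-Martin formula in finite dimension: the induction hypothesis treats the inner integral,
    the formula on the line the outer one. *)
Lemma integral_gauss_shift d (v : d.-tuple R) (f : d.-tuple R -> \bar R) :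
  measurable_fun setT f -> (forall x, 0 <= f x)%E ->
  (\int[gauss d]_g f (tadd g v) =
   \int[gauss d]_g (f g * (expR (gratio v g))%:E))%E.
Proof.
elim: d v f => [|d IH] v f mf f0.
  rewrite !integral_gauss0//.
  - by rewrite /gratio big_ord0 expR0 mule1; congr f; apply: eq_from_tnth => -[].
  - by apply: emeasurable_funM => //; apply: measurable_expR_EFin; exact: measurable_gratio.
  - by move=> x; rewrite mule_ge0// lee_fin expR_ge0.
  - by apply: (measurableT_comp mf); exact: measurable_tadd.
case: (tupleP v) => a v'.
have mW : measurable_fun setT (fun g => f g * (expR (gratio [tuple of a :: v'] g))%:E)%E.
  by apply: emeasurable_funM => //; apply: measurable_expR_EFin; exact: measurable_gratio.
have W0 g : (0 <= f g * (expR (gratio [tuple of a :: v'] g))%:E)%E.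
  by rewrite mule_ge0// lee_fin expR_ge0.
rewrite !integral_gaussS//; last first.
  by apply: (measurableT_comp mf); exact: measurable_tadd.
pose h u := (\int[gauss d]_g f [tuple of u :: tadd g v'])%E.
have mf1 u : measurable_fun setT (fun g : d.-tuple R => f [tuple of u :: g]).
  by apply: (measurableT_comp mf); exact: measurable_tuple_cons.
have hE u : (h u = \int[gauss d]_g (f [tuple of u :: g] * (expR (gratio v' g))%:E))%E.
  by rewrite /h (IH v' (fun g => f [tuple of u :: g])).
transitivity (\int[N01]_u h (u + a)%R)%E.
  by apply: eq_integral => u _; apply: eq_integral => g _; rewrite tadd_cons.
have h0 u : (0 <= h u)%E by apply: integral_ge0.
rewrite integral_normal_shift//; last first.
  (* Measurability of [h] is read off a section integral on tuples of length d + 1: the density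
     ratio of the shift by [0 :: v'] does not involve the first coordinate. *)
  rewrite (_ : h = fun u => \int[gauss d]_g
      (f [tuple of u :: g] * (expR (gratio [tuple of 0 :: v'] [tuple of u :: g]))%:E))%E.
    apply: measurable_gauss_section (fun g => f g * (expR (gratio [tuple of 0 :: v'] g))%:E)%E _ _.
      by apply: emeasurable_funM => //; apply: measurable_expR_EFin; exact: measurable_gratio.
    by move=> g; rewrite mule_ge0// lee_fin expR_ge0.
  apply/funext => u; rewrite hE; apply: eq_integral => g _.
  by rewrite gratio_cons mul0r expr0n/= mul0r subrr add0r.
apply: eq_integral => u _; rewrite hE -ge0_integralZr//.
- apply: eq_integral => g _; rewrite -muleA -EFinM -expRD gratio_cons.
  by rewrite addrC.
- by apply: emeasurable_funM => //; apply: measurable_expR_EFin; exact: measurable_gratio.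
- by move=> g _; rewrite mule_ge0// lee_fin expR_ge0.
Qed.

Lemma integral_gauss_expR d (v : d.-tuple R) :
  (\int[gauss d]_g (expR (gratio v g))%:E = 1)%E.
Proof.
have := @integral_gauss_shift d v (cst 1%E) (measurable_cst _) (fun=> lee01).
under [in X in _ = X -> _]eq_integral do rewrite mul1e.
move=> <-; rewrite integral_cst//. by rewrite mul1e; exact: probability_setT.
Qed.

Lemma integral_gauss_expR_sqr d :
  (\int[gauss d]_g (expR (\sum_(j < d) tnth g j ^+ 2 / 4))%:E
    = (Num.sqrt 2 ^+ d)%:E)%E.
Proof.
have mE n : measurable_fun setT
    (fun g : n.-tuple R => (expR (\sum_(j < n) tnth g j ^+ 2 / 4))%:E).
  apply: measurable_expR_EFin; apply: measurable_sum => j.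
  apply: measurable_funM => //; apply: measurable_funX; exact: measurable_tnth.
elim: d => [|d IH].
  rewrite integral_gauss0// ?big_ord0 ?expR0//.
rewrite integral_gaussS//.
transitivity (\int[N01]_u ((expR (u ^+ 2 / 4))%:E * (Num.sqrt 2 ^+ d)%:E))%E.
  apply: eq_integral => u _; rewrite -IH -ge0_integralZl//; last exact: mE.
  apply: eq_integral => g _; rewrite big_ord_recl tnth0 expRD EFinM.
  by under eq_bigr do rewrite tnthS.
rewrite [LHS](_ : _ = (\int[N01]_u (expR (u ^+ 2 / 4))%:E) * (Num.sqrt 2 ^+ d)%:E)%E.
  by rewrite integral_normal_expR_sqr -EFinM exprS.
apply: (@ge0_integralZr _ _ _ (normal_prob 0 1) _ measurableT
  (fun u : R => (expR (u ^+ 2 / 4))%:E)) => //.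
- by apply: measurable_expR_EFin; apply: measurable_funM => //; apply: measurable_funX.
Qed.

Lemma measurable_sumsq_gt d (a : R) :
  measurable [set g : d.-tuple R | a < \sum_(j < d) tnth g j ^+ 2].
Proof.
have mS : measurable_fun setT (fun g : d.-tuple R => \sum_(j < d) tnth g j ^+ 2).
  apply: measurable_sum => j; apply: measurable_funX; exact: measurable_tnth.
rewrite (_ : [set g | _] = setT `&` (fun g : d.-tuple R => \sum_(j < d) tnth g j ^+ 2)
    @^-1` `]a, +oo[%classic); first exact: mS.
by apply/seteqP; split => g /=; rewrite in_itv/= andbT => // -[].
Qed.

(** Markov's inequality for e^(|g|^2/4), whose mean is sqrt(2)^d; the factor e^(-d) coming from the
    threshold absorbs that mean. *)
Lemma gauss_tail d (x : R) :
  (gauss d [set g : d.-tuple R | (4 * (d%:R + x) < \sum_(j < d) tnth g j ^+ 2)%R] <= (expR (- x))%:E)%E.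
Proof.
set B := [set g | _].
have mB : measurable B by exact: measurable_sumsq_gt.
have mE : measurable_fun setT
    (fun g : d.-tuple R => (expR (\sum_(j < d) tnth g j ^+ 2 / 4))%:E).
  apply: measurable_expR_EFin; apply: measurable_sum => j.
  apply: measurable_funM => //; apply: measurable_funX; exact: measurable_tnth.
have mind : measurable_fun setT (fun g : d.-tuple R => (\1_B g)%:E : \bar R).
  by apply/measurable_EFinP; apply: measurable_indic.
have -> : gauss d B = (\int[gauss d]_g (\1_B g)%:E)%E.
  by rewrite integral_indic// setIT.
apply: (@le_trans _ _ (\int[gauss d]_g ((expR (\sum_(j < d) tnth g j ^+ 2 / 4))%:E *
   (expR (- (d%:R + x)))%:E))%E).
  apply: ge0_le_integral => //.
  - by apply: emeasurable_funM.
  - move=> g _; rewrite -EFinM lee_fin -expRD indicE.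
    case: (boolP (g \in B)) => [|_]; last by rewrite expR_ge0.
    rewrite inE /B/= => gB; apply: (@le_trans _ _ (expR 0)); first by rewrite expR0.
    rewrite ler_expR.
    by rewrite subr_ge0 -mulr_suml ler_pdivlMr// mulrC ltW.
rewrite ge0_integralZr// ?lee_fin ?expR_ge0// integral_gauss_expR_sqr -EFinM lee_fin.
rewrite opprD expRD mulrA ler_piMl ?expR_ge0//.
rewrite -[- d%:R]mulN1r expRM_natr -exprMn; apply: exprn_ile1.
  by rewrite mulr_ge0 ?expR_ge0.
rewrite expRN ler_pdivrMr ?expR_gt0// mul1r.
apply: (@le_trans _ _ 2); last by have := @expR_ge1Dx R 1; lra.
by rewrite -[leRHS]ger0_norm// -sqrtr_sqr ler_sqrt//; lra.
Qed.

(** Let e^y be the density ratio. Where y <= a it costs a factor e^a; where y > a, it is at most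
    e^((1 + l) y - l a), and the moment of order 1 + l of the ratio is explicit. The parameter [l]
    stays free, to be chosen according to eps and delta. *)
Lemma gauss_shift_le d (v : d.-tuple R) (B : set (d.-tuple R)) (a l : R) :
  measurable B -> 0 <= l ->
  (gauss d [set g : d.-tuple R | B (tadd g v)] <=
   (expR a)%:E * gauss d B +
   (expR (l * (1 + l) / 2 * (\sum_(j < d) tnth v j ^+ 2) - l * a))%:E)%E.
Proof.
move=> mB l0; set c := expR (_ - _).
have mind : measurable_fun setT (fun g : d.-tuple R => (\1_B g)%:E : \bar R).
  exact/measurable_EFinP/measurable_indic.
have mtB : measurable [set g : d.-tuple R | B (tadd g v)].
  rewrite -[X in measurable X]setTI; exact: (measurable_tadd v).
have -> : gauss d [set g : d.-tuple R | B (tadd g v)] = (\int[gauss d]_g (\1_B (tadd g v))%:E)%E.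
  transitivity (\int[gauss d]_g (\1_[set g : d.-tuple R | B (tadd g v)] g)%:E)%E.
    by rewrite integral_indic// setIT.
  by [].
rewrite (@integral_gauss_shift d v (fun g => (\1_B g)%:E))//.
(* The moment is itself a density ratio up to the constant [c], that of the shift by (1 + l) v, so
   its integral is known. *)
pose w : d.-tuple R := [tuple (1 + l) * tnth v j | j < d].
have wE g : c * expR (gratio w g) = expR ((1 + l) * gratio v g - l * a).
  rewrite -expRD; congr expR; rewrite /gratio !mulr_sumr.
  rewrite addrAC -big_split/=; congr (_ - _); apply: eq_bigr => j _.
  by rewrite tnth_mktuple; field.
have mG (u : d.-tuple R) : measurable_fun setT (fun g => (expR (gratio u g))%:E).
  by apply: measurable_expR_EFin; exact: measurable_gratio.
apply: (@le_trans _ _ (\int[gauss d]_g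
   ((expR a)%:E * (\1_B g)%:E + c%:E * (expR (gratio w g))%:E))%E).
  apply: ge0_le_integral => //.
  - by apply: emeasurable_funM => //; exact: mG.
  - by apply: emeasurable_funD; apply: emeasurable_funM => //; exact: mG.
  - move=> g _; rewrite -!EFinM -EFinD lee_fin wE indicE.
    case: (g \in B); last by rewrite mul0r mulr0 add0r expR_ge0.
    rewrite mul1r mulr1; have [ya|ya] := leP (gratio v g) a.
      by rewrite (le_trans (y := expR a)) ?ler_expR// lerDl expR_ge0.
    rewrite (le_trans (y := expR ((1 + l) * gratio v g - l * a)))//; last first.
      by rewrite lerDr expR_ge0.
    by rewrite ler_expR; nra.
rewrite ge0_integralD//.
- rewrite !ge0_integralZl ?lee_fin ?expR_ge0//.
  by rewrite integral_gauss_expR mule1 integral_indic// setIT.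
- by apply: emeasurable_funM => //.
- by move=> g _; apply: mule_ge0; rewrite lee_fin expR_ge0.
- by apply: emeasurable_funM => //; exact: mG.
Qed.

End GaussianTuple.

(** * Uniform sequences of indices *)

Section Averages.
Variable R : realType.
Variable p : nat.

(** Nested in the order of successive [SampleIndex] draws. Laws of runs appear through the
    extended-real copy [eavg]; estimates are made with [ravg]. *)
Fixpoint ravg m (F : seq nat -> R) : R :=
  match m with
  | 0 => F [::]
  | m'.+1 => p.+1%:R^-1 * \sum_(v < p.+1) ravg m' (fun T => F (val v :: T))
  end.

Fixpoint eavg m (F : seq nat -> \bar R) : \bar R :=
  match m with
  | 0 => F [::]
  | m'.+1 => ((p.+1%:R^-1)%:E * \sum_(v < p.+1) eavg m' (fun T => F (val v :: T)))%E
  end.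

Lemma eavg_EFin m (F : seq nat -> R) : eavg m (fun T => (F T)%:E) = (ravg m F)%:E.
Proof.
elim: m F => [|m IH] F //=; rewrite EFinM -sumEFin; congr (_ * _)%E.
by apply: eq_bigr => v _; rewrite IH.
Qed.

Lemma eq_eavg m (F G : seq nat -> \bar R) :
  (forall T, size T = m -> all (leq^~ p) T -> F T = G T) -> eavg m F = eavg m G.
Proof.
elim: m F G => [|m IH] F G FG /=; first exact: FG.
congr (_ * _)%E; apply: eq_bigr => v _; apply: IH => T sT aT.
by apply: FG; rewrite /= ?sT// aT andbT -ltnS.
Qed.

Lemma ler_ravg m (F G : seq nat -> R) :
  (forall T, size T = m -> all (leq^~ p) T -> F T <= G T) -> ravg m F <= ravg m G.
Proof.
elim: m F G => [|m IH] F G FG /=; first exact: FG.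
rewrite ler_wpM2l ?invr_ge0//; apply: ler_sum => v _; apply: IH => T sT aT.
by apply: FG; rewrite /= ?sT// aT andbT -ltnS.
Qed.

Lemma eq_ravg m (F G : seq nat -> R) :
  (forall T, size T = m -> all (leq^~ p) T -> F T = G T) -> ravg m F = ravg m G.
Proof.
move=> FG; apply/eqP; rewrite eq_le.
by apply/andP; split; apply: ler_ravg => T sT aT; rewrite FG.
Qed.

Lemma ravgD m (F G : seq nat -> R) :
  ravg m (fun T => F T + G T) = ravg m F + ravg m G.
Proof.
elim: m F G => [|m IH] F G //=; rewrite -mulrDr -big_split/=; congr (_ * _).
by apply: eq_bigr => v _; rewrite IH.
Qed.

Lemma ravgZ m c (F : seq nat -> R) : ravg m (fun T => c * F T) = c * ravg m F.
Proof.
elim: m F => [|m IH] F //=; rewrite mulrCA; congr (_ * _); rewrite mulr_sumr.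
by apply: eq_bigr => v _; rewrite IH.
Qed.

Lemma ravg_cst m c : ravg m (fun=> c) = c.
Proof.
elim: m => [|m IH] //=; under eq_bigr do rewrite IH.
by rewrite sumr_const card_ord -[c *+ _]mulr_natl mulrA mulVf ?mul1r// pnatr_eq0.
Qed.

Lemma ravg_sum m (I : finType) (F : I -> seq nat -> R) :
  ravg m (fun T => \sum_i F i T) = \sum_i ravg m (F i).
Proof.
elim: m F => [|m IH] F //=; rewrite -mulr_sumr exchange_big/=; congr (_ * _).
by apply: eq_bigr => v _; rewrite IH.
Qed.

Lemma ravg_prod m (h : nat -> R) :
  ravg m (fun T => \prod_(t <- T) h t) = (p.+1%:R^-1 * \sum_(v < p.+1) h v) ^+ m.
Proof.
elim: m => [|m IH] /=; first by rewrite big_nil.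
rewrite exprS -mulrA; congr (_ * _); rewrite mulr_suml; apply: eq_bigr => v _.
by rewrite -IH -ravgZ; apply: eq_ravg => T _ _; rewrite big_cons.
Qed.

(* Chernoff's bound with base 3/2: [(1 + 11/40)^3 <= 12/13 (3/2)^2]. *)
Lemma ravg_tail m (b : nat -> bool) :
  (\sum_(v < p.+1) b v)%:R <= 11 / 20 * p.+1%:R :> R ->
  ravg (3 * m) (fun T => (2 * m <= \sum_(t <- T) b t)%N%:R) <= (12 / 13) ^+ m.
Proof.
move=> hb; pose h t : R := if b t then 3 / 2 else 1.
apply: (@le_trans _ _ (ravg (3 * m) (fun T => (4 / 9) ^+ m * \prod_(t <- T) h t))).
  apply: ler_ravg => T _ _.
  have -> : \prod_(t <- T) h t = (3 / 2) ^+ (\sum_(t <- T) b t).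
    elim: T => [|t T IH]; first by rewrite !big_nil.
    rewrite !big_cons exprD -IH /h; case: (b t); by rewrite ?expr1 ?expr0.
  case: leqP => [le|_]; last by rewrite mulr_ge0// exprn_ge0//; lra.
  rewrite -(subnK le) exprD [(2 * m)%N]mulnC mulnC exprM mulrCA -exprMn.
  rewrite (_ : 4 / 9 * _ = 1); last by field.
  by rewrite expr1n mulr1 exprn_ege1//; lra.
rewrite ravgZ ravg_prod exprM -exprMn.
have h0 : 0 <= p.+1%:R^-1 * \sum_(v < p.+1) h v.
  rewrite mulr_ge0 ?invr_ge0// sumr_ge0// => v _.
  by rewrite /h; case: ifP => _; lra.
have hle : p.+1%:R^-1 * \sum_(v < p.+1) h v <= 51 / 40.
  have -> : \sum_(v < p.+1) h v = p.+1%:R + 1 / 2 * (\sum_(v < p.+1) b v)%:R.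
    rewrite natr_sum mulr_sumr -[X in X%:R + _]card_ord -sumr_const -big_split/=.
    by apply: eq_bigr => v _; rewrite /h; case: (b v) => /=; lra.
  by rewrite mulrC ler_pdivrMr ?ltr0Sn//; lra.
have h3 : (p.+1%:R^-1 * \sum_(v < p.+1) h v) ^+ 3 <= (51 / 40) ^+ 3.
  by rewrite lerXn2r ?nnegrE//; lra.
apply: lerXn2r; rewrite ?nnegrE.
- by rewrite mulr_ge0 ?exprn_ge0//; lra.
- by lra.
- by move: h3; set x := _ ^+ 3 => h3; lra.
Qed.
End Averages.

(** * Mixtures of probability laws *)

Section IsProbability.
Context d (T : measurableType d) (R : realType).
Local Open Scope ereal_scope.

(** Laws of runs are plain set functions; agreeing with a probability on measurable sets is all that
    [implements] asks of them. *)
Definition is_prob (V : set T -> \bar R) :=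
  exists P : probability T R, forall E, measurable E -> P E = V E.

Lemma eq_is_prob (V V' : set T -> \bar R) :
  (forall E, measurable E -> V E = V' E) -> is_prob V -> is_prob V'.
Proof. by move=> VV' [P PE]; exists P => E mE; rewrite PE// VV'. Qed.

Lemma mnormalize_total1 (mu : {measure set T -> \bar R}) (P : probability T R) E :
  mu setT = 1 -> mnormalize mu P E = mu E.
Proof. by move=> mu1; rewrite /mnormalize mu1 onee_eq0/= invr1 mule1. Qed.

Lemma is_prob_sum (N : nat) (w : nat -> R) (V : nat -> set T -> \bar R) :
  (forall k, 0 <= w k)%R -> (\sum_(k < N) w k)%R = 1%R ->
  (forall k, is_prob (V k)) -> is_prob (fun E => \sum_(k < N) (w k)%:E * V k E).
Proof.
move=> w0 w1 /choice[P PE].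
pose mu := msum (fun k => mscale (NngNum (w0 k)) (P k)) N.
have muE E : measurable E -> mu E = \sum_(k < N) (w k)%:E * V k E.
  move=> mE; rewrite /mu/= /msum/=; apply: eq_bigr => k _.
  by rewrite /mscale/= PE.
have mu1 : mu setT = 1.
  rewrite /mu/= /msum/= -w1 -sumEFin; apply: eq_bigr => k _.
  by rewrite /mscale/= probability_setT mule1.
(* The total mass is 1, so normalizing only packs [mu] as a probability; [P 0] is the default of
   [mnormalize] for a degenerate mass. *)
exists (mnormalize mu (P 0%N)) => E mE.
by rewrite -muE//; exact: mnormalize_total1.
Qed.

Lemma is_prob_eavg p m (V : seq nat -> set T -> \bar R) :
  (forall s, is_prob (V s)) -> is_prob (fun E => eavg p m (fun s => V s E)).
Proof.
elim: m V => [|m IH] V Vp /=; first exact: Vp.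
apply: (@eq_is_prob (fun E => \sum_(v < p.+1)
    (p.+1%:R^-1)%:E * eavg p m (fun s => V (val v :: s) E))).
  move=> E mE; rewrite ge0_sume_distrr// => v _.
  by have [P <-] := IH (fun s => V (val v :: s)) (fun s => Vp _).
apply: (@is_prob_sum p.+1 (fun=> p.+1%:R^-1)%R
  (fun v E => eavg p m (fun s => V (v :: s) E))).
- by move=> _; rewrite invr_ge0.
- by rewrite sumr_const card_ord -[LHS]mulr_natl divff// pnatr_eq0.
- by move=> k; exact: IH.
Qed.
End IsProbability.

(** * Euclidean geometry and the geometric median *)

Section Euclid.
Variable R : realType.

Definition nrm d (v : 'I_d -> R) : R := Num.sqrt (\sum_(j < d) v j ^+ 2).

Lemma nrm_ge0 d (v : 'I_d -> R) : 0 <= nrm v.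
Proof. exact: sqrtr_ge0. Qed.

Lemma sumsq_ge0 d (v : 'I_d -> R) : 0 <= \sum_(j < d) v j ^+ 2.
Proof. by apply: sumr_ge0 => j _; exact: sqr_ge0. Qed.

Lemma nrm_sqr d (v : 'I_d -> R) : nrm v ^+ 2 = \sum_(j < d) v j ^+ 2.
Proof. by rewrite sqr_sqrtr// sumsq_ge0. Qed.

(** The vector B u - C v has squared norm B (A B - C^2), so the second factor is nonnegative unless
    B = 0, when [v] vanishes. *)
Lemma cauchy_schwarz d (u v : 'I_d -> R) :
  \sum_(j < d) u j * v j <= nrm u * nrm v.
Proof.
set A := \sum_(j < d) u j ^+ 2; set B := \sum_(j < d) v j ^+ 2.
set C := \sum_(j < d) u j * v j.
have A0 : 0 <= A by exact: sumsq_ge0.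
have B0 : 0 <= B by exact: sumsq_ge0.
suff CAB : C ^+ 2 <= A * B.
  rewrite /nrm -/A -/B -sqrtrM// (le_trans (ler_norm _))//.
  by rewrite -sqrtr_sqr ler_wsqrtr.
have E : \sum_(j < d) (B * u j - C * v j) ^+ 2 = B * (A * B - C ^+ 2).
  transitivity (\sum_(j < d) (B ^+ 2 * u j ^+ 2 - 2 * B * C * (u j * v j) + C ^+ 2 * v j ^+ 2)).
    by apply: eq_bigr => j _; ring.
  rewrite big_split sumrB/= -!mulr_sumr -/A -/B -/C; ring.
have [B1|B1] := eqVneq B 0.
  have v0 j : v j = 0.
    move: B1 => /eqP; rewrite /B psumr_eq0; last by move=> i _; exact: sqr_ge0.
    by move=> /allP/(_ j); rewrite mem_index_enum => /(_ isT); rewrite sqrf_eq0 => /eqP.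
  by rewrite /C big1 ?expr0n ?mulr_ge0// => j _; rewrite v0 mulr0.
rewrite -subr_ge0 -(pmulr_rge0 _ (x := B)) ?lt0r ?B1// -E.
exact: sumsq_ge0.
Qed.

Lemma ler_nrmD d (u v : 'I_d -> R) : nrm (fun j => u j + v j) <= nrm u + nrm v.
Proof.
rewrite -(ler_pXn2r (ltn0Sn 1)) ?nnegrE ?addr_ge0 ?nrm_ge0//.
rewrite sqrrD !nrm_sqr.
have -> : \sum_(j < d) (u j + v j) ^+ 2 = \sum_(j < d) u j ^+ 2
    + (\sum_(j < d) u j * v j) *+ 2 + \sum_(j < d) v j ^+ 2.
  rewrite -sumrMnl -!big_split/=; apply: eq_bigr => j _; ring.
by rewrite lerD2r lerD2l lerMn2r cauchy_schwarz orbT.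
Qed.

Lemma nrmZ d a (v : 'I_d -> R) : nrm (fun j => a * v j) = `|a| * nrm v.
Proof.
rewrite /nrm -sqrtr_sqr -sqrtrM ?sqr_ge0// mulr_sumr; congr Num.sqrt.
by apply: eq_bigr => j _; rewrite exprMn.
Qed.

Lemma eq_nrm d (u v : 'I_d -> R) : u =1 v -> nrm u = nrm v.
Proof. by move=> uv; congr Num.sqrt; apply: eq_bigr => j _; rewrite uv. Qed.

Lemma nrm0 d : nrm (fun _ : 'I_d => 0) = 0.
Proof. by rewrite /nrm big1 ?sqrtr0// => j _; rewrite expr0n. Qed.

Lemma ler_nrm_sum d (I : finType) (b : I -> R) (v : I -> 'I_d -> R) :
  (forall i, nrm (v i) <= b i) ->
  nrm (fun j => \sum_i v i j) <= \sum_i b i.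
Proof.
move=> vb; apply: (@le_trans _ _ (\sum_i nrm (v i))); last exact: ler_sum.
move: (index_enum I) => r; elim: r => [|i s IH].
  by rewrite big_nil (@eq_nrm _ _ (fun=> 0)) ?nrm0// => j; rewrite big_nil.
rewrite (@eq_nrm _ _ (fun j => v i j + \sum_(i <- s) v i j)); last first.
  by move=> j; rewrite big_cons.
by rewrite big_cons (le_trans (ler_nrmD _ _))// lerD2l.
Qed.

Lemma euclid_distE d (x y : d.-tuple R) :
  euclid_dist x y = nrm (fun j => tnth x j - tnth y j).
Proof. by []. Qed.

Lemma euclid_dist_ge0 d (x y : d.-tuple R) : 0 <= euclid_dist x y.
Proof. exact: nrm_ge0. Qed.

Lemma euclid_distC d (x y : d.-tuple R) : euclid_dist x y = euclid_dist y x.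
Proof.
by rewrite !euclid_distE /nrm; congr Num.sqrt; apply: eq_bigr => j _; rewrite -sqrrN opprB.
Qed.

Lemma euclid_dist_triangle d (y x z : d.-tuple R) :
  euclid_dist x z <= euclid_dist x y + euclid_dist y z.
Proof.
rewrite !euclid_distE (le_trans _ (ler_nrmD _ _))// le_eqVlt; apply/orP; left.
by apply/eqP; apply: eq_nrm => j; rewrite addrA subrK.
Qed.

End Euclid.

(** * Geometric medians and quantile radii *)

Section Median.
Variables (R : realType) (n d : nat) (D : dataset R n d).
Hypothesis n0 : (0 < n)%N.

Definition ball_count (x : d.-tuple R) (s : R) : nat :=
  \sum_(i < n) (euclid_dist (D i) x <= s)%R.

Lemma ball_count_card x s :
  #|[pred i : 'I_n | in_eball x s (D i)]| = ball_count x s.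
Proof.
rewrite -sum1_card /ball_count big_mkcond/=; apply: eq_bigr => i _.
by rewrite inE /in_eball; case: (_ <= _).
Qed.

Lemma ball_count_le x s s' : s <= s' -> (ball_count x s <= ball_count x s')%N.
Proof.
move=> ss'; apply: leq_sum => i _; case: (leP (euclid_dist (D i) x) s) => // h.
by rewrite (le_trans h).
Qed.

Let nR : 0 < n%:R :> R. Proof. by rewrite ltr0n. Qed.

Lemma gm_objective_ge0 x : 0 <= gm_objective D x.
Proof.
rewrite mulr_ge0 ?invr_ge0// sumr_ge0// => i _; exact: euclid_dist_ge0.
Qed.

Lemma gm_objective_lipschitz x y :
  gm_objective D y <= gm_objective D x + euclid_dist x y.
Proof.
rewrite /gm_objective mulrC [n%:R^-1 * _]mulrC ler_pdivrMr// mulrDl divfK ?gt_eqF//.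
rewrite mulrC -[n in n%:R * _]card_ord mulr_natl -sumr_const -big_split/=.
by apply: ler_sum => i _; rewrite addrC (euclid_distC x) euclid_dist_triangle.
Qed.

(** Moving from [xs] to [c] saves at least Delta - 2s on each point of the ball and costs at most
    Delta on any other. With 11/20 of the points in the ball, minimality of [xs] gives (11/10)(Delta
    - s) <= Delta. *)
Lemma median_near_ball xs c s : geometric_median D xs ->
  11 / 20 * n%:R <= (ball_count c s)%:R :> R -> euclid_dist xs c <= 11 * s.
Proof.
move=> /(_ c) med cnt; set Delta := euclid_dist xs c.
have D0 : 0 <= Delta by exact: euclid_dist_ge0.
have [i0 Hi0] : exists i0, euclid_dist (D i0) c <= s.
  apply/not_existsP => h; suff : (ball_count c s)%:R = 0 :> R by have := nR; lra.
  by rewrite /ball_count big1// => i _; apply/eqP; rewrite eqb0; exact/negP/h.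
have s0 : 0 <= s := le_trans (euclid_dist_ge0 _ _) Hi0.
have key : \sum_(i < n) euclid_dist xs (D i) <= \sum_(i < n) euclid_dist c (D i).
  by move: med; rewrite /gm_objective ler_pM2l ?invr_gt0.
have : 0 <= \sum_(i < n) (Delta + (euclid_dist (D i) c <= s)%R%:R * (2 * s - 2 * Delta)).
  rewrite -subr_ge0 -sumrB in key; apply: (le_trans key); apply: ler_sum => i _.
  have h1 := euclid_dist_triangle xs c (D i).
  have h2 := euclid_dist_triangle (D i) xs c.
  rewrite -/Delta in h2; rewrite (euclid_distC c xs) -/Delta in h1.
  case: (leP (euclid_dist (D i) c) s) => h3; last by rewrite /= mulr0n mul0r addr0; lra.
  by rewrite /= mulr1n mul1r (euclid_distC c); lra.
rewrite big_split/= sumr_const card_ord -mulr_suml -natr_sum -/(ball_count c s).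
rewrite -[Delta *+ n]mulr_natl => h.
have [//|h4] := leP Delta (11 * s); exfalso.
move: cnt h nR; set N := (ball_count c s)%:R; set M := n%:R => cnt h nR'.
have : N * (2 * s - 2 * Delta) <= 11 / 20 * M * (2 * s - 2 * Delta).
  by apply: ler_wnM2r => //; lra.
nra.
Qed.

Let rho xs := quantile_radius (9 / 10) D xs.

Let qset xs := [set s : R | 0 <= s /\
  9 / 10 * n%:R <= #|[pred i : 'I_n | in_eball xs s (D i)]|%:R :> R].

Let qset_has_inf xs : has_inf (qset xs).
Proof.
split; last by exists 0 => s [].
exists (\sum_(i < n) euclid_dist (D i) xs); split.
  by apply: sumr_ge0 => i _; exact: euclid_dist_ge0.
rewrite ball_count_card; have -> : ball_count xs (\sum_(i < n) euclid_dist (D i) xs) = n.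
  rewrite -[RHS]card_ord -sum1_card; apply: eq_bigr => i _.
  rewrite (bigD1 i)//= lerDl sumr_ge0// => j _; exact: euclid_dist_ge0.
by have := nR; lra.
Qed.

Lemma quantile_radius_count xs s : rho xs < s ->
  9 / 10 * n%:R <= (ball_count xs s)%:R :> R.
Proof.
move=> /(inf_lt (qset_has_inf xs).1)[t []]; rewrite ball_count_card => t0 h ts.
by rewrite (le_trans h)// ler_nat ball_count_le// ltW.
Qed.

(** Markov's inequality: a radius below the quantile radius leaves out more than a tenth of the
    points, each contributing more than that radius. The midpoint [s] lies below the quantile radius
    and above ten times the objective. *)
Lemma quantile_radius_le xs : rho xs <= 10 * gm_objective D xs.
Proof.
have f0 := gm_objective_ge0 xs.
have [//|h] := leP; exfalso.
pose s := (rho xs + 10 * gm_objective D xs) / 2.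
have s0 : 0 <= s by rewrite /s; lra.
have srho : s < rho xs by rewrite /s; lra.
have cnt : (ball_count xs s)%:R < 9 / 10 * n%:R :> R.
  rewrite ltNge; apply/negP => hc.
  have : rho xs <= s by apply: ge_inf; [exact: (qset_has_inf xs).2|split=> //; rewrite ball_count_card].
  by lra.
have : s * n%:R - s * (ball_count xs s)%:R <= gm_objective D xs * n%:R.
  rewrite /gm_objective [n%:R^-1 * _]mulrC divfK ?gt_eqF//.
  rewrite -[n in s * n%:R]card_ord mulr_natr -sumr_const /ball_count natr_sum mulr_sumr -sumrB.
  apply: ler_sum => i _; rewrite (euclid_distC xs); case: (leP (euclid_dist (D i) xs) s) => h'.
    by rewrite mulr1 subrr euclid_dist_ge0.
  by rewrite mulr0 subr0 ltW.
have hs : 10 * gm_objective D xs < s by rewrite /s; lra.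
move: cnt nR; set N := (ball_count xs s)%:R; set M := n%:R => cnt M0.
nra.
Qed.

(** Average |xs| <= |xs - x_i| + radius over i and compare the objective at [xs] with that at the
    origin. *)
Lemma median_norm (radius : R) xs : bounded_dataset radius D ->
  geometric_median D xs -> euclid_dist xs (origin R d) <= 2 * radius.
Proof.
move=> bD med.
have f0 : gm_objective D (origin R d) <= radius.
  rewrite /gm_objective mulrC ler_pdivrMr// mulrC -[n in n%:R]card_ord mulr_natl -sumr_const.
  by apply: ler_sum => i _; rewrite euclid_distC; exact: bD.
have := gm_objective_lipschitz (origin R d) xs.
have := med (origin R d).
have : euclid_dist xs (origin R d) * n%:R <= (gm_objective D xs + radius) * n%:R.
  rewrite mulrDl /gm_objective [n%:R^-1 * _]mulrC divfK ?gt_eqF//.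
  rewrite -[n in n%:R]card_ord !mulr_natr -!sumr_const -big_split/=.
  apply: ler_sum => i _; rewrite (le_trans (euclid_dist_triangle (D i) _ _))// lerD2l.
  exact: bD.
by rewrite ler_pM2r// => ? ? ?; lra.
Qed.

End Median.

(** * Stability of weighted means *)

Section WeightedMean.
Variables (R : realType) (n d : nat).
Implicit Types (w : 'I_n -> R) (D : dataset R n d).

Definition wmean w D : d.-tuple R :=
  [tuple (\sum_(i < n) w i * tnth (D i) j) / \sum_(i < n) w i | j < d].

Lemma wmean_sub w D (y : d.-tuple R) j : 0 < \sum_(i < n) w i ->
  tnth (wmean w D) j - tnth y j =
  \sum_(i < n) w i / (\sum_(i < n) w i) * (tnth (D i) j - tnth y j).
Proof.
move=> W0; rewrite tnth_mktuple.
have -> : \sum_(i < n) w i / (\sum_(i < n) w i) * (tnth (D i) j - tnth y j) =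
  (\sum_(i < n) w i * tnth (D i) j - (\sum_(i < n) w i) * tnth y j) / (\sum_(i < n) w i).
  rewrite [_ * tnth y j]mulr_suml -sumrB mulr_suml.
  by apply: eq_bigr => i _; ring.
by rewrite mulrBl [_ * tnth y j]mulrC mulfK// gt_eqF.
Qed.

Lemma nrm_scaled_le k (c b : R) (v : 'I_k -> R) :
  (c != 0 -> nrm v <= b) -> nrm (fun j => c * v j) <= `|c| * b.
Proof.
move=> h; rewrite nrmZ; have [->|/h] := eqVneq c 0; first by rewrite normr0 !mul0r.
exact: ler_wpM2l.
Qed.

Lemma wmean_dist w D y b : (forall i, 0 <= w i) -> 0 < \sum_(i < n) w i ->
  (forall i, w i != 0 -> euclid_dist (D i) y <= b) -> euclid_dist (wmean w D) y <= b.
Proof.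
move=> w0 W0 h; rewrite euclid_distE (eq_nrm (wmean_sub D y ^~ W0)).
have -> : b = \sum_(i < n) (w i / (\sum_(i < n) w i)) * b.
  by rewrite -mulr_suml -mulr_suml divff ?mul1r// gt_eqF.
apply: ler_nrm_sum => i.
have wW : 0 <= w i / (\sum_(i < n) w i) by rewrite divr_ge0// ltW.
rewrite -[X in _ <= X * _]ger0_norm//; apply: nrm_scaled_le.
by rewrite mulf_eq0 negb_or => /andP[/h].
Qed.

(* Measured from [y], the change splits into the effect of the normalization and
   that of the weights, each at most [b] times the variation of the weights. *)
Lemma wmean_stable w w' D D' i0 y b :
  (forall i, 0 <= w i) -> (forall i, 0 <= w' i) ->
  0 < \sum_(i < n) w i -> 0 < \sum_(i < n) w' i -> 0 <= b ->
  (forall i, i != i0 -> D i = D' i) ->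
  (forall i, w i != 0 -> euclid_dist (D i) y <= b) ->
  (forall i, w' i != 0 -> euclid_dist (D' i) y <= b) ->
  euclid_dist (wmean w D) (wmean w' D') <=
  2 * b * (\sum_(i < n | i != i0) `|w i - w' i| + w i0 + w' i0) / \sum_(i < n) w' i.
Proof.
move=> w0 w'0 W0 W'0 b0 DD' h h'.
set W := \sum_(i < n) w i; set W' := \sum_(i < n) w' i.
set V := \sum_(i < n | i != i0) `|w i - w' i| + w i0 + w' i0.
pose A i j := w i * (W^-1 - W'^-1) * (tnth (D i) j - tnth y j).
pose B i j := W'^-1 * (w i * (tnth (D i) j - tnth y j) - w' i * (tnth (D' i) j - tnth y j)).
have WW' : `|W - W'| <= V.
  rewrite /W /W' (bigD1 i0)//= [X in _ - X](bigD1 i0)//= /V.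
  have -> : w i0 + \sum_(i < n | i != i0) w i - (w' i0 + \sum_(i < n | i != i0) w' i)
    = \sum_(i < n | i != i0) (w i - w' i) + (w i0 - w' i0) by rewrite sumrB; ring.
  rewrite (le_trans (ler_normD _ _))// -addrA lerD ?ler_norm_sum//.
  by rewrite (le_trans (ler_normB _ _))// !ger0_norm.
have nA : nrm (fun j => \sum_i A i j) <= V * b / W'.
  apply: (@le_trans _ _ (\sum_i w i * `|W^-1 - W'^-1| * b)).
    apply: ler_nrm_sum => i.
    rewrite -[X in X * _ * b]ger0_norm// -normrM; apply: nrm_scaled_le.
    by rewrite mulf_eq0 negb_or => /andP[/h].
  rewrite -!mulr_suml -/W.
  have -> : W^-1 - W'^-1 = (W' - W) / W / W'.
    by field; rewrite !gt_eqF.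
  rewrite !normrM !normfV (gtr0_norm W0) (gtr0_norm W'0) distrC.
  have -> : W * (`|W - W'| / W / W') * b = `|W - W'| * b / W'.
    by field; rewrite !gt_eqF.
  by rewrite ler_pM2r ?invr_gt0// ler_wpM2r.
have nB : nrm (fun j => \sum_i B i j) <= V * b / W'.
  have -> : V * b / W' = \sum_i W'^-1 *
     ((if i == i0 then w i0 + w' i0 else `|w i - w' i|) * b).
    rewrite -mulr_sumr -mulr_suml (bigD1 i0)//= eqxx.
    rewrite (eq_bigr (fun i => `|w i - w' i|)); last by move=> i /negbTE ->.
    by rewrite /V; ring.
  apply: ler_nrm_sum => i; rewrite nrmZ gtr0_norm ?invr_gt0// ler_pM2l ?invr_gt0//.
  case: eqVneq => [->|ii0].
    rewrite (@eq_nrm _ _ _ (fun j => w i0 * (tnth (D i0) j - tnth y j)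
        + - w' i0 * (tnth (D' i0) j - tnth y j))); last by move=> j; rewrite mulNr.
    rewrite (le_trans (ler_nrmD _ _))// mulrDl lerD//.
      rewrite -[X in _ <= X * _]ger0_norm//; apply: nrm_scaled_le; exact: h.
    rewrite -[X in _ <= X * _]ger0_norm// -normrN; apply: nrm_scaled_le.
    by rewrite oppr_eq0; exact: h'.
  rewrite (@eq_nrm _ _ _ (fun j => (w i - w' i) * (tnth (D i) j - tnth y j))); last first.
    by move=> j; rewrite mulrBl -DD'.
  apply: nrm_scaled_le => ww'.
  (* If [w i] vanishes, then [w' i] does not, and the point i is the same in both data sets. *)
  have [wi0|/h//] := eqVneq (w i) 0.
  rewrite -euclid_distE DD'//; apply: h'.
  by apply: contraNneq ww' => ->; rewrite wi0 subrr.
have -> : 2 * b * V / W' = V * b / W' + V * b / W' by ring.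
rewrite euclid_distE (@eq_nrm _ _ _ (fun j => \sum_i A i j + \sum_i B i j)).
  by rewrite (le_trans (ler_nrmD _ _))// lerD.
move=> j.
have -> : tnth (wmean w D) j - tnth (wmean w' D') j =
  (tnth (wmean w D) j - tnth y j) - (tnth (wmean w' D') j - tnth y j) by ring.
rewrite !wmean_sub// -/W -/W' -sumrB -big_split/=; apply: eq_bigr => i _.
by rewrite /A /B; ring.
Qed.

End WeightedMean.

(** * Degrees along random shifts *)

Section Degrees.
Variables (R : realType) (p d : nat).
Local Notation n := p.+1.
Implicit Types (D : dataset R n d) (T : seq nat) (s : R).

Definition cyc (i : 'I_n) (t : nat) : 'I_n := inZp (i + t).

Lemma cycE i (t : 'I_n) : cyc i t = (i + t)%R.
Proof. by apply: val_inj. Qed.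

(** From a fixed point, a uniform shift leads to a uniform point: the comparisons of one point are
    independent samples of the data. *)
Lemma sum_cyc_l (F : 'I_n -> nat) i : (\sum_(t < n) F (cyc i t) = \sum_j F j)%N.
Proof.
rewrite [RHS](reindex_inj (addrI i)); apply: eq_bigr => t _; by rewrite cycE.
Qed.

(** Along a fixed shift each point is reached exactly once: this bounds the influence of one data
    point without any randomness. *)
Lemma sum_cyc_r (F : 'I_n -> nat) t : (\sum_(i < n) F (cyc i t) = \sum_j F j)%N.
Proof.
rewrite [RHS](reindex_inj (addIr (inZp t : 'I_n))); apply: eq_bigr => i _; congr F.
by apply: val_inj; rewrite /= modnDmr.
Qed.

Definition near_pt D s (i j : 'I_n) : bool := euclid_dist (D i) (D j) <= s.

Definition deg D s T (i : 'I_n) : nat := (\sum_(t <- T) near_pt D s i (cyc i t))%N.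

Definition score D s T : nat := (\sum_(i < n) deg D s T i)%N.

Lemma deg_le_size D s T i : (deg D s T i <= size T)%N.
Proof. by rewrite -sum1_size; apply: leq_sum => t _; case: near_pt. Qed.

Lemma score_full D s T : (forall i j, euclid_dist (D i) (D j) <= s) ->
  score D s T = (n * size T)%N.
Proof.
move=> h; rewrite /score (eq_bigr (fun=> size T)); last first.
  by move=> i _; rewrite -sum1_size; apply: eq_bigr => t _; rewrite /near_pt h.
by rewrite sum_nat_const card_ord.
Qed.

Lemma score_swap D s T : score D s T = (\sum_(t <- T) \sum_(i < n) near_pt D s i (cyc i t))%N.
Proof. by rewrite /score /deg exchange_big. Qed.

(** If i and i + t are both in the ball, they are within [s] of each other. Inclusion-exclusion
    leaves at least 2 (9/10) n - n = (4/5) n such i for every shift. *)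
Lemma score_concentrated D x s T : 9 / 10 * n%:R <= (ball_count D x (s / 2))%:R :> R ->
  4 / 5 * n%:R * (size T)%:R <= (score D s T)%:R :> R.
Proof.
move=> h; rewrite score_swap natr_sum -[size T]sum1_size natr_sum mulr_sumr.
apply: ler_sum => t _; rewrite mulr1.
pose a i : nat := (euclid_dist (D i) x <= s / 2)%R.
have : (\sum_(i < n) (a i + a (cyc i t)) <= \sum_(i < n) (near_pt D s i (cyc i t) + 1))%N.
  apply: leq_sum => i _; rewrite /a /near_pt.
  case: (leP (euclid_dist (D i) x)) => h1; last first.
    by rewrite add0n addnC; apply: leq_trans (leq_addr _ _); case: (_ <= _).
  case: (leP (euclid_dist (D (cyc i t)) x)) => h2; last by rewrite addn0 addnC leq_addr.
  have := euclid_dist_triangle x (D i) (D (cyc i t)).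
  rewrite (euclid_distC x) => h3; suff -> : euclid_dist (D i) (D (cyc i t)) <= s by [].
  lra.
rewrite !big_split/= sum_cyc_r sum_nat_const card_ord muln1 -(ler_nat R) !natrD.
rewrite -/(ball_count D x (s / 2)); lra.
Qed.

(** Along one shift [i0] enters two comparisons, once as origin and once as target. *)
Lemma score_sensitivity D D' i0 s T : (forall j, j != i0 -> D j = D' j) ->
  (score D s T <= score D' s T + 2 * size T)%N.
Proof.
move=> DD'; rewrite !score_swap -[size T]sum1_size big_distrr -big_split/=.
apply: leq_sum => t _; rewrite muln1.
apply: (@leq_trans (\sum_(i < n) (near_pt D' s i (cyc i t) + ((i == i0) + (cyc i t == i0))))).
  apply: leq_sum => i _; rewrite /near_pt.
  have [->|ii0] := eqVneq i i0; first by rewrite (leq_trans (leq_b1 _))// addnCA leq_addr.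
  have [->|ti0] := eqVneq (cyc i t) i0; first by rewrite (leq_trans (leq_b1 _))// !addnA leq_addl.
  by rewrite !DD'// addn0.
rewrite !big_split/= (sum_cyc_r (fun j => (j == i0) : nat)) leq_add2l.
rewrite (bigD1 i0)//= eqxx big1; first by [].
by move=> i /negbTE ->.
Qed.

(** The event that Chernoff's bound excludes, for all points at once. Outside it, every point of
    positive weight is the centre of a ball with a majority of the data. *)
Definition bad_shifts D s q T : bool :=
  [exists i : 'I_n, ((ball_count D (D i) s)%:R < 11 / 20 * n%:R :> R) && (2 * q <= deg D s T i)%N].

Lemma ball_countE D s i : ball_count D (D i) s = (\sum_(t < n) near_pt D s i (cyc i t))%N.
Proof.
rewrite (sum_cyc_l (fun j => near_pt D s i j : nat)).
by apply: eq_bigr => j _; rewrite /near_pt euclid_distC.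
Qed.

Lemma ravg_bad_shifts D s q :
  ravg p (3 * q) (fun T => (bad_shifts D s q T)%:R) <= n%:R * (12 / 13) ^+ q :> R.
Proof.
pose b (i : 'I_n) T := ((ball_count D (D i) s)%:R < 11 / 20 * n%:R :> R) && (2 * q <= deg D s T i)%N.
apply: (@le_trans _ _ (ravg p (3 * q) (fun T => \sum_(i < n) (b i T)%:R))).
  apply: ler_ravg => T _ _; rewrite /bad_shifts.
  case: existsP => [[i bi]|_]; last by rewrite sumr_ge0.
  by rewrite (bigD1 i)//= /b bi lerDl sumr_ge0.
rewrite ravg_sum -[n in n%:R]card_ord mulr_natl -sumr_const; apply: ler_sum => i _.
rewrite /b; case: ltP => h /=; last first.
  by rewrite ravg_cst exprn_ge0//; lra.
apply: (@ravg_tail R p q (fun t => near_pt D s i (cyc i t))).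
by rewrite -ball_countE ltW.
Qed.

(* Truncated subtraction: only points of degree above [2 * q] get weight. *)
Definition cweight D s q T (i : 'I_n) : R := (deg D s T i - 2 * q)%N%:R.

Definition core_mean D s q T : d.-tuple R := wmean (cweight D s q T) D.

Lemma cweight_ge0 D s q T i : 0 <= cweight D s q T i.
Proof. exact: ler0n. Qed.

Lemma cweight_le D s q T i : size T = (3 * q)%N -> cweight D s q T i <= q%:R.
Proof.
move=> sT; rewrite ler_nat; have := deg_le_size D s T i; rewrite sT; lia.
Qed.

Lemma cweight_ball D s q T i : ~~ bad_shifts D s q T -> cweight D s q T i != 0 ->
  11 / 20 * n%:R <= (ball_count D (D i) s)%:R :> R.
Proof.
move=> /existsPn/(_ i); rewrite negb_and -leNgt => /orP[//|h].
by rewrite pnatr_eq0 subn_eq0 -ltnNge => /ltnW h'; rewrite h' in h.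
Qed.

Lemma sum_cweight D s q T : (score D s T)%:R - 2 * q%:R * n%:R <= \sum_i cweight D s q T i.
Proof.
rewrite -natr_sum lerBlDr -natrM -natrM -natrD ler_nat /score.
have -> : (2 * q * n = \sum_(i < n) 2 * q)%N by rewrite sum_nat_const card_ord mulnC.
rewrite -big_split/=.
by apply: leq_sum => i _; rewrite addnC -leq_subLR.
Qed.

(** Two sets with at least n + 2 members in total share at least two indices, one of which differs
    from [i0]. *)
Lemma overlap (a b : 'I_n -> bool) i0 : (n + 1 < \sum_i a i + \sum_i b i)%N ->
  exists j, [/\ j != i0, a j & b j].
Proof.
move=> h; apply/not_existsP => no.
suff : (\sum_i a i + \sum_i b i <= n + 1)%N by rewrite leqNgt h.
rewrite -big_split/=; apply: (@leq_trans (\sum_(i < n) (1 + (i == i0)))).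
  apply: leq_sum => i _; have [->|ii0] := eqVneq i i0.
    by rewrite (@leq_add _ _ 1 1)// leq_b1.
  by have := no i; rewrite ii0; case: (a i); case: (b i) => // -[].
rewrite big_split/= sum_nat_const card_ord muln1 leq_add2l (bigD1 i0)//= eqxx big1//.
by move=> i /negbTE ->.
Qed.

(** A point in both balls is within [s] of both centres; asking that it differ from [i0] lets the
    two balls come from neighbouring data sets. The case D = D' serves inside one data set. *)
Lemma overlap_dist D D' i0 s x y : (50 <= n)%N -> (forall j, j != i0 -> D j = D' j) ->
  11 / 20 * n%:R <= (ball_count D x s)%:R :> R ->
  11 / 20 * n%:R <= (ball_count D' y s)%:R :> R ->
  euclid_dist x y <= 2 * s.
Proof.
move=> n50 DD' hx hy.
have [j [jj0 hjx hjy]] : exists j, [/\ j != i0, euclid_dist (D j) x <= s & euclid_dist (D' j) y <= s].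
  apply: overlap; rewrite -(ltr_nat R) !natrD -/(ball_count D x s) -/(ball_count D' y s).
  have : 50 <= n%:R :> R by rewrite (ler_nat R 50).
  lra.
have := euclid_dist_triangle (D j) x y.
by rewrite {2}DD'// (euclid_distC x (D j)) => h; lra.
Qed.

(** The degree of i changes only along the shifts that carry i to [i0], and each shift carries a
    single index there. Truncated subtraction does not enlarge differences. *)
Lemma cweight_sensitivity D D' i0 s q T : (forall j, j != i0 -> D j = D' j) ->
  \sum_(i < n | i != i0) `|cweight D s q T i - cweight D' s q T i| <= (size T)%:R.
Proof.
move=> DD'.
apply: (@le_trans _ _ (\sum_(i < n) (\sum_(t <- T) (cyc i t == i0))%N%:R)).
  rewrite big_mkcond/=; apply: ler_sum => i _; case: ifPn => // ii0.
  have h1 E E' : (forall j, j != i0 -> E j = E' j) ->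
      (deg E s T i <= deg E' s T i + \sum_(t <- T) (cyc i t == i0))%N.
    move=> EE'; rewrite /deg -big_split/=; apply: leq_sum => t _; rewrite /near_pt.
    have [->|ti0] := eqVneq (cyc i t) i0; first by rewrite (leq_trans (leq_b1 _))// leq_addl.
    by rewrite !EE'// addn0.
  have := h1 _ _ DD'; have := h1 D' D (fun j jj => esym (DD' j jj)).
  rewrite /cweight; set S := (\sum_(t <- T) _)%N; set a := deg _ _ _ _; set a' := deg _ _ _ _.
  move=> u v; rewrite ler_distl -!natrD; apply/andP; split.
    by rewrite lerBlDr -natrD ler_nat; lia.
  by rewrite ler_nat; lia.
rewrite -natr_sum exchange_big/= ler_nat -[leqRHS]sum1_size; apply: leq_sum => t _.
rewrite (sum_cyc_r (fun j => (j == i0) : nat)) (bigD1 i0)//= eqxx big1//.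
by move=> i /negbTE ->.
Qed.

(** [wmean_stable] with b = 2s, weight variation at most 5q and total weight at least qn/10, since 2
    (2s)(5q) / (qn/10) = 200 s/n. *)
Lemma core_mean_stable D D' i0 s q T : (50 <= n)%N -> (0 < q)%N -> size T = (3 * q)%N ->
  (forall j, j != i0 -> D j = D' j) ->
  ~~ bad_shifts D s q T -> ~~ bad_shifts D' s q T ->
  11 / 5 * q%:R * n%:R <= (score D s T)%:R :> R ->
  euclid_dist (core_mean D s q T) (core_mean D' s q T) <= 200 * s / n%:R.
Proof.
move=> n50 q0 sT DD' bD bD' hQ.
have n50R : 50 <= n%:R :> R by rewrite (ler_nat R 50).
have q0R : 0 < q%:R :> R by rewrite ltr0n.
pose w := cweight D s q T; pose w' := cweight D' s q T.
pose V := \sum_(i < n | i != i0) `|w i - w' i| + w i0 + w' i0.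
(* 3q from the points other than [i0], one per shift, and q from each version of [i0]. *)
have V5 : V <= 5 * q%:R.
  have := cweight_sensitivity s q T DD'; rewrite sT natrM -/w -/w'.
  have := cweight_le D s i0 sT; have := cweight_le D' s i0 sT.
  rewrite -/w -/w' /V; lra.
have hW : 1 / 5 * q%:R * n%:R <= \sum_i w i.
  by have := sum_cweight D s q T; rewrite -/w; lra.
have hW' : \sum_i w i - V <= \sum_i w' i.
  rewrite (bigD1 i0)//= [X in _ <= X](bigD1 i0)//= /V.
  have : \sum_(i < n | i != i0) (w i - `|w i - w' i|) <= \sum_(i < n | i != i0) w' i.
    by apply: ler_sum => i _; rewrite lerBlDr -lerBlDl ler_norm.
  rewrite sumrB => h; have := cweight_ge0 D' s q T i0; rewrite -/w' => h'; lra.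
have W0 : 0 < \sum_i w i by rewrite (lt_le_trans _ hW)// !mulr_gt0//; lra.
(* Here n >= 50 enters: the loss 5q is at most half of qn/5. *)
have hW'2 : 1 / 10 * q%:R * n%:R <= \sum_i w' i.
  apply: le_trans hW'; apply: (@le_trans _ _ (1 / 5 * q%:R * n%:R - 5 * q%:R)); last lra.
  by nra.
have W'0 : 0 < \sum_i w' i by rewrite (lt_le_trans _ hW'2)// !mulr_gt0//; lra.
(* The reference point of [wmean_stable]. It exists because one weight is at most q < qn/5; all
   weighted points of both data sets are within 2s of it, by overlap of their balls. *)
have [i1 [i10 wi1]] : exists i1, i1 != i0 /\ w i1 != 0.
  apply/not_existsP => no.
  have : \sum_i w i <= q%:R.
    rewrite (bigD1 i0)//= big1 ?addr0; first exact: cweight_le.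
    by move=> i ii0; apply/eqP/negPn/negP => h; apply: (no i).
  have : q%:R < 1 / 5 * q%:R * n%:R :> R by nra.
  lra.
have by1 := cweight_ball bD wi1.
have s0 : 0 <= s.
  rewrite leNgt; apply/negP => s0; move: by1.
  rewrite /ball_count big1 => [|i _]; first by lra.
  by apply/eqP; rewrite eqb0 -ltNge (lt_le_trans s0)// euclid_dist_ge0.
have := @wmean_stable R n d w w' D D' i0 (D i1) (2 * s)
  (cweight_ge0 D s q T) (cweight_ge0 D' s q T) W0 W'0 _ DD'.
rewrite -/V -/(core_mean D s q T) -/(core_mean D' s q T) => h.
apply: (le_trans (h _ _ _)).
- by lra.
- by move=> i wi; apply: (@overlap_dist D D i0) => //; exact: cweight_ball wi.
- move=> i wi; rewrite euclid_distC; apply: (@overlap_dist D D' i0) => //.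
  exact: cweight_ball wi.
rewrite ler_pdivrMr//.
apply: (@le_trans _ _ (200 * s / n%:R * (1 / 10 * q%:R * n%:R))); last first.
  by rewrite ler_wpM2l// divr_ge0// mulr_ge0.
have -> : 200 * s / n%:R * (1 / 10 * q%:R * n%:R) = 20 * (s * q%:R).
  by field; rewrite gt_eqF//; lra.
by nra.
Qed.

Lemma core_mean_near_median D s q T xs : size T = (3 * q)%N -> (0 < q)%N ->
  geometric_median D xs -> ~~ bad_shifts D s q T ->
  11 / 5 * q%:R * n%:R <= (score D s T)%:R :> R ->
  euclid_dist (core_mean D s q T) xs <= 11 * s.
Proof.
move=> sT q0 med bD hQ.
have q0R : 0 < q%:R :> R by rewrite ltr0n.
have n0R : 0 < n%:R :> R by rewrite ltr0n.
apply: wmean_dist.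
- exact: cweight_ge0.
- have := sum_cweight D s q T; have : 0 < q%:R * n%:R :> R by rewrite mulr_gt0.
  by lra.
- move=> i wi; rewrite euclid_distC; apply: (@median_near_ball R n d D) => //.
  exact: (cweight_ball bD wi).
Qed.

End Degrees.

(** * The mechanism, its privacy and its utility *)

Section ExponentialMechanism.
Variables (R : realType) (K : nat) (b lo hi : R).
Hypothesis b0 : 0 <= b.
Implicit Type Q : nat -> R.

Definition prev Q k : R := if k is k'.+1 then Q k' else 0.

(** With x = b (Q k - lo) and y = b (hi - Q (k - 1)), 1 / (e^(-x) + e^(-y)) is e^(min(x, y)) up to a
    factor 2: the exponential mechanism for the distance to the nearer threshold, in a form without
    a minimum. *)
Definition ew Q k : R := (expR (- (b * (Q k - lo))) + expR (- (b * (hi - prev Q k))))^-1.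

Definition em_bad Q k : bool := (Q k <= lo) || (hi <= prev Q k).

Definition em_prob Q k : R := ew Q k / \sum_(k < K.+1) ew Q k.

Lemma ew_gt0 Q k : 0 < ew Q k.
Proof. by rewrite invr_gt0 addr_gt0 ?expR_gt0. Qed.

Lemma sum_ew_gt0 Q : 0 < \sum_(k < K.+1) ew Q k.
Proof.
rewrite big_ord_recl ltr_pwDl ?ew_gt0// sumr_ge0// => k _; exact/ltW/ew_gt0.
Qed.

Lemma em_prob_ge0 Q k : 0 <= em_prob Q k.
Proof. by rewrite divr_ge0// ltW ?ew_gt0 ?sum_ew_gt0. Qed.

Lemma sum_em_prob Q : \sum_(k < K.+1) em_prob Q k = 1.
Proof. by rewrite -mulr_suml divff// gt_eqF// sum_ew_gt0. Qed.

Lemma ew_ratio Q Q' c k : 0 <= c -> (forall k, `|Q k - Q' k| <= c) ->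
  ew Q k <= expR (b * c) * ew Q' k.
Proof.
move=> c0 QQ'; have pQQ' : `|prev Q k - prev Q' k| <= c.
  by case: k => [|k] /=; rewrite ?subrr ?normr0.
rewrite /ew -[expR (b * c)]invrK -expRN -invfM lef_pV2 ?posrE ?mulr_gt0 ?addr_gt0 ?expR_gt0//.
rewrite mulrDr -!expRD lerD// ler_expR -mulNr -[X in _ + X]mulNr -mulrDr mulNr.
  move: (QQ' k); rewrite ler_norml => /andP[_ h].
  by rewrite lerN2 ler_wpM2l//; lra.
move: pQQ'; rewrite ler_norml => /andP[h _].
by rewrite lerN2 ler_wpM2l//; lra.
Qed.

(** One factor e^(b c) comes from the weight, the other from the normalization. *)
Lemma em_prob_ratio Q Q' c k : 0 <= c -> (forall k, `|Q k - Q' k| <= c) ->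
  em_prob Q k <= expR (2 * b * c) * em_prob Q' k.
Proof.
move=> c0 QQ'.
have h1 := ew_ratio k c0 QQ'.
have h2 : \sum_(k < K.+1) ew Q' k <= expR (b * c) * \sum_(k < K.+1) ew Q k.
  rewrite mulr_sumr; apply: ler_sum => j _; apply: ew_ratio => // i; by rewrite distrC.
rewrite /em_prob ler_pdivrMr ?sum_ew_gt0//.
apply: (le_trans h1).
have -> : expR (2 * b * c) = expR (b * c) * expR (b * c) by rewrite -expRD; congr expR; ring.
have e0 := expR_gt0 (b * c); have w0 := ew_gt0 Q' k; have Z0 := sum_ew_gt0 Q'.
set E := expR _ in h1 h2 e0 *; set Z := \sum_(k < _) ew Q k in h2 *.
set Z' := \sum_(k < _) ew Q' k in h2 Z0 *.
have -> : E * E * (ew Q' k / Z') * Z = E * ew Q' k * (E * Z / Z') by ring.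
apply: ler_peMr; first by rewrite mulr_ge0// ltW.
by rewrite ler_pdivlMr// mul1r.
Qed.

Lemma em_bad_ew Q k : em_bad Q k -> ew Q k <= 1.
Proof.
move=> h; rewrite invf_le1 ?addr_gt0 ?expR_gt0//.
have e1 := expR_gt0 (- (b * (Q k - lo))); have e2 := expR_gt0 (- (b * (hi - prev Q k))).
case/orP: h => h.
  have : 1 <= expR (- (b * (Q k - lo))).
    by rewrite -[leLHS]expR0 ler_expR -mulrN mulr_ge0//; lra.
  lra.
have : 1 <= expR (- (b * (hi - prev Q k))).
  by rewrite -[leLHS]expR0 ler_expR -mulrN mulr_ge0//; lra.
lra.
Qed.

(* The first [k] with [mid <= Q k] is far from both thresholds. *)
Lemma em_best Q mid g : 0 <= mid -> mid - lo >= g -> hi - mid >= g -> mid <= Q K ->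
  exists2 k, (k <= K)%N & expR (b * g) / 2 <= ew Q k.
Proof.
move=> m0 h1 h2 QK.
have ex : exists k, (k <= K)%N && (mid <= Q k) by exists K; rewrite leqnn.
have [k /andP[kK mk] kmin] := ex_minnP ex; exists k => //.
have pk : prev Q k <= mid.
  case: k kK kmin {mk} => [//|k] kK kmin /=.
  rewrite leNgt; apply/negP => /ltW h.
  by have := kmin k; rewrite h (ltnW kK) ltnn => /(_ isT).
rewrite -[leLHS]invrK invf_div lef_pV2 ?posrE ?divr_gt0 ?addr_gt0 ?expR_gt0//.
rewrite -expRN mulr2n mulrDl mul1r lerD// ler_expR lerN2 ler_wpM2l//; lra.
Qed.

(** At most K + 1 bad indices of weight at most 1 stand against one index of weight at least e^(b g)
    / 2. *)
Lemma em_bad_prob Q mid g : 0 <= mid -> mid - lo >= g -> hi - mid >= g -> mid <= Q K ->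
  \sum_(k < K.+1 | em_bad Q k) em_prob Q k <= 2 * K.+1%:R * expR (- (b * g)).
Proof.
move=> m0 h1 h2 QK; have [k0 k0K hk0] := em_best m0 h1 h2 QK.
have Z0 := sum_ew_gt0 Q.
have Zk : expR (b * g) / 2 <= \sum_(k < K.+1) ew Q k.
  apply: (le_trans hk0); rewrite (bigD1 (Ordinal (k0K : (k0 < K.+1)%N)))//= lerDl.
  by apply: sumr_ge0 => k _; exact/ltW/ew_gt0.
rewrite -mulr_suml ler_pdivrMr//.
apply: (@le_trans _ _ K.+1%:R).
  have -> : K.+1%:R = \sum_(k < K.+1) 1 :> R by rewrite sumr_const card_ord.
  rewrite big_mkcond/=; apply: ler_sum => k _.
  by case: ifP => // /em_bad_ew.
apply: (@le_trans _ _ (2 * K.+1%:R * expR (- (b * g)) * (expR (b * g) / 2))).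
  rewrite expRN; set e := expR _; have : e != 0 by rewrite gt_eqF// expR_gt0.
  by move=> e0; rewrite le_eqVlt; apply/orP; left; apply/eqP; field.
by rewrite ler_wpM2l// !mulr_ge0// expR_ge0.
Qed.
End ExponentialMechanism.

(** * The mechanism and its privacy *)

Section Mechanism.
Variables (R : realType) (p d : nat) (r tau b : R) (K q : nat).
Local Notation n := p.+1.
Implicit Types (D : dataset R n d) (T : seq nat) (s : R) (c : d.-tuple R).

Definition lo : R := 11 / 5 * q%:R * n%:R.
Definition hi : R := 12 / 5 * q%:R * n%:R.
Definition scale (k : nat) : R := r * 2 ^+ k.
Definition qscore D T (k : nat) : R := (score D (scale k) T)%:R.
Definition scale_prob D T k : R := em_prob K b lo hi (qscore D T) k.
Definition scale_bad D T k : bool := em_bad lo hi (qscore D T) k.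

Definition noisy c s (g : seq R) : d.-tuple R * R :=
  ([tuple tnth c j + s * tau * nth 0 g j | j < d], s).

Lemma measurable_noisy c s : measurable_fun setT (fun g : d.-tuple R => noisy c s g).
Proof.
apply/measurable_fun_pairP; split; last exact: measurable_cst.
apply/measurable_fun_tnthP => j.
rewrite (_ : _ \o _ = fun g : d.-tuple R => tnth c j + s * tau * tnth g j); last first.
  by apply/funext => g; rewrite /= tnth_mktuple -tnth_nth.
apply: measurable_funD => //; apply: measurable_funM => //; exact: measurable_tnth.
Qed.

Definition noisy_law c s (E : set (d.-tuple R * R)) : \bar R :=
  gauss R d [set g : d.-tuple R | E (noisy c s g)].

Lemma measurable_noisy_pre c s (E : set (d.-tuple R * R)) : measurable E ->
  measurable [set g : d.-tuple R | E (noisy c s g)].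
Proof. by move=> mE; rewrite -[X in measurable X]setTI; exact: (measurable_noisy c s). Qed.

Lemma is_prob_noisy c s : is_prob (noisy_law c s).
Proof.
pose X := HB.pack_for {mfun d.-tuple R >-> (d.-tuple R * R)%type} (fun g : d.-tuple R => noisy c s g)
  (isMeasurableFun.Build _ _ _ _ _ (measurable_noisy c s)).
by exists (distribution (gauss R d) X).
Qed.

(** The law in the form suited to analysis: selection is a finite mixture and the noise a single
    Gaussian measure. [main_lawE] identifies it with the law of a run. *)
Definition mech D (E : set (d.-tuple R * R)) : \bar R :=
  eavg p (3 * q) (fun T => \sum_(k < K.+1)
    (scale_prob D T k)%:E * noisy_law (core_mean D (scale k) q T) (scale k) E)%E.

Lemma is_prob_mech D : is_prob (mech D).
Proof.
apply: is_prob_eavg => T; apply: (@is_prob_sum _ _ _ K.+1 (scale_prob D T)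
  (fun k => noisy_law (core_mean D (scale k) q T) (scale k))).
- by move=> k; exact: em_prob_ge0.
- exact: sum_em_prob.
- by move=> k; exact: is_prob_noisy.
Qed.

Definition rnoisy c s E : R := fine (noisy_law c s E).

Lemma rnoisyE c s E : measurable E -> noisy_law c s E = (rnoisy c s E)%:E.
Proof.
move=> mE; rewrite /rnoisy fineK//; apply: fin_num_measure.
exact: measurable_noisy_pre.
Qed.

Lemma rnoisy_ge0 c s E : 0 <= rnoisy c s E.
Proof. by rewrite fine_ge0// measure_ge0. Qed.

Lemma rnoisy_le1 c s E : measurable E -> rnoisy c s E <= 1.
Proof.
move=> mE; rewrite -lee_fin -rnoisyE//; apply: probability_le1.
exact: measurable_noisy_pre.
Qed.

Lemma mechE D E : measurable E -> mech D E = (ravg p (3 * q) (fun T => \sum_(k < K.+1)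
    scale_prob D T k * rnoisy (core_mean D (scale k) q T) (scale k) E))%:E.
Proof.
move=> mE; rewrite -eavg_EFin; apply: eq_eavg => T _ _; rewrite -sumEFin.
by apply: eq_bigr => k _; rewrite EFinM rnoisyE.
Qed.

(** The displacement 200 s / n in units of the noise deviation s tau; the scale cancels. *)
Definition noise_ratio : R := 200 / (n%:R * tau).

(** Changing the centre from c' to c amounts to shifting the Gaussian by (c - c') / (s tau). *)
Lemma rnoisy_shift c c' s a l E : measurable E -> 0 < s -> 0 < tau -> 0 <= l ->
  euclid_dist c c' <= 200 * s / n%:R ->
  rnoisy c s E <= expR a * rnoisy c' s E +
    expR (l * (1 + l) / 2 * noise_ratio ^+ 2 - l * a).
Proof.
move=> mE s0 t0 l0 cc'.
pose v : d.-tuple R := [tuple (tnth c j - tnth c' j) / (s * tau) | j < d].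
have st0 : s * tau != 0 by rewrite gt_eqF// mulr_gt0.
have -> : rnoisy c s E = fine (gauss R d [set g : d.-tuple R | E (noisy c' s (tadd g v))]).
  congr (fine (gauss R d _)); apply/seteqP.
  suff e (g : d.-tuple R) : noisy c s g = noisy c' s (tadd g v) by split=> g /=; rewrite e.
  congr pair; apply: eq_from_tnth => j; rewrite !tnth_mktuple.
  by rewrite -!tnth_nth !tnth_mktuple; field; rewrite !gt_eqF.
have mB := measurable_noisy_pre c' s mE.
have mB' : measurable [set g : d.-tuple R | E (noisy c' s (tadd g v))].
  by rewrite -[X in measurable X]setTI; apply: (measurable_tadd v _ mB).
have := gauss_shift_le v a mB l0.
rewrite -[X in (_ <= _ * X + _)%E]/(noisy_law c' s E) rnoisyE//.
rewrite -[X in (X <= _)%E]fineK ?fin_num_measure// -EFinM -EFinD lee_fin => h.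
apply: (le_trans h); rewrite lerD2l ler_expR lerD2r ler_wpM2l//.
  by rewrite divr_ge0// mulr_ge0// addr_ge0.
have -> : \sum_(j < d) tnth v j ^+ 2 = (euclid_dist c c' / (s * tau)) ^+ 2.
  rewrite exprMn exprVn euclid_distE nrm_sqr mulr_suml; apply: eq_bigr => j _.
  by rewrite tnth_mktuple exprMn exprVn.
have t0' := ltW t0.
apply: lerXn2r; rewrite ?nnegrE.
- by rewrite divr_ge0 ?mulr_ge0 ?euclid_dist_ge0 ?ltW.
- by rewrite divr_ge0 ?mulr_ge0.
rewrite ler_pdivrMr ?mulr_gt0//; apply: (le_trans cc').
rewrite le_eqVlt; apply/orP; left; apply/eqP; rewrite /noise_ratio.
by field; rewrite gt_eqF//= pnatr_eq0.
Qed.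

(** A count rather than an indicator: its mean is directly a union bound over scales, and being at
    least 1 when some scale is bad, it then dominates any probability. *)
Definition any_bad D T : R := \sum_(k < K.+1) (bad_shifts D (scale k) q T)%:R.

Lemma ravg_any_bad D :
  ravg p (3 * q) (any_bad D) <= K.+1%:R * (n%:R * (12 / 13) ^+ q).
Proof.
rewrite /any_bad ravg_sum.
have -> : K.+1%:R * (n%:R * (12 / 13) ^+ q) = \sum_(k < K.+1) n%:R * (12 / 13) ^+ q :> R.
  by rewrite sumr_const card_ord mulr_natl.
by apply: ler_sum => k _; exact: ravg_bad_shifts.
Qed.

Lemma any_bad_ge0 D T : 0 <= any_bad D T.
Proof. by apply: sumr_ge0. Qed.

Lemma any_bad_ge1 D T : 1 <= any_bad D T \/ forall k, (k <= K)%N -> ~~ bad_shifts D (scale k) q T.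
Proof.
have [/existsP[k hk]|/existsPn h] := boolP [exists k : 'I_K.+1, bad_shifts D (scale k) q T].
  by left; rewrite /any_bad (bigD1 k)//= hk lerDl sumr_ge0.
by right=> k kK; exact: (h (Ordinal (kK : (k < K.+1)%N))).
Qed.

Hypothesis r0 : 0 < r.
Hypothesis tau0 : 0 < tau.
Hypothesis b0 : 0 <= b.
Hypothesis q0 : (0 < q)%N.

Lemma scale_gt0 k : 0 < scale k.
Proof. by rewrite mulr_gt0// exprn_gt0. Qed.

Variable radius : R.
Hypothesis top : 2 * radius <= scale K.

(** Guarantees that the scores climb above the middle level (23/10)qn, as [em_bad_prob] requires. *)
Lemma qscore_top D T : bounded_dataset radius D -> size T = (3 * q)%N ->
  qscore D T K = 3 * q%:R * n%:R.
Proof.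
move=> bD sT; rewrite /qscore score_full ?sT ?natrM; first by ring.
move=> i j; apply: le_trans top.
have := euclid_dist_triangle (origin R d) (D i) (D j).
have := bD i; have := bD j; rewrite /in_eball (euclid_distC (origin R d)); lra.
Qed.

Definition em_err : R := 2 * K.+1%:R * expR (- (b * (q%:R * n%:R / 10))).

Lemma scale_bad_prob D T : bounded_dataset radius D -> size T = (3 * q)%N ->
  \sum_(k < K.+1 | scale_bad D T k) scale_prob D T k <= em_err.
Proof.
move=> bD sT; have q0R : 0 <= q%:R * n%:R :> R by rewrite mulr_ge0.
(* 23/10 is halfway between 11/5 and 12/5, which leaves the gap qn/10 on both sides. *)
apply: (@em_bad_prob R K b lo hi b0 (qscore D T) (23 / 10 * q%:R * n%:R)).
- by rewrite !mulr_ge0//.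
- by rewrite /lo; lra.
- by rewrite /hi; lra.
- by rewrite qscore_top//; lra.
Qed.

Lemma qscore_sensitivity D D' i0 T k : size T = (3 * q)%N ->
  (forall j, j != i0 -> D j = D' j) -> `|qscore D T k - qscore D' T k| <= 6 * q%:R.
Proof.
move=> sT DD'.
have h1 := score_sensitivity (scale k) T DD'.
have h2 := score_sensitivity (scale k) T (fun j jj => esym (DD' j jj)).
have e : (2 * (3 * q))%N%:R = 6 * q%:R :> R by rewrite mulnA natrM.
move: h1 h2; rewrite sT /qscore ler_distl -(ler_nat R) natrD e => h1.
rewrite -(ler_nat R) natrD e => h2.
by apply/andP; split; lra.
Qed.

Variables (eps delta l : R).
Hypothesis n50 : (50 <= n)%N.
Hypothesis eps0 : 0 <= eps.
Hypothesis l0 : 0 <= l.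
Hypothesis Hb : 12 * b * q%:R <= eps / 2.

Definition gauss_err : R := expR (l * (1 + l) / 2 * noise_ratio ^+ 2 - l * (eps / 2)).

(** For fixed shifts. If they are bad for either data set, [any_bad] exceeds the left side, which is
    at most 1. Otherwise wrongly selected scales are charged to [em_err], and at every other scale
    selection and noise each cost a factor e^(eps/2). *)
Lemma mech_step D D' i0 T E : measurable E ->
  bounded_dataset radius D -> (forall j, j != i0 -> D j = D' j) -> size T = (3 * q)%N ->
  \sum_(k < K.+1) scale_prob D T k * rnoisy (core_mean D (scale k) q T) (scale k) E <=
  expR eps * (\sum_(k < K.+1) scale_prob D' T k * rnoisy (core_mean D' (scale k) q T) (scale k) E)
  + any_bad D T + any_bad D' T + em_err + gauss_err.
Proof.
move=> mE bD DD' sT.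
have P0 D1 k : 0 <= scale_prob D1 T k by exact: em_prob_ge0.
have em0 : 0 <= em_err by rewrite mulr_ge0 ?expR_ge0// mulr_ge0.
have ga0 : 0 <= gauss_err by exact: expR_ge0.
have S0 : 0 <= expR eps * (\sum_(k < K.+1) scale_prob D' T k * rnoisy (core_mean D' (scale k) q T) (scale k) E).
  by rewrite mulr_ge0 ?expR_ge0// sumr_ge0// => k _; rewrite mulr_ge0 ?rnoisy_ge0.
have A0 := any_bad_ge0 D T; have A0' := any_bad_ge0 D' T.
have S1 : \sum_(k < K.+1) scale_prob D T k * rnoisy (core_mean D (scale k) q T) (scale k) E <= 1.
  rewrite -[leRHS](sum_em_prob K b lo hi (qscore D T)); apply: ler_sum => k _.
  by rewrite ler_piMr ?rnoisy_le1.
have [h|gD] := any_bad_ge1 D T; first by lra.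
have [h|gD'] := any_bad_ge1 D' T; first by lra.
suff : \sum_(k < K.+1) scale_prob D T k * rnoisy (core_mean D (scale k) q T) (scale k) E <=
  expR eps * (\sum_(k < K.+1) scale_prob D' T k * rnoisy (core_mean D' (scale k) q T) (scale k) E)
  + em_err + gauss_err by lra.
have ge : gauss_err = \sum_(k < K.+1) scale_prob D T k * gauss_err.
  by rewrite -mulr_suml sum_em_prob mul1r.
rewrite ge mulr_sumr.
apply: (@le_trans _ _ (\sum_(k < K.+1) (expR eps * (scale_prob D' T k *
    rnoisy (core_mean D' (scale k) q T) (scale k) E)) +
    \sum_(k < K.+1) (if scale_bad D T k then scale_prob D T k else 0) +
    \sum_(k < K.+1) scale_prob D T k * gauss_err)); last first.
  by rewrite lerD2r lerD2l -big_mkcond; exact: scale_bad_prob.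
rewrite -!big_split/=; apply: ler_sum => k _.
case: ifPn => kb.
  have h0 : 0 <= expR eps * (scale_prob D' T k * rnoisy (core_mean D' (scale k) q T) (scale k) E).
    by rewrite mulr_ge0 ?expR_ge0// mulr_ge0 ?rnoisy_ge0// P0.
  have h1 : 0 <= scale_prob D T k * gauss_err by rewrite mulr_ge0.
  have h2 : scale_prob D T k * rnoisy (core_mean D (scale k) q T) (scale k) E <= scale_prob D T k.
    by rewrite ler_piMr ?rnoisy_le1.
  lra.
have kK : (k <= K)%N by rewrite -ltnS.
have hQ : 11 / 5 * q%:R * n%:R <= (score D (scale k) T)%:R :> R.
  by move: kb; rewrite negb_or -ltNge => /andP[/ltW].
have hc := core_mean_stable n50 q0 sT DD' (gD k kK) (gD' k kK) hQ.
have := rnoisy_shift (eps / 2) mE (scale_gt0 k) tau0 l0 hc; rewrite -/gauss_err => h1.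
have h2 : scale_prob D T k <= expR (eps / 2) * scale_prob D' T k.
  have := @em_prob_ratio R K b lo hi b0 (qscore D T) (qscore D' T) (6 * q%:R) k.
  have c0 : 0 <= 6 * q%:R :> R by rewrite mulr_ge0.
  move=> /(_ c0 (fun k => qscore_sensitivity k sT DD')) h.
  apply: (le_trans h); apply: ler_wpM2r; first exact: P0.
  rewrite ler_expR (le_trans _ Hb)// le_eqVlt; apply/orP; left; apply/eqP; ring.
rewrite addr0; apply: (@le_trans _ _ (scale_prob D T k * (expR (eps / 2) *
   rnoisy (core_mean D' (scale k) q T) (scale k) E + gauss_err))).
  by rewrite ler_wpM2l.
rewrite mulrDr lerD2r mulrA [_ * expR _]mulrC mulrA.
rewrite ler_wpM2r ?rnoisy_ge0//.
have -> : expR eps = expR (eps / 2) * expR (eps / 2) by rewrite -expRD; congr expR; lra.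
by rewrite -mulrA ler_wpM2l ?expR_ge0.
Qed.

Lemma mech_private D D' E : measurable E ->
  2 * (K.+1%:R * (n%:R * (12 / 13) ^+ q)) + em_err + gauss_err <= delta ->
  bounded_dataset radius D -> neighboring D D' ->
  (mech D E <= (expR eps)%:E * mech D' E + delta%:E)%E.
Proof.
move=> mE Hd bD [i0 _ DD']; rewrite !mechE// -EFinM -EFinD lee_fin.
rewrite -ravgZ.
apply: (@le_trans _ _ (ravg p (3 * q) (fun T => expR eps * (\sum_(k < K.+1)
    scale_prob D' T k * rnoisy (core_mean D' (scale k) q T) (scale k) E) +
    (any_bad D T + (any_bad D' T + (em_err + gauss_err)))))).
  by apply: ler_ravg => T sT _; rewrite !addrA; exact: (mech_step mE bD DD' sT).
rewrite !ravgD !ravg_cst lerD2l.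
have := ravg_any_bad D; have := ravg_any_bad D'; lra.
Qed.
End Mechanism.

(** * Accuracy *)

Section Utility.
Variables (R : realType) (p d : nat).
Local Notation n := p.+1.
Variables (D : dataset R n d) (xs : d.-tuple R).

Definition good_output : set (d.-tuple R * R) := [set o : d.-tuple R * R |
  [/\ gm_objective D o.1 <= (40 * 12 + 1) * gm_objective D xs,
      o.2 <= 4 * quantile_radius (9 / 10) D xs &
      euclid_dist xs o.1 <= 12 * o.2]].

(** The objective is 1-Lipschitz; the 40 is the 4 of the bound on the radius times the 10 of
    [quantile_radius_le]. *)
Lemma good_outputP o : o.2 <= 4 * quantile_radius (9 / 10) D xs ->
  euclid_dist xs o.1 <= 12 * o.2 -> good_output o.
Proof.
move=> h1 h2; split => //.
have := gm_objective_lipschitz D (ltn0Sn p) xs o.1.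
have := @quantile_radius_le R n d D (ltn0Sn p) xs.
lra.
Qed.

Lemma measurable_euclid_dist (y : d.-tuple R) :
  measurable_fun setT (fun x : d.-tuple R => euclid_dist x y).
Proof.
apply: measurableT_comp.
  apply: continuous_measurable_fun; exact: sqrt_continuous.
apply: measurable_sum => j; apply: measurable_funX; apply: measurable_funB => //.
exact: measurable_tnth.
Qed.

Lemma measurable_good_output : measurable good_output.
Proof.
have m1 (y : d.-tuple R) : measurable_fun setT (fun o : d.-tuple R * R => euclid_dist o.1 y).
  apply: (measurableT_comp (measurable_euclid_dist y)); exact: measurable_fst.
have m2 : measurable_fun setT (fun o : d.-tuple R * R => o.2) by exact: measurable_snd.
have -> : good_output = [set o : d.-tuple R * R | gm_objective D o.1 <= (40 * 12 + 1) * gm_objective D xs]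
   `&` [set o | o.2 <= 4 * quantile_radius (9 / 10) D xs]
   `&` [set o | euclid_dist o.1 xs - 12 * o.2 <= 0].
  apply/seteqP; split => o /=.
    by move=> [h1 h2 h3]; rewrite subr_le0 euclid_distC.
  by move=> [[h1 h2]]; rewrite subr_le0 euclid_distC => h3; split.
have le_m (h : d.-tuple R * R -> R) (a : R) : measurable_fun setT h -> measurable [set o | h o <= a].
  move=> mh; rewrite (_ : [set o | _] = setT `&` h @^-1` `]-oo, a]%classic); first exact: mh.
  by apply/seteqP; split => o /=; rewrite in_itv/= => // -[].
apply: measurableI; first apply: measurableI; apply: le_m => //.
  apply: measurable_funM => //; apply: measurable_sum => i; exact: m1.
by apply: measurable_funB => //; apply: measurable_funM.
Qed.

Variables (r tau b x : R) (K q : nat) (radius : R).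
Hypothesis r0 : 0 < r.
Hypothesis tau0 : 0 < tau.
Hypothesis b0 : 0 <= b.
Hypothesis q0 : (0 < q)%N.
Hypothesis top : 2 * radius <= scale r K.
Hypothesis bD : bounded_dataset radius D.
Hypothesis med : geometric_median D xs.
Hypothesis rq : r <= 4 * quantile_radius (9 / 10) D xs.
Hypothesis x0 : 0 <= d%:R + x.
Hypothesis Htau : tau ^+ 2 * (4 * (d%:R + x)) <= 1.

(** At k = 0 this is the assumption on r. Later, the low score at the preceding scale and
    [score_concentrated] show that half of that scale, a quarter of the selected one, does not
    exceed the quantile radius. *)
Lemma scale_le_quantile T k : size T = (3 * q)%N ->
  ~~ scale_bad r q D T k -> scale r k <= 4 * quantile_radius (9 / 10) D xs.
Proof.
move=> sT; case: k => [|k]; first by rewrite /scale expr0 mulr1.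
rewrite negb_or -!ltNge => /andP[_ /=]; rewrite /qscore /hi => h.
rewrite leNgt; apply/negP => h'.
have hs : quantile_radius (9 / 10) D xs < scale r k / 2.
  by move: h'; rewrite /scale exprS mulrCA; lra.
have := score_concentrated T (quantile_radius_count (ltn0Sn p) hs).
rewrite sT natrM; lra.
Qed.

(** 11 s from the median to the mean plus at most s of noise; hence C' = 12. *)
Lemma noisy_good T k (g : d.-tuple R) : size T = (3 * q)%N ->
  ~~ bad_shifts D (scale r k) q T -> ~~ scale_bad r q D T k ->
  \sum_(j < d) tnth g j ^+ 2 <= 4 * (d%:R + x) ->
  good_output (noisy tau (core_mean D (scale r k) q T) (scale r k) g).
Proof.
move=> sT nb kb hg; apply: good_outputP; first exact: scale_le_quantile kb.
set s := scale r k; set c := core_mean _ _ _ _.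
have s0 : 0 < s by exact: scale_gt0.
have hQ : 11 / 5 * q%:R * n%:R <= (score D s T)%:R :> R.
  by move: kb; rewrite negb_or -!ltNge => /andP[/ltW].
have h1 : euclid_dist c xs <= 11 * s := core_mean_near_median sT q0 med nb hQ.
suff h2 : euclid_dist (noisy tau c s g).1 c <= s.
  have := euclid_dist_triangle c xs (noisy tau c s g).1.
  rewrite (euclid_distC xs c) (euclid_distC c (noisy _ _ _ _).1) /= => h3; lra.
rewrite euclid_distE (@eq_nrm _ _ _ (fun j => s * tau * tnth g j)); last first.
  by move=> j; rewrite tnth_mktuple -tnth_nth addrC addKr.
have st0 : 0 <= s * tau by rewrite mulr_ge0 ?ltW.
rewrite nrmZ ger0_norm// -[leRHS]mulr1 -mulrA ler_pM2l//.
rewrite -(@expr_le1 _ 2)//; last by rewrite mulr_ge0 ?nrm_ge0 ?(ltW tau0).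
by rewrite exprMn nrm_sqr (le_trans _ Htau)// ler_wpM2l// sqr_ge0.
Qed.

Lemma rnoisy_good T k : size T = (3 * q)%N ->
  ~~ bad_shifts D (scale r k) q T -> ~~ scale_bad r q D T k ->
  1 - expR (- x) <= rnoisy tau (core_mean D (scale r k) q T) (scale r k) good_output.
Proof.
move=> sT nb kb; set c := core_mean _ _ _ _; set s := scale r k.
have mG := measurable_noisy_pre tau c s measurable_good_output.
have h := gauss_tail d x.
rewrite -lee_fin -rnoisyE; last exact: measurable_good_output.
rewrite /noisy_law EFinB lee_subel_addr//.
apply: (@le_trans _ _ (gauss R d [set g | good_output (noisy tau c s g)] +
  gauss R d (~` [set g : d.-tuple R | good_output (noisy tau c s g)]))%E).
  rewrite probability_setC//.
  have : gauss R d [set g | good_output (noisy tau c s g)] \is a fin_num by exact: fin_num_measure.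
  by move=> f; rewrite addeC subeK.
rewrite leeD2l//; apply: le_trans h; apply: le_measure; rewrite ?inE//.
- exact: measurableC.
- exact: measurable_sumsq_gt.
- move=> g /= ng; rewrite ltNge; apply/negP => hg; apply: ng; exact: noisy_good.
exact: fin_num_measure.
Qed.

Lemma mech_utility :
  ((1 - (K.+1%:R * (n%:R * (12 / 13) ^+ q) + em_err p b K q + expR (- x)))%:E
    <= mech r tau b K q D good_output)%E.
Proof.
have mg := measurable_good_output.
rewrite mechE// lee_fin.
have e0 := expR_gt0 (- x).
have em0 : 0 <= em_err p b K q by rewrite mulr_ge0 ?expR_ge0// mulr_ge0.
(* The bound is written as a mean over the shifts, so that the rest is an inequality for fixed
   shifts. *)
apply: (@le_trans _ _ (ravg p (3 * q) (fun T => 1 + ((- 1) * any_bad r K q D T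
    + (- (em_err p b K q) - expR (- x)))))).
  by rewrite !ravgD ravgZ !ravg_cst; have := ravg_any_bad r K q D; lra.
apply: ler_ravg => T sT _.
have P0 k : 0 <= scale_prob r b K q D T k by exact: em_prob_ge0.
have S1 : \sum_(k < K.+1) scale_prob r b K q D T k = 1 by exact: sum_em_prob.
have [h|nb] := any_bad_ge1 r K q D T.
  apply: (@le_trans _ _ 0); first lra.
  by apply: sumr_ge0 => k _; rewrite mulr_ge0// rnoisy_ge0.
have A0 := any_bad_ge0 r K q D T.
apply: (@le_trans _ _ (1 - em_err p b K q - expR (- x))); first lra.
have h1 := scale_bad_prob b0 top bD sT.
apply: (@le_trans _ _ (\sum_(k < K.+1) (scale_prob r b K q D T k -
    (if scale_bad r q D T k then scale_prob r b K q D T k else 0)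
    - scale_prob r b K q D T k * expR (- x)))).
  have e : \sum_(k < K.+1) scale_prob r b K q D T k * expR (- x) = expR (- x).
    by rewrite -[RHS]mul1r -S1 mulr_suml.
  by rewrite !sumrB -big_mkcond/= S1 e; lra.
apply: ler_sum => k _; case: ifPn => kb.
  have : 0 <= scale_prob r b K q D T k * expR (- x) by rewrite mulr_ge0// ltW.
  have : 0 <= scale_prob r b K q D T k * rnoisy tau (core_mean D (scale r k) q T) (scale r k) good_output.
    by rewrite mulr_ge0// rnoisy_ge0.
  lra.
rewrite subr0 -[X in X - _]mulr1 -mulrBr ler_wpM2l//; apply: rnoisy_good => //.
by apply: nb; rewrite -ltnS.
Qed.
End Utility.

(** * Sampling from finite weights with one uniform draw *)

Section InverseTransform.
Variables (R : realType).
Local Notation U01 := (uniform_prob (@ltr01 R)).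

Lemma uniform_prob_le (c : R) : 0 <= c <= 1 -> U01 [set u : R | u <= c] = c%:E.
Proof.
move=> /andP[c0 c1]; rewrite /uniform_prob integral_uniform_pdf.
rewrite (_ : _ `&` _ = `[0, c]%classic); last first.
  apply/seteqP; split => u /=; rewrite !in_itv/=.
    by move=> [-> /andP[-> _]].
  by move=> /andP[h1 h2]; rewrite h1 h2 (le_trans h2).
rewrite (eq_integral (fun=> 1%E)); last first.
  move=> u; rewrite inE/= in_itv/= /uniform_pdf => /andP[h1 h2].
  by rewrite h1 (le_trans h2 c1)/= subr0 invr1.
rewrite integral_cst//= lebesgue_measure_itv/= lte_fin mul1e.
case: ltP => h; first by rewrite sube0.
by have -> : c = 0 by apply/eqP; rewrite eq_le h c0.
Qed.

Variables (K : nat) (w : nat -> R).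
Hypothesis w0 : forall k, 0 < w k.

Definition cum (k : nat) : R := \sum_(j < k.+1) w j.

(** Inverse transform without division. The search stops before [K], and [find] returns [K] when it
    fails; thus the result is at most [K] for every real [u], even outside [0, 1]. *)
Definition select (Z u : R) : nat := find (fun k => u * Z <= cum k) (iota 0 K).

Lemma cum_le j k : (j <= k)%N -> cum j <= cum k.
Proof.
move=> jk; rewrite /cum -!(big_mkord xpredT w) (@big_cat_nat _ _ _ j.+1 0 k.+1)//= lerDl.
by rewrite sumr_ge0// => i _; exact: ltW.
Qed.

Lemma cum_gt0 k : 0 < cum k.
Proof.
rewrite /cum big_ord_recl ltr_pwDl// sumr_ge0// => i _; exact: ltW.
Qed.

Lemma select_le Z u : (select Z u <= K)%N.
Proof. by rewrite -[leqRHS](size_iota 0); exact: find_size. Qed.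

Lemma select_leP Z u k : (k < K)%N -> (select Z u <= k)%N = (u * Z <= cum k).
Proof.
move=> kK; apply/idP/idP => [sk|].
  have : has (fun k => u * Z <= cum k) (iota 0 K).
    by rewrite has_find size_iota (leq_ltn_trans sk).
  move=> /(nth_find 0%N); rewrite -/(select Z u) nth_iota ?(leq_ltn_trans sk)// add0n.
  by move=> h; rewrite (le_trans h)// cum_le.
apply: contraLR; rewrite -ltnNge => /(before_find 0%N).
by rewrite nth_iota// add0n => ->.
Qed.

Let Z := cum K.

Lemma prob_select_le k : (k <= K)%N ->
  measurable [set u : measurableTypeR R | (select Z u <= k)%N] /\
  U01 [set u : R | (select Z u <= k)%N] = (cum k / Z)%:E.
Proof.
have Z0 : 0 < Z := cum_gt0 K.
rewrite leq_eqVlt => /orP[/eqP->|kK].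
  rewrite (_ : [set u | _] = setT); last first.
    by apply/seteqP; split => // u _ /=; exact: select_le.
  by split => //; rewrite divff ?gt_eqF//; exact: probability_setT.
have e : [set u : R | (select Z u <= k)%N] = [set u | u <= cum k / Z].
  by apply/seteqP; split => u /=; rewrite select_leP// ler_pdivlMr.
have c01 : 0 <= cum k / Z <= 1.
  apply/andP; split; first by rewrite divr_ge0// ltW ?cum_gt0.
  by rewrite ler_pdivrMr// mul1r cum_le// ltnW.
rewrite e; split; last exact: uniform_prob_le.
rewrite (_ : [set u | _] = `]-oo, cum k / Z]%classic) //.
Qed.

Lemma prob_select k : (k <= K)%N ->
  measurable [set u : measurableTypeR R | select Z u = k] /\
  U01 [set u : R | select Z u = k] = (w k / Z)%:E.
Proof.
case: k => [|k] kK.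
  have [m1 P1] := prob_select_le kK.
  rewrite (_ : [set u : R | select Z u = 0%N] = [set u : R | (select Z u <= 0)%N]).
    by split => //; rewrite P1 /cum big_ord1.
  by apply/seteqP; split => u /=; rewrite leqn0 => /eqP.
have [m1 P1] := prob_select_le kK; have [m2 P2] := prob_select_le (ltnW kK).
have e : [set u : R | select Z u = k.+1] =
    [set u : R | (select Z u <= k.+1)%N] `\` [set u : R | (select Z u <= k)%N].
  apply/seteqP; split => u /=; first by move=> ->; rewrite ltnn.
  by move=> [h1 /negP]; rewrite -ltnNge => h2; apply/eqP; rewrite eqn_leq h1.
rewrite e; split; first exact: measurableD.
rewrite measureD//=; last by rewrite P1 ltry.
rewrite setIidr; last by move=> u /=; exact: leqW.
rewrite P1 P2 -EFinB; congr EFin.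
rewrite -mulrBl; congr (_ / _).
have -> : cum k.+1 = cum k + w k.+1 by rewrite /cum big_ord_recr.
by rewrite addrC addKr.
Qed.

Lemma integral_select (H : nat -> \bar R) : (forall k, 0 <= H k)%E ->
  (\int[U01]_u H (select Z u) = \sum_(k < K.+1) (w k / Z)%:E * H k)%E.
Proof.
move=> H0.
transitivity (\int[U01]_u (\sum_(k < K.+1) H k * (\1_[set u : R | select Z u = k] u)%:E))%E.
  apply: eq_integral => u _.
  have sK : (select Z u < K.+1)%N by rewrite ltnS select_le.
  rewrite (bigD1 (Ordinal sK))//= indicE mem_set// mule1 big1 ?adde0// => k kk.
  rewrite indicE memNset ?mule0//= => e.
  by move/eqP: kk; apply; apply: val_inj.
rewrite ge0_integral_sum//.
- apply: eq_bigr => k _; have kK : (k <= K)%N by rewrite -ltnS.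
  have [mk Pk] := prob_select kK.
  rewrite ge0_integralZl//.
    by rewrite integral_indic// setIT muleC -Pk.
  by apply/measurable_EFinP; exact: measurable_indic.
- move=> k; have kK : (k <= K)%N by rewrite -ltnS.
  have [mk Pk] := prob_select kK.
  by apply: emeasurable_funM => //; apply/measurable_EFinP; exact: measurable_indic.
- by move=> k u _; rewrite mule_ge0.
Qed.

End InverseTransform.

(** * Running programs *)

Section ProgramLogic.
Variables (R : realType) (d : nat).
Implicit Types (s : state R) (c : cmd) (k : seq cmd).
Local Notation N01 := (@normal_prob R 0 1).
Local Notation U01 := (uniform_prob (@ltr01 R)).

(* [V] is the law of the output.  Unlike [always_halts], this asks for
   termination even when the uniform draw falls outside [0, 1], so that the
   integrands agree everywhere. *)
Fixpoint runs (T : nat) (cf : config R) (V : set (d.-tuple R * R) -> \bar R) : Prop :=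
  match cf, T with
  | ([::], s), _ => 0 < (output d s).2 /\ V = (fun E => (\1_E (output d s))%:E)
  | (_ :: _, _), 0%N => False
  | (c :: k, s), T'.+1 =>
      match step c k s with
      | Det cf' => runs T' cf' V
      | DrawUniform f => exists2 W, forall u, runs T' (f u) (W u) &
          V = (fun E => \int[U01]_u W u E)%E
      | DrawGaussian f => exists2 W, forall u, runs T' (f u) (W u) &
          V = (fun E => \int[N01]_u W u E)%E
      | DrawIndex m f => exists2 W, forall v, (v <= m)%N -> runs T' (f v) (W v) &
          V = (fun E => (m.+1%:R^-1)%:E * \sum_(v < m.+1) W v E)%E
      end
  end.

Lemma runs_sound T cf V : runs T cf V ->
  always_halts T cf (fun s => 0 < (output d s).2) /\
  forall E, halting_prob T cf (@output R d @^-1` E) = V E.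
Proof.
elim: T cf V => [|T IH] [[|c k] s] V //=.
- by move=> [h ->].
- by move=> [h ->].
case: (step c k s) => [cf|f|f|m f].
- exact: IH.
- move=> [W hW ->]; split=> [u _|E]; first exact: (IH _ _ (hW u)).1.
  by apply: eq_integral => u _; rewrite (IH _ _ (hW u)).2.
- move=> [W hW ->]; split=> [u|E]; first exact: (IH _ _ (hW u)).1.
  by apply: eq_integral => u _; rewrite (IH _ _ (hW u)).2.
- move=> [W hW ->]; split=> [v vm|E]; first exact: (IH _ _ (hW v vm)).1.
  congr (_ * _)%E; apply: eq_bigr => v _.
  by rewrite (IH _ _ (hW v _)).2// -ltnS.
Qed.

Lemma runs_mono T T' cf V : (T <= T')%N -> runs T cf V -> runs T' cf V.
Proof.
elim: T T' cf V => [|T IH] [|T'] [[|c k] s] V //= TT'.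
case: (step c k s) => [cf|f|f|m f].
- exact: IH.
- by move=> [W hW ->]; exists W => // u; exact: IH.
- by move=> [W hW ->]; exists W => // u; exact: IH.
- by move=> [W hW ->]; exists W => // v vm; apply: IH => //; exact: hW.
Qed.

(* A Hoare triple for a deterministic command, in continuation-passing form. *)
Definition Exec (C : nat) c s s' : Prop :=
  forall k T V, runs T (k, s') V -> runs (C + T) (c :: k, s) V.

Lemma Exec_le C C' c s s' : (C <= C')%N -> Exec C c s s' -> Exec C' c s s'.
Proof. by move=> CC' h k T V /h; apply: runs_mono; rewrite leq_add2r. Qed.

Lemma Exec_skip s : Exec 1 Skip s s.
Proof. by []. Qed.

Lemma Exec_setn s a i e : Exec 1 (SetN a i e) s (setn s a (neval s i) (neval s e)).
Proof. by []. Qed.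

Lemma Exec_setr s a i j e :
  Exec 1 (SetR a i j e) s (setr s a (neval s i) (neval s j) (reval s e)).
Proof. by []. Qed.

Lemma Exec_seq C1 C2 c1 c2 s s1 s2 :
  Exec C1 c1 s s1 -> Exec C2 c2 s1 s2 -> Exec (1 + C1 + C2) (Seq c1 c2) s s2.
Proof. by move=> h1 h2 k T V h /=; rewrite -addnA; apply: h1; exact: h2. Qed.

Lemma Exec_if C b c1 c2 s s' :
  Exec C (if beval s b then c1 else c2) s s' -> Exec C.+1 (If b c1 c2) s s'.
Proof. by move=> h k T V hk /=; exact: h. Qed.

Lemma Exec_while_stop b c s : beval s b = false -> Exec 1 (While b c) s s.
Proof. by move=> h k T V hk /=; rewrite h. Qed.

(** Loops are described by the exact state after m rounds instead of an invariant. Each round pays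
    one step for its test, and the failing test pays the last step. *)
Lemma Exec_while N C b c (S : nat -> state R) :
  (forall m, (m < N)%N -> beval (S m) b) -> beval (S N) b = false ->
  (forall m, (m < N)%N -> Exec C c (S m) (S m.+1)) ->
  Exec (N * C.+1 + 1) (While b c) (S 0) (S N).
Proof.
elim: N S => [|N IH] S h1 h2 h3; first exact: Exec_while_stop.
have := IH (fun m => S m.+1) (fun m mN => h1 m.+1 mN) h2 (fun m mN => h3 m.+1 mN).
move=> h k T V hk.
rewrite mulSn -!addnA addSn /= h1//; apply: h3 => //.
by rewrite addnA; exact: h.
Qed.

Lemma state_ext s s' : (forall a i, ncell s a i = ncell s' a i) ->
  (forall a i j, rcell s a i j = rcell s' a i j) -> s = s'.
Proof.
case: s => f g; case: s' => f' g' /= h1 h2; congr State.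
  by apply/funext => a; apply/funext => i.
by apply/funext => a; apply/funext => i; apply/funext => j.
Qed.

Lemma Exec_eq C c s s1 s2 : s1 = s2 -> Exec C c s s1 -> Exec C c s s2.
Proof. by move=> ->. Qed.

End ProgramLogic.

(** * The program *)

(* Cells of the program: N_2 coin, N_3 K, N_4 q, N_5 shifts, N_6 and N_7 shift and
   point indices, N_8 coordinate, N_9 scale, N_10 degree, N_11 and N_13 current and
   previous score, N_12 total weight; X_7 scale, X_8 squared distance, X_9 and X_10
   partial and total selection weights, X_11 uniform draw, X_12 Gaussian draw.
   Every block resets its scratch cells, so that states can be described exactly. *)
Definition nv a : nexp := NCell a (NLit 0).
Definition rv a : rexp := RCell a (NLit 0) (NLit 0).
Definition setnv a e : cmd := SetN a (NLit 0) e.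
Definition setrv a e : cmd := SetR a (NLit 0) (NLit 0) e.
Definition incr a : cmd := setnv a (NAdd (nv a) (NLit 1)).
Definition nlt e1 e2 : bexp := BNatLe (NAdd e1 (NLit 1)) e2.
Definition rnat m : rexp := RNat (NLit m).

Declare Scope cmd_scope.
Delimit Scope cmd_scope with cmd.
Notation "c1 ;; c2" := (Seq c1 c2) (at level 60, right associativity) : cmd_scope.
Local Open Scope cmd_scope.

(* [(i + t) mod n] for [i, t < n], without a branch. *)
Definition idx_exp : nexp :=
  let s := NAdd (nv 7) (NCell 5 (nv 6)) in
  NSub s (NMul (nv 0) (NSub (NLit 1) (NSub (nv 0) s))).

Definition diff_exp : rexp := RSub (RCell 0 (nv 7) (nv 8)) (RCell 0 idx_exp (nv 8)).

Definition dist_loop : cmd :=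
  While (nlt (nv 8) (nv 1))
    (setrv 8 (RAdd (rv 8) (RMul diff_exp diff_exp)) ;; incr 8).

Definition dist_cmd : cmd := setrv 8 (rnat 0) ;; dist_loop ;; setnv 8 (NLit 0).

Definition deg_body : cmd :=
  dist_cmd ;;
  If (BRealLe (RSqrt (rv 8)) (rv 7)) (incr 10) Skip ;;
  incr 6.

Definition deg_loop : cmd := While (nlt (nv 6) (NMul (NLit 3) (nv 4))) deg_body.

Definition deg_cmd : cmd :=
  setnv 10 (NLit 0) ;; deg_loop ;; setnv 6 (NLit 0) ;; setrv 8 (rnat 0).

Definition score_body : cmd :=
  deg_cmd ;; setnv 11 (NAdd (nv 11) (nv 10)) ;; incr 7.

Definition score_loop : cmd := While (nlt (nv 7) (nv 0)) score_body.

Definition score_cmd : cmd :=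
  setnv 11 (NLit 0) ;; score_loop ;; setnv 7 (NLit 0) ;; setnv 10 (NLit 0).

Ltac st_cases :=
  simpl; try done; repeat (match goal with
  | |- context [@eq_op _ ?x ?y] => let H := fresh "E" in destruct (@eqP _ x y) as [H|H]; [try rewrite H|]
  end; simpl; try done).

Ltac st_ext := apply: state_ext; [intros ? ?|intros ? ? ?]; simpl; st_cases; try congruence.

Definition beta_exp : rexp :=
  RDiv (RMul (rnat 10) (RLn (RDiv (RMul (rnat 20) (RNat (NAdd (nv 3) (NLit 1)))) (rv 4))))
       (RMul (RNat (nv 4)) (RNat (nv 0))).

Definition frac_exp a b : rexp :=
  RMul (RMul (RDiv (rnat a) (rnat b)) (RNat (nv 4))) (RNat (nv 0)).

Definition weight_exp : rexp :=
  RDiv (rnat 1)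
    (RAdd (RExp (RSub (rnat 0) (RMul beta_exp (RSub (RNat (nv 11)) (frac_exp 11 5)))))
          (RExp (RSub (rnat 0) (RMul beta_exp (RSub (frac_exp 12 5) (RNat (nv 13))))))).

Definition weights_body : cmd :=
  score_cmd ;;
  setrv 10 (RAdd (rv 10) weight_exp) ;;
  SetR 9 (NLit 0) (nv 9) (rv 10) ;;
  setnv 13 (nv 11) ;;
  incr 9 ;;
  setrv 7 (RMul (rv 7) (rnat 2)).

Definition weights_loop : cmd := While (BNatLe (nv 9) (nv 3)) weights_body.

Definition weights_cmd : cmd :=
  weights_loop ;; setnv 9 (NLit 0) ;; setnv 11 (NLit 0) ;; setnv 13 (NLit 0) ;; setrv 7 (rv 2).

Definition select_loop : cmd :=
  While (BAnd (nlt (nv 9) (nv 3))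
              (BNot (BRealLe (RMul (rv 11) (rv 10)) (RCell 9 (NLit 0) (nv 9)))))
    (incr 9 ;; setrv 7 (RMul (rv 7) (rnat 2))).

Definition center_row_body : cmd :=
  SetR 5 (NLit 0) (nv 8)
    (RAdd (RCell 5 (NLit 0) (nv 8)) (RMul (RNat (nv 10)) (RCell 0 (nv 7) (nv 8)))) ;;
  incr 8.

Definition center_row_loop : cmd := While (nlt (nv 8) (nv 1)) center_row_body.

Definition center_body : cmd :=
  deg_cmd ;;
  setnv 10 (NSub (nv 10) (NMul (NLit 2) (nv 4))) ;;
  setnv 12 (NAdd (nv 12) (nv 10)) ;;
  center_row_loop ;;
  setnv 8 (NLit 0) ;;
  incr 7.

Definition center_loop : cmd := While (nlt (nv 7) (nv 0)) center_body.

(** * Exact effect of the deterministic blocks *)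

Section Blocks.
Variables (R : realType).
Implicit Types (s : state R).

Definition cidx (n i t : nat) : nat := (i + t - n * (1 - (n - (i + t))))%N.

Definition sdiff s i l j : R :=
  rcell s 0 i j - rcell s 0 (cidx (ncell s 0 0) i (ncell s 5 l)) j.

Definition ssq s i l m : R := \sum_(j < m) sdiff s i l j * sdiff s i l j.

Definition sdeg s i m : nat :=
  (\sum_(l < m) (Num.sqrt (ssq s i l (ncell s 1 0)) <= rcell s 7 0 0)%R)%N.

Definition sscore s m : nat := (\sum_(i < m) sdeg s i (3 * ncell s 4 0))%N.

Variable d0 : nat.
Local Notation Exec := (Exec d0).

Lemma Exec_dist s d : (0 < d)%N -> ncell s 1 0 = d -> ncell s 8 0 = 0%N ->
  Exec (9 * d) dist_cmd s (setr s 8 0 0 (ssq s (ncell s 7 0) (ncell s 6 0) d)).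
Proof.
move=> dgt0 sd s8.
pose S m := setn (setr s 8 0 0 (ssq s (ncell s 7 0) (ncell s 6 0) m)) 8 0 m.
have L : Exec (d * 4 + 1) dist_loop (S 0%N) (S d).
  apply: Exec_while => [m md||m md].
  - by rewrite /= addn1 sd.
  - by rewrite /= addn1 sd ltnn.
  - have := Exec_seq (@Exec_setr R d0 (S m) 8 (NLit 0) (NLit 0) (RAdd (rv 8) (RMul diff_exp diff_exp)))
      (@Exec_setn R d0 _ 8 (NLit 0) (NAdd (nv 8) (NLit 1))).
    apply: Exec_eq; rewrite /= addn1.
    apply: state_ext => [a i|a i j] /=; st_cases.
    by subst; rewrite /ssq big_ord_recr.
have S0 : S 0%N = setr s 8 0 0 0.
  by rewrite /S /ssq big_ord0; st_ext.
rewrite S0 in L.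
have := Exec_seq (@Exec_setr R d0 s 8 (NLit 0) (NLit 0) (rnat 0))
  (Exec_seq L (@Exec_setn R d0 _ 8 (NLit 0) (NLit 0))).
move=> H; apply: Exec_le (Exec_eq _ H); first lia.
by rewrite /S /=; st_ext.
Qed.

Lemma Exec_setrv s a e v : reval s e = v -> Exec 1 (setrv a e) s (setr s a 0 0 v).
Proof. by move=> <-. Qed.

Lemma Exec_setnv s a e v : neval s e = v -> Exec 1 (setnv a e) s (setn s a 0 v).
Proof. by move=> <-. Qed.

Lemma Exec_count s b a : Exec 2 (If b (incr a) Skip) s
  (setn s a 0 (ncell s a 0 + beval s b)).
Proof.
apply: Exec_if; case: (beval s b); first exact: Exec_setn.
by apply: Exec_eq (@Exec_skip R d0 s); rewrite addn0; st_ext; subst.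
Qed.

Lemma Exec_deg s d q : (0 < d)%N -> (0 < q)%N -> ncell s 1 0 = d -> ncell s 4 0 = q ->
  ncell s 6 0 = 0%N -> ncell s 8 0 = 0%N -> rcell s 8 0 0 = 0 ->
  Exec (52 * (q * d)) deg_cmd s (setn s 10 0 (sdeg s (ncell s 7 0) (3 * q))).
Proof.
move=> dgt0 qgt0 sd sq s6 s8 r8; set i := ncell s 7 0.
(* The last squared distance stays in X_8 until the block resets it; an exact description of the
   state has to carry it along. *)
pose junk m : R := if m is m'.+1 then ssq s i m' d else 0.
pose S m := setn (setn (setr s 8 0 0 (junk m)) 10 0 (sdeg s i m)) 6 0 m.
have L : Exec (3 * q * (14 * d).+1 + 1) deg_loop (S 0%N) (S (3 * q)%N).
  apply: Exec_while => [m mq||m mq].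
  - by rewrite /= addn1 sq.
  - by rewrite /= addn1 sq ltnn.
  - have A := Exec_seq (@Exec_dist (S m) d dgt0 sd s8) (Exec_seq (@Exec_count _ _ _)
      (@Exec_setn R d0 _ 6 (NLit 0) (NAdd (nv 6) (NLit 1)))).
    apply: Exec_le (Exec_eq _ (A _ _)); first lia.
    rewrite /= addn1.
    apply: state_ext => [a i'|a i' j] /=; st_cases.
    by subst; rewrite /sdeg big_ord_recr.
have S0 : S 0%N = setn s 10 0 0.
  by rewrite /S /sdeg big_ord0; st_ext; subst.
rewrite S0 in L.
have A := Exec_seq (@Exec_setn R d0 s 10 (NLit 0) (NLit 0))
  (Exec_seq L (Exec_seq (@Exec_setn R d0 _ 6 (NLit 0) (NLit 0))
    (@Exec_setr R d0 _ 8 (NLit 0) (NLit 0) (rnat 0)))).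
apply: Exec_le (Exec_eq _ A); first nia.
by rewrite /S /=; st_ext; subst.
Qed.

Lemma Exec_score s d q n : (0 < d)%N -> (0 < q)%N -> (0 < n)%N ->
  ncell s 0 0 = n -> ncell s 1 0 = d -> ncell s 4 0 = q ->
  ncell s 6 0 = 0%N -> ncell s 7 0 = 0%N -> ncell s 8 0 = 0%N -> ncell s 10 0 = 0%N ->
  rcell s 8 0 0 = 0 ->
  Exec (64 * (n * (q * d))) score_cmd s (setn s 11 0 (sscore s n)).
Proof.
move=> dgt0 qgt0 ngt0 sn sd sq s6 s7 s8 s10 r8.
pose junk m : nat := if m is m'.+1 then sdeg s m' (3 * q) else 0%N.
pose S m := setn (setn (setn s 10 0 (junk m)) 11 0 (sscore s m)) 7 0 m.
have L : Exec (n * (52 * (q * d) + 4).+1 + 1) score_loop (S 0%N) (S n).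
  apply: Exec_while => [m mq||m mq].
  - by rewrite /= addn1 sn.
  - by rewrite /= addn1 sn ltnn.
  - have D : Exec (52 * (q * d)) deg_cmd (S m) (setn (S m) 10 0 (sdeg s m (3 * q))).
      exact: (@Exec_deg (S m) d q dgt0 qgt0 sd sq s6 s8 r8).
    have A := Exec_seq D (Exec_seq
      (@Exec_setn R d0 _ 11 (NLit 0) (NAdd (nv 11) (nv 10)))
      (@Exec_setn R d0 _ 7 (NLit 0) (NAdd (nv 7) (NLit 1)))).
    apply: Exec_le (Exec_eq _ A); first lia.
    rewrite /= addn1.
    apply: state_ext => [a i'|a i' j] /=; st_cases.
    by subst; rewrite /sscore big_ord_recr.
have S0 : S 0%N = setn s 11 0 0.
  by rewrite /S /sscore big_ord0; st_ext; subst.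
rewrite S0 in L.
have A := Exec_seq (@Exec_setn R d0 s 11 (NLit 0) (NLit 0))
  (Exec_seq L (Exec_seq (@Exec_setn R d0 _ 7 (NLit 0) (NLit 0))
    (@Exec_setn R d0 _ 10 (NLit 0) (NLit 0)))).
have h1 : (n <= n * (q * d))%N by rewrite leq_pmulr// muln_gt0 qgt0.
apply: Exec_le (Exec_eq _ A); first nia.
by rewrite /S /=; st_ext; subst.
Qed.

Definition setrow s a (f : nat -> R) : state R :=
  State (ncell s) (fun a' i j => if (a' == a) && (i == 0%N) then f j else rcell s a' i j).

Section Weights.
Variables (s : state R) (n d q K : nat) (r delta : R).
Hypotheses (dgt0 : (0 < d)%N) (qgt0 : (0 < q)%N) (ngt0 : (0 < n)%N)
  (sn : ncell s 0 0 = n) (sd : ncell s 1 0 = d) (sK : ncell s 3 0 = K)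
  (sq : ncell s 4 0 = q) (s6 : ncell s 6 0 = 0%N) (s7 : ncell s 7 0 = 0%N)
  (s8 : ncell s 8 0 = 0%N) (s9 : ncell s 9 0 = 0%N) (s10 : ncell s 10 0 = 0%N)
  (s11 : ncell s 11 0 = 0%N) (s13 : ncell s 13 0 = 0%N)
  (r2 : rcell s 2 0 0 = r) (r4 : rcell s 4 0 0 = delta)
  (r7 : rcell s 7 0 0 = r) (r8 : rcell s 8 0 0 = 0) (r10 : rcell s 10 0 0 = 0).

(** The solution b of 2 (K + 1) e^(- b q n / 10) = delta / 10. *)
Definition beta_val : R := 10 * ln (20 * (K + 1)%:R / delta) / (q%:R * n%:R).

Definition kscore k : nat := sscore (setr s 7 0 0 (r * 2 ^+ k)) n.

Definition kweight k : R := ew beta_val (11 / 5 * q%:R * n%:R) (12 / 5 * q%:R * n%:R)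
  (fun k => (kscore k)%:R) k.

Let junk m : nat := if m is m'.+1 then kscore m' else 0%N.

Let wstate m := setrow (setr (setr (setn (setn (setn s 9 0 m) 11 0 (junk m)) 13 0 (junk m))
  7 0 0 (r * 2 ^+ m)) 10 0 0 (\sum_(k < m) kweight k))
  9 (fun k => if (k < m)%N then cum kweight k else rcell s 9 0 k).

Lemma Exec_weights :
  Exec (84 * (K.+1 * (n * (q * d)))) weights_cmd s
   (setrow (setr s 10 0 0 (cum kweight K)) 9
      (fun k => if (k < K.+1)%N then cum kweight k else rcell s 9 0 k)).
Proof.
have L : Exec (K.+1 * (64 * (n * (q * d)) + 10).+1 + 1) weights_loop (wstate 0%N) (wstate K.+1).
  apply: Exec_while => [m mq||m mq].
  - by rewrite /= sK -ltnS.
  - by rewrite /= sK ltnn.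
  - have D : Exec (64 * (n * (q * d))) score_cmd (wstate m) (setn (wstate m) 11 0 (kscore m)).
      exact: (@Exec_score (wstate m) d q n dgt0 qgt0 ngt0 sn sd sq s6 s7 s8 s10 r8).
    pose s1 := setn (wstate m) 11 0 (kscore m).
    pose v := \sum_(k < m) kweight k + kweight m.
    have W : reval s1 weight_exp = kweight m.
      rewrite /= sK sq sn r4 div1r !sub0r /kweight /ew.
      congr (_ + expR (- (_ * (_ - _))))^-1.
      (* N_13 starts at 0, in agreement with the convention of [prev] at index 0. *)
      by case: (m).
    have E1 : Exec 1 (setrv 10 (RAdd (rv 10) weight_exp)) s1 (setr s1 10 0 0 v).
      by apply: Exec_setrv; rewrite /v -W.
    have E2 : Exec 1 (SetR 9 (NLit 0) (nv 9) (rv 10)) (setr s1 10 0 0 v)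
       (setr (setr s1 10 0 0 v) 9 0 m v) by [].
    have A := Exec_seq D (Exec_seq E1 (Exec_seq E2 (Exec_seq
      (@Exec_setnv _ 13 (nv 11) (kscore m) _) (Exec_seq
      (@Exec_setnv _ 9 (NAdd (nv 9) (NLit 1)) m.+1 _)
      (@Exec_setrv _ 7 (RMul (rv 7) (rnat 2)) (r * 2 ^+ m.+1) _))))).
    apply: Exec_le (Exec_eq _ (A _ _ _)); first lia; last 3 first.
    + by [].
    + by rewrite /= addn1.
    + by rewrite /= exprSr mulrA.
    apply: state_ext => [a i'|a i' j].
      by simpl; st_cases; subst.
    simpl; st_cases.
    all: try by subst; rewrite ?ltnSn /v ?/cum big_ord_recr.
    by rewrite [in RHS]ltnS [in RHS]leq_eqVlt; case: eqP.
have S0 : wstate 0%N = s.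
  rewrite /wstate big_ord0; apply: state_ext => [a i|a i j]; simpl; st_cases.
  by rewrite expr0 mulr1.
rewrite S0 in L.
have A := Exec_seq L (Exec_seq (@Exec_setnv _ 9 (NLit 0) 0%N erefl)
  (Exec_seq (@Exec_setnv _ 11 (NLit 0) 0%N erefl)
  (Exec_seq (@Exec_setnv _ 13 (NLit 0) 0%N erefl) (@Exec_setrv _ 7 (rv 2) r _)))).
have h1 : (K.+1 <= K.+1 * (n * (q * d)))%N by rewrite leq_pmulr// !muln_gt0 ngt0 qgt0.
apply: Exec_le (Exec_eq _ (A r2)); first by move: h1; move: (n * (q * d))%N => X h1; nia.
apply: state_ext => [a i|a i j]; simpl; st_cases; subst; congruence.
Qed.
End Weights.

Lemma Exec_select s K r (w : nat -> R) Z u : ncell s 3 0 = K -> ncell s 9 0 = 0%N ->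
  rcell s 7 0 0 = r -> rcell s 10 0 0 = Z -> rcell s 11 0 0 = u ->
  (forall k, (k < K)%N -> rcell s 9 0 k = cum w k) ->
  Exec (4 * K + 1) select_loop s
    (setr (setn s 9 0 (select K w Z u)) 7 0 0 (r * 2 ^+ select K w Z u)).
Proof.
move=> sK s9 r7 r10 r11 hw; set N := select K w Z u.
have NK : (N <= K)%N by rewrite /N /select -[leqRHS](size_iota 0) find_size.
pose S m := setr (setn s 9 0 m) 7 0 0 (r * 2 ^+ m).
have L : Exec (N * 4 + 1) select_loop (S 0%N) (S N).
  apply: Exec_while => [m mN||m mN].
  - have mK : (m < K)%N := leq_trans mN NK.
    rewrite /= addn1 sK mK /= r10 r11 hw//.
    have := before_find 0%N mN; rewrite nth_iota// add0n => ->.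
    by [].
  - rewrite /= addn1 sK; have [NK'|] := ltnP N K; last by [].
    rewrite /= r10 r11 hw//; apply/negbF.
    have : has (fun k => u * Z <= cum w k) (iota 0 K) by rewrite has_find size_iota.
    by move=> /(nth_find 0%N); rewrite nth_iota.
  - have A := Exec_seq (@Exec_setnv (S m) 9 (NAdd (nv 9) (NLit 1)) m.+1 _)
      (@Exec_setrv _ 7 (RMul (rv 7) (rnat 2)) (r * 2 ^+ m.+1) _).
    apply: Exec_le (Exec_eq _ (A _ _)); first by [].
    + by apply: state_ext => [a i|a i j]; simpl; st_cases; congruence.
    + by rewrite /= addn1.
    + by rewrite /= exprSr mulrA.
have S0 : S 0%N = s.
  apply: state_ext => [a i|a i j]; simpl; st_cases; try congruence.
  by rewrite expr0 mulr1; congruence.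
rewrite S0 in L.
by apply: Exec_le L; lia.
Qed.

(** The sums in X_5 are not yet divided by the total weight N_12: [out_loop] does it while adding
    noise. The existential hides the degree left in N_10. *)
Lemma Exec_center s n d q : (0 < d)%N -> (0 < q)%N -> (0 < n)%N ->
  ncell s 0 0 = n -> ncell s 1 0 = d -> ncell s 4 0 = q ->
  ncell s 6 0 = 0%N -> ncell s 7 0 = 0%N -> ncell s 8 0 = 0%N -> ncell s 10 0 = 0%N ->
  ncell s 12 0 = 0%N -> rcell s 8 0 0 = 0 -> (forall j, rcell s 5 0 j = 0) ->
  let w i := (sdeg s i (3 * q) - 2 * q)%N in
  exists x, Exec (72 * (n * (q * d))) center_loop s
   (setrow (setn (setn (setn s 10 0 x) 12 0 (\sum_(i < n) w i)) 7 0 n) 5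
     (fun j => if (j < d)%N then \sum_(i < n) (w i)%:R * rcell s 0 i j else 0)).
Proof.
move=> dgt0 qgt0 ngt0 sn sd sq s6 s7 s8 s10 s12 r8 r5 w.
pose junk m : nat := if m is m'.+1 then w m' else 0%N.
pose g m j : R := if (j < d)%N then \sum_(i < m) (w i)%:R * rcell s 0 i j else 0.
pose S m := setrow (setn (setn (setn s 10 0 (junk m)) 12 0 (\sum_(i < m) w i)%N) 7 0 m) 5 (g m).
exists (junk n).
have L : Exec (n * (52 * (q * d) + (d * 4 + 1 + 10)).+1 + 1) center_loop (S 0%N) (S n).
  apply: Exec_while => [m mn||m mn].
  - by rewrite /= addn1 sn.
  - by rewrite /= addn1 sn ltnn.
  - have D : Exec (52 * (q * d)) deg_cmd (S m) (setn (S m) 10 0 (sdeg s m (3 * q))).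
      exact: (@Exec_deg (S m) d q dgt0 qgt0 sd sq s6 s8 r8).
    pose s1 := setn (setn (S m) 10 0 (w m)) 12 0 (\sum_(i < m.+1) w i)%N.
    have D1 : Exec 1 (setnv 10 (NSub (nv 10) (NMul (NLit 2) (nv 4))))
       (setn (S m) 10 0 (sdeg s m (3 * q))) (setn (S m) 10 0 (w m)).
      apply: Exec_eq (@Exec_setnv _ 10 _ (w m) _); last by rewrite /= sq.
      by apply: state_ext => [a i|a i j]; simpl; st_cases; congruence.
    have D2 : Exec 1 (setnv 12 (NAdd (nv 12) (nv 10))) (setn (S m) 10 0 (w m)) s1.
      by apply: Exec_setnv; rewrite /= big_ord_recr.
    (* Halfway through the row, the first [l] coordinates already include point m and the others do
       not. *)
    pose S' l := setn (setrow s1 5 (fun j => if (j < l)%N then g m.+1 j else g m j)) 8 0 l.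
    have L' : Exec (d * 4 + 1) center_row_loop (S' 0%N) (S' d).
      apply: Exec_while => [l ld||l ld].
      + by rewrite /= addn1 sd.
      + by rewrite /= addn1 sd ltnn.
      + have A := Exec_seq (@Exec_setr R d0 (S' l) 5 (NLit 0) (nv 8)
          (RAdd (RCell 5 (NLit 0) (nv 8)) (RMul (RNat (nv 10)) (RCell 0 (nv 7) (nv 8)))))
          (@Exec_setnv _ 8 (NAdd (nv 8) (NLit 1)) l.+1 _).
        apply: Exec_le (Exec_eq _ (A _)); [by []| |by rewrite /= addn1].
        have gl : g m l + (w m)%:R * rcell s 0 m l = g m.+1 l.
          by rewrite /g ld big_ord_recr.
        apply: state_ext => [a i|a i j]; simpl; st_cases; try congruence.
        * by rewrite ltnn ltnSn gl.
        * by rewrite [in RHS]ltnS [in RHS]leq_eqVlt; case: eqP.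
    have S'0 : S' 0%N = s1.
      by apply: state_ext => [a i|a i j]; simpl; st_cases; congruence.
    rewrite S'0 in L'.
    have A := Exec_seq D (Exec_seq D1 (Exec_seq D2 (Exec_seq L' (Exec_seq
      (@Exec_setnv _ 8 (NLit 0) 0%N erefl) (@Exec_setnv _ 7 (NAdd (nv 7) (NLit 1)) m.+1 _))))).
    apply: Exec_le (Exec_eq _ (A _)); [lia| |by rewrite /= addn1].
    apply: state_ext => [a i|a i j]; simpl; st_cases; try congruence.
    by case: ifP => // jd; rewrite /g jd.
have S0 : S 0%N = s.
  apply: state_ext => [a i|a i j]; simpl; rewrite ?big_ord0; st_cases; try congruence.
  by rewrite /g big_ord0 if_same r5.
rewrite S0 in L.
apply: Exec_le L.
have h1 : (n * d <= n * (q * d))%N by rewrite leq_pmul2l// leq_pmull.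
have h2 : (n <= n * (q * d))%N by rewrite leq_pmulr// muln_gt0 qgt0.
nia.
Qed.

End Blocks.


(** * Random draws and the search for K and q *)

Definition shift_loop : cmd :=
  While (nlt (nv 6) (NMul (NLit 3) (nv 4)))
    (SampleIndex 5 (nv 6) (NSub (nv 0) (NLit 1)) ;; incr 6).

Definition tau_exp : rexp :=
  RDiv (rnat 1) (RSqrt (RMul (rnat 4) (RAdd (RNat (nv 1)) (RLn (RDiv (rnat 10) (rv 4)))))).

Definition out_loop : cmd :=
  While (nlt (nv 8) (nv 1))
    (SampleGaussian 12 (NLit 0) (NLit 0) ;;
     SetR 5 (NLit 0) (nv 8)
       (RAdd (RDiv (RCell 5 (NLit 0) (nv 8)) (RNat (nv 12))) (RMul (RMul (rv 7) tau_exp) (rv 12))) ;;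
     incr 8).

(** The machine cannot round a real to a natural, so K, and q in the next loop, are found by
    counting up, in O(K + q) steps. *)
Definition scales_loop : cmd :=
  While (BNot (BRealLe (RMul (rnat 2) (rv 1)) (rv 7))) (setrv 7 (RMul (rv 7) (rnat 2)) ;; incr 3).

Definition shifts_bound_exp : rexp :=
  RMul (rnat 13) (RLn (RDiv (RMul (RMul (rnat 10) (RNat (nv 0))) (RNat (NAdd (nv 3) (NLit 1)))) (rv 4))).

Definition shift_count_loop : cmd :=
  While (BNot (BRealLe shifts_bound_exp (RNat (nv 4)))) (incr 4).

Definition init_cmd : cmd :=
  setrv 7 (rv 2) ;; scales_loop ;; setrv 7 (rv 2) ;; shift_count_loop.

Section RandomLoops.
Variables (R : realType) (p d : nat).
Local Notation n := p.+1.
Implicit Types (s : state R).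

(** In the uses below N_5 is empty beforehand, so that the default 0 of [nth] is the actual content
    of the cells beyond [T]. *)
Definition shift_state s (T : seq nat) : state R :=
  State (fun a i => if a == 5%N then nth 0%N T i
                    else if (a == 6%N) && (i == 0%N) then size T else ncell s a i) (rcell s).

(** Induction on the [m] draws still to come, with those already made in [pre]. *)
Lemma runs_shifts s q k T1 (V : seq nat -> set (d.-tuple R * R) -> \bar R) m pre :
  ncell s 0 0 = n -> ncell s 4 0 = q -> (size pre + m = 3 * q)%N -> all (leq^~ p) pre ->
  (forall T, size T = (3 * q)%N -> all (leq^~ p) T -> runs T1 (k, shift_state s T) (V T)) ->
  runs (m * 4 + 1 + T1) (shift_loop :: k, shift_state s pre)
    (fun E => eavg p m (fun T => V (pre ++ T) E)).
Proof.
move=> sn sq; elim: m pre => [|m IH] pre sz al h.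
  rewrite mul0n add0n add1n /= sq addn1 -sz addn0 ltnn /= cats0.
  by apply: h => //; rewrite -sz addn0.
have -> : (m.+1 * 4 + 1 + T1 = (m * 4 + 1 + T1).+4)%N by lia.
rewrite /= sq addn1 -sz addnS ltnS leq_addr /= sn subn1 /=.
exists (fun v E => eavg p m (fun T => V (pre ++ v :: T) E)) => // v vp.
have -> : setn (setn (shift_state s pre) 5 (size pre) v) 6 0
     (size pre + 1) = shift_state s (rcons pre v).
  apply: state_ext => [a i|a i j] //=; rewrite size_rcons addn1.
  st_cases; try congruence; rewrite nth_rcons.
  - by rewrite ltnn eqxx.
  - case: ltnP => // ip; case: eqP => // _; exact: nth_default.
have -> : (fun E => eavg p m (fun T => V (pre ++ v :: T) E)) =
    (fun E => eavg p m (fun T => V (rcons pre v ++ T) E)).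
  by apply/funext => E; congr eavg; apply/funext => T; rewrite cat_rcons.
apply: IH => //; first by rewrite size_rcons -sz addSnnS.
by rewrite all_rcons vp.
Qed.

Definition tau_val (delta : R) : R := 1 / Num.sqrt (4 * (d%:R + ln (10 / delta))).

Definition out_state s (W sc tau : R) (g : seq R) : state R :=
  setn (setr (setrow s 5 (fun j => if (j < size g)%N
      then rcell s 5 0 j / W + sc * tau * nth 0 g j else rcell s 5 0 j))
    12 0 0 (last 0 g)) 8 0 (size g).

(** Induction on the draws still to come, with [g] holding the earlier ones. This loop ends the run,
    so after the last draw the law is a point mass. *)
Lemma runs_out s W sc delta (c : d.-tuple R) m g :
  ncell s 1 0 = d -> ncell s 12 0 = W -> rcell s 7 0 0 = sc -> rcell s 4 0 0 = delta ->
  rcell s 6 0 0 = sc -> 0 < sc -> (forall j : 'I_d, tnth c j = rcell s 5 0 j / W%:R) ->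
  (size g + m = d)%N ->
  runs (m * 6 + 1) ([:: out_loop], out_state s W%:R sc (tau_val delta) g)
    (fun E => igauss m (fun g' => (\1_E (noisy (tau_val delta) c sc (g ++ g')))%:E)).
Proof.
move=> sd s12 r7 r4 r6 sc0 hc; elim: m g => [|m IH] g sz.
  have sg : size g = d by rewrite -sz addn0.
  rewrite mul0n add0n /= sd sg addn1 ltnn /=.
  have oE : output d (out_state s W%:R sc (tau_val delta) g) = noisy (tau_val delta) c sc g.
    rewrite /output /noisy; congr pair => //.
    apply: eq_from_tnth => j; rewrite !tnth_mktuple /= sg ltn_ord.
    by rewrite hc.
  split; first by rewrite /= r6.
  by rewrite oE cats0.
have -> : (m.+1 * 6 + 1 = (m * 6 + 1).+4.+2)%N by lia.
have lt : (size g < d)%N by rewrite -sz addnS ltnS leq_addr.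
rewrite /= sd addn1 lt /=.
exists (fun u E => igauss m (fun g' => (\1_E (noisy (tau_val delta) c sc (g ++ u :: g')))%:E)) => // u.
have -> : (fun E => igauss m (fun g' => (\1_E (noisy (tau_val delta) c sc (g ++ u :: g')))%:E)) =
   (fun E => igauss m (fun g' => (\1_E (noisy (tau_val delta) c sc (rcons g u ++ g')))%:E)).
  by apply/funext => E; congr igauss; apply/funext => g'; rewrite cat_rcons.
have := IH (rcons g u); rewrite size_rcons addSnnS => /(_ sz).
rewrite /=; congr (runs _ (_, _) _).
apply: state_ext => [a i|a i j]; rewrite /= ?size_rcons ?last_rcons ?addn1; st_cases; try congruence.
- by rewrite ltnn ltnSn nth_rcons ltnn eqxx s12 r7 sd r4.
- by rewrite [(j < (size g).+1)%N]ltnS nth_rcons; case: (ltngtP j (size g)) => // jE; congruence.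
Qed.

(** As i + t < 2n, one subtraction of n reduces it; the truncated difference 1 - (n - (i + t)) is 1
    exactly when i + t >= n. *)
Lemma cidxE (i t : nat) : (i < n)%N -> (t < n)%N -> cidx n i t = ((i + t) %% n)%N.
Proof.
move=> iN tN; rewrite /cidx; have [lt|ge] := ltnP (i + t) n.
  have -> : (1 - (n - (i + t)) = 0)%N by lia.
  by rewrite modn_small// muln0 subn0.
have -> : (n - (i + t) = 0)%N by lia.
rewrite subn0 muln1; rewrite -{2}(subnK ge) modnDr modn_small//; lia.
Qed.

Section Meaning.
Variables (D : dataset R n d) (s : state R) (T : seq nat).
Hypotheses (sn : ncell s 0 0 = n) (sd : ncell s 1 0 = d)
  (s5 : forall l, ncell s 5 l = nth 0%N T l) (Tp : all (leq^~ p) T)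
  (dat : forall (i : 'I_n) (j : 'I_d), rcell s 0 i j = tnth (D i) j).

Lemma sdegE (i : 'I_n) : sdeg s i (size T) = deg D (rcell s 7 0 0) T i.
Proof.
rewrite /deg (big_nth 0%N) big_mkord; apply: eq_bigr => l _; congr (nat_of_bool (_ <= _)).
rewrite euclid_distE /nrm /ssq sd; congr Num.sqrt; apply: eq_bigr => j _.
rewrite /sdiff sn s5 dat expr2.
have tp : (nth 0%N T l < n)%N by rewrite ltnS (allP Tp)// mem_nth.
by rewrite cidxE// -(dat (cyc i (nth 0%N T l))).
Qed.

Lemma sscoreE q : ncell s 4 0 = q -> size T = (3 * q)%N ->
  sscore s n = score D (rcell s 7 0 0) T.
Proof. by move=> sq sT; apply: eq_bigr => i _; rewrite sq -sT sdegE. Qed.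
End Meaning.

Lemma Exec_init s K q r radius delta :
  ncell s 0 0 = n -> ncell s 3 0 = 0%N -> ncell s 4 0 = 0%N ->
  rcell s 1 0 0 = radius -> rcell s 2 0 0 = r -> rcell s 4 0 0 = delta ->
  2 * radius <= r * 2 ^+ K -> (forall k, (k < K)%N -> r * 2 ^+ k < 2 * radius) ->
  13 * ln (10 * n%:R * (K + 1)%:R / delta) <= q%:R ->
  (forall k, (k < q)%N -> k%:R < 13 * ln (10 * n%:R * (K + 1)%:R / delta)) ->
  Exec d (4 * K + 2 * q + 7) init_cmd s (setn (setn (setr s 7 0 0 r) 3 0 K) 4 0 q).
Proof.
move=> sn s3 s4 r1 r2 r4 hK hK' hq hq'.
pose S m := setn (setr s 7 0 0 (r * 2 ^+ m)) 3 0 m.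
have L : Exec d (K * 4 + 1) scales_loop (S 0%N) (S K).
  apply: Exec_while => [m mK||m mK].
  - by rewrite /= r1 -ltNge hK'.
  - by rewrite /= r1 hK.
  - have A := Exec_seq (@Exec_setrv R d (S m) 7 (RMul (rv 7) (rnat 2)) (r * 2 ^+ m.+1) _)
      (@Exec_setnv R d _ 3 (NAdd (nv 3) (NLit 1)) m.+1 _).
    apply: Exec_le (Exec_eq _ (A _ _)); first by [].
    + by apply: state_ext => [a i|a i j]; simpl; st_cases; congruence.
    + by rewrite /= exprSr mulrA.
    + by rewrite /= addn1.
have S0 : S 0%N = setr s 7 0 0 r.
  apply: state_ext => [a i|a i j]; simpl; st_cases; try congruence.
  by rewrite expr0 mulr1.
rewrite S0 in L.
pose Q m := setn (setn (setr s 7 0 0 r) 3 0 K) 4 0 m.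
have L2 : Exec d (q * 2 + 1) shift_count_loop (Q 0%N) (Q q).
  apply: Exec_while => [m mK||m mK].
  - by rewrite /= sn r4 -ltNge hq'.
  - by rewrite /= sn r4 hq.
  - have A := (@Exec_setnv R d (Q m) 4 (NAdd (nv 4) (NLit 1)) m.+1 _).
    apply: Exec_eq (A _); last by rewrite /= addn1.
    by apply: state_ext => [a i|a i j]; simpl; st_cases; congruence.
have E3 : Exec d 1 (setrv 7 (rv 2)) (S K) (Q 0%N).
  apply: Exec_eq (@Exec_setrv R d (S K) 7 (rv 2) r _); last by rewrite /= r2.
  by apply: state_ext => [a i|a i j]; simpl; st_cases; congruence.
have A := Exec_seq (@Exec_setrv R d s 7 (rv 2) r r2) (Exec_seq L (Exec_seq E3 L2)).
by apply: Exec_le A; lia.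
Qed.

End RandomLoops.

Definition main_cmd : cmd :=
  init_cmd ;; shift_loop ;; setnv 6 (NLit 0) ;; weights_cmd ;;
  SampleUniform 11 (NLit 0) (NLit 0) ;; select_loop ;; center_loop ;;
  setrv 6 (rv 7) ;; out_loop.

Lemma runs_seq (R : realType) d C T c1 c2 k (s s1 : state R)
    (V : set (d.-tuple R * R) -> \bar R) :
  Exec d C c1 s s1 -> runs T (c2 :: k, s1) V -> runs (1 + (C + T)) (Seq c1 c2 :: k, s) V.
Proof. by move=> h1 h2 /=; exact: h1. Qed.

Lemma igauss_ge0 (R : realType) m (F : seq R -> \bar R) :
  (forall g, 0 <= F g)%E -> (0 <= igauss m F)%E.
Proof.
elim: m F => [|m IH] F F0 /=; first exact: F0.
by apply: integral_ge0 => u _; exact: IH.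
Qed.

Section Main.
Variables (R : realType) (p d : nat) (radius r eps delta : R) (K q : nat).
Local Notation n := p.+1.
Variable D : dataset R n d.
Hypotheses (dgt0 : (0 < d)%N) (qgt0 : (0 < q)%N) (r0 : 0 < r).
Hypotheses (hK : 2 * radius <= r * 2 ^+ K)
  (hK' : forall k, (k < K)%N -> r * 2 ^+ k < 2 * radius)
  (hq : 13 * ln (10 * n%:R * (K + 1)%:R / delta) <= q%:R)
  (hq' : forall k, (k < q)%N -> k%:R < 13 * ln (10 * n%:R * (K + 1)%:R / delta)).

Let b : R := beta_val n q K delta.
Let tau : R := tau_val d delta.
Let w T : nat -> R := ew b (lo R p q) (hi R p q) (qscore r D T).

(** Literally the nested integrals of the run, since [runs] demands equality on all sets, measurable
    or not. *)
Definition main_law (E : set (d.-tuple R * R)) : \bar R :=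
  eavg p (3 * q) (fun T => \int[uniform_prob (@ltr01 R)]_u
    (fun k => igauss d (fun g => (\1_E (noisy tau (core_mean D (scale r k) q T)
      (scale r k) g))%:E)) (select K (w T) (cum (w T) K) u))%E.

Lemma main_lawE E : measurable E -> main_law E = mech r tau b K q D E.
Proof.
move=> mE; apply: eq_eavg => T _ _.
have w0 k : 0 < w T k by exact: ew_gt0.
pose H k := igauss d (fun g => (\1_E (noisy tau (core_mean D (scale r k) q T)
      (scale r k) g))%:E).
have H0 k : (0 <= H k)%E by apply: igauss_ge0 => g; rewrite lee_fin.
apply: etrans (integral_select K w0 H0) _.
apply: eq_bigr => k _; congr (_ * _)%E.
have mB := measurable_noisy_pre tau (core_mean D (scale r k) q T) (scale r k) mE.
rewrite /H igaussE.
- transitivity (\int[gauss R d]_g (\1_[set g : d.-tuple R |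
      E (noisy tau (core_mean D (scale r k) q T) (scale r k) g)] g)%:E)%E; first by [].
  by rewrite integral_indic// setIT.
- by apply/measurable_EFinP; exact: (measurable_indic mB).
- by move=> g; rewrite lee_fin.
Qed.

Definition main_time : nat := (400 * (K.+1 * (n * (q * d))))%N.

Lemma runs_main v :
  runs main_time ([:: main_cmd], setn (input D radius r eps delta) 2 0 v) main_law.
Proof.
set s0 := setn _ _ _ _.
pose s1 := setn (setn (setr s0 7 0 0 r) 3 0 K) 4 0 q.
pose s2 T := setn (shift_state s1 T) 6 0 0.
pose s3 T := setrow (setr (s2 T) 10 0 0 (cum (w T) K)) 9
      (fun k => if (k < K.+1)%N then cum (w T) k else 0).
pose s4 T u := setr (s3 T) 11 0 0 u.
pose sel T u := select K (w T) (cum (w T) K) u.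
pose s5 T u := setr (setn (s4 T u) 9 0 (sel T u)) 7 0 0 (r * 2 ^+ sel T u).
have dat (i : 'I_n) (j : 'I_d) : rcell s0 0 i j = tnth (D i) j.
  by rewrite /= !valK.
have I : Exec d (4 * K + 2 * q + 7) init_cmd s0 s1 by apply: Exec_init.
have S1 : shift_state s1 [::] = s1.
  apply: state_ext => [a i|a i j]; simpl; st_cases; try congruence.
  by rewrite nth_nil.
set rest := (setnv 6 (NLit 0) ;; weights_cmd ;;
  SampleUniform 11 (NLit 0) (NLit 0) ;; select_loop ;; center_loop ;;
  setrv 6 (rv 7) ;; out_loop).
pose N := (n * (q * d))%N.
pose T4 := (1 + ((4 * K + 1) + (1 + (72 * N + (1 + (1 + (d * 6 + 1)))))))%N.
pose T1 := (1 + (1 + (1 + (84 * (K.+1 * N) + (1 + (1 + T4))))))%N.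
have step T : size T = (3 * q)%N -> all (leq^~ p) T ->
  runs T1 ([:: rest], shift_state s1 T) (fun E => \int[uniform_prob (@ltr01 R)]_u
    (fun k => igauss d (fun g => (\1_E (noisy tau (core_mean D (scale r k) q T)
      (scale r k) g))%:E)) (sel T u))%E.
  move=> sT aT.
  pose n5 l : ncell (s2 T) 5 l = nth 0%N T l := erefl.
  have qs k : kscore (s2 T) n r k = score D (scale r k) T.
    exact: (@sscoreE R p d D (setr (s2 T) 7 0 0 (r * 2 ^+ k)) T erefl erefl n5 aT dat q erefl sT).
  have kw : kweight (s2 T) n q K r delta = w T.
    apply/funext => k; rewrite /kweight /w /b /lo /hi; congr (ew _ _ _ _ k).
    by apply/funext => k'; rewrite qs.
  have W : Exec d (84 * (K.+1 * N)) weights_cmd (s2 T) (s3 T).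
    have := @Exec_weights R d (s2 T) n d q K r delta dgt0 qgt0 (ltn0Sn p).
    rewrite kw => h; apply: Exec_eq (h _ _ _ _ _ _ _ _ _ _ _ _ _ _ _ _) => //.
  apply: (@runs_seq R d 1 _ _ _ _ _ (s2 T)); first exact: Exec_setnv.
  apply: (runs_seq W).
  exists (fun u E => igauss d (fun g => (\1_E (noisy tau (core_mean D (scale r (sel T u)) q T)
      (scale r (sel T u)) g))%:E)) => // u.
  have Sel : Exec d (4 * K + 1) select_loop (s4 T u) (s5 T u).
    apply: (@Exec_select R d (s4 T u) K r (w T) (cum (w T) K) u) => //.
    by move=> k kK; rewrite /= (ltnW kK : (k < K.+1)%N).
  apply: (runs_seq Sel).
  have dg i : (i < n)%N -> sdeg (s5 T u) i (3 * q) = deg D (scale r (sel T u)) T (inord i).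
    move=> iN; rewrite -sT.
    have := @sdegE R p d D (s5 T u) T erefl erefl n5 aT dat (Ordinal iN).
    by rewrite /= => ->; congr deg; apply: val_inj; rewrite /= inordK.
  have [x C] := @Exec_center R d (s5 T u) n d q dgt0 qgt0 (ltn0Sn p) erefl erefl erefl
    erefl erefl erefl erefl erefl erefl (fun j => erefl).
  apply: (runs_seq C).
  set s6 := setrow _ _ _.
  apply: (@runs_seq R d 1 _ _ _ _ _ (setr s6 6 0 0 (scale r (sel T u)))).
    exact: Exec_setrv.
  set s7 := setr s6 _ _ _ _.
  have S7 : s7 = out_state s7 (ncell s7 12 0)%:R (scale r (sel T u)) tau [::].
    by apply: state_ext => [a i|a i j]; simpl; st_cases; congruence.
  rewrite [X in (_, X)]S7.
  apply: (@runs_out R d s7 _ (scale r (sel T u)) delta _ d [::]) => //.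
  - exact: scale_gt0.
  - move=> j; rewrite tnth_mktuple /= ltn_ord.
    congr (_ / _); last rewrite natr_sum; apply: eq_bigr => i _.
      by rewrite dg// inord_val -dat.
    by rewrite dg// inord_val.
have H := @runs_shifts R p d s1 q [:: rest] T1 _ (3 * q) [::] erefl erefl erefl erefl step.
rewrite S1 in H.
have : runs (1 + (4 * K + 2 * q + 7 + (1 + (3 * q * 4 + 1 + T1)))) ([:: main_cmd], s0) main_law.
  by apply: (runs_seq I).
apply: runs_mono; rewrite /T1 /T4 /main_time -/N.
have h1 : (q <= N)%N by rewrite /N mulnCA leq_pmulr// muln_gt0.
have h2 : (d <= N)%N by rewrite /N mulnA leq_pmull// muln_gt0.
nia.
Qed.
End Main.

(** * Constants *)

Section Estimates.
Variable R : realType.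

Lemma expR1_ge2 : 2 <= expR 1 :> R.
Proof. by have := @expR_ge1Dx R 1; lra. Qed.

Lemma expR_half_le2 : expR (1 / 2) <= 2 :> R.
Proof.
rewrite -[leLHS]invrK -expRN -[leRHS]invrK lef_pV2 ?posrE ?invr_gt0 ?expR_gt0//.
by have := @expR_ge1Dx R (- (1 / 2)); lra.
Qed.

Lemma expR1_le4 : expR 1 <= 4 :> R.
Proof.
have -> : 1 = 1 / 2 + 1 / 2 :> R by lra.
by rewrite expRD; have := expR_half_le2; have := expR_gt0 (1 / 2 : R); nra.
Qed.

Lemma ln_lb1 (x : R) : 4 <= x -> 1 <= ln x.
Proof.
move=> x4; rewrite -ler_expR lnK ?posrE; last lra.
by have := expR1_le4; lra.
Qed.

Lemma ln_le_id (x : R) : 0 < x -> ln x <= x.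
Proof. by move=> x0; exact/ltW/ln_sublinear. Qed.

Lemma lnM_le (c x : R) : 0 < c -> 0 < x -> ln (c * x) <= c + ln x.
Proof. by move=> c0 x0; rewrite lnM ?posrE// lerD2r ln_le_id. Qed.

Lemma ln_inv_ge (delta : R) : 0 < delta -> delta <= 3 / 4 -> 1 / 4 <= ln (1 / delta).
Proof.
move=> d0 d1; rewrite (div1r delta) lnV ?posrE//.
by have := @le_ln1Dx R (delta - 1); rewrite addrCA subrr addr0 => /(_ _); lra.
Qed.

Lemma log_ratio_ge1 (radius r : R) : 0 < r -> 5 * r < radius -> 1 <= ln (radius / r).
Proof. by move=> r0 Rr; apply: ln_lb1; rewrite ler_pdivlMr//; lra. Qed.

(** Minimality gives 2^(K-1) < 2 radius / r; as e^(1/2) <= 2, this yields (K - 1)/2 < 1 + L, hence K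
    + 1 < 2L + 4 <= 6L. *)
Lemma exists_scales (radius r : R) : 0 < r -> 5 * r < radius ->
  exists K, [/\ 2 * radius <= r * 2 ^+ K,
  forall k, (k < K)%N -> r * 2 ^+ k < 2 * radius & K.+1%:R <= 6 * ln (radius / r)].
Proof.
move=> r0 Rr; set L := ln _.
have rad0 : 0 < radius by lra.
have e2 : expR L = radius / r by rewrite lnK// posrE divr_gt0.
have ex : exists K, 2 * radius <= r * 2 ^+ K.
  have /archi_boundP : 0 <= 2 * radius / r by rewrite divr_ge0// ltW//; lra.
  set m := Num.bound _ => hm; exists m.
  rewrite [leRHS]mulrC -ler_pdivrMr//; apply: (le_trans (ltW hm)).
  by rewrite -natrX ler_nat ltnW// ltn_expl.
have [K hK Kmin] := ex_minnP ex; exists K; split => //.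
  by move=> k kK; rewrite ltNge; apply/negP => /Kmin; rewrite leqNgt kK.
have L1 : 1 <= L := log_ratio_ge1 r0 Rr.
case: K hK Kmin => [|K] hK Kmin; first lra.
have h : r * 2 ^+ K < 2 * radius by rewrite ltNge; apply/negP => /Kmin; rewrite ltnn.
have h2 : expR (1 / 2 * K%:R) < expR (1 + L).
  rewrite expRM_natr; apply: (@le_lt_trans _ _ (2 ^+ K)).
    by apply: lerXn2r; rewrite ?nnegrE ?expR_ge0// expR_half_le2.
  rewrite expRD e2; apply: (@lt_le_trans _ _ (2 * (radius / r))).
    by rewrite mulrA ltr_pdivlMr// mulrC.
  by rewrite ler_wpM2r// ?expR1_ge2// divr_ge0// ltW.
move: h2; rewrite ltr_expR => h2.
have -> : K.+2%:R = K%:R + 2 :> R by rewrite -addn2 natrD.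
lra.
Qed.

(** With K + 1 <= 6L the logarithm is at most 60 + Y, where 60 = 10 * 6 is pulled out by [lnM_le];
    rounding up gives 13 * 61 + 1 <= 800. *)
Lemma exists_shift_count (L delta : R) n K : 1 <= L -> 0 < delta <= 1 -> (0 < n)%N ->
  K.+1%:R <= 6 * L ->
  exists q, [/\ (0 < q)%N, 13 * ln (10 * n%:R * (K + 1)%:R / delta) <= q%:R,
  forall k, (k < q)%N -> k%:R < 13 * ln (10 * n%:R * (K + 1)%:R / delta) :> R &
  q%:R <= 800 * Num.max 1 (ln (n%:R * Num.max 1 L / delta))].
Proof.
move=> L1 /andP[d0 d1] n0 hK.
have n1 : 1 <= n%:R :> R by rewrite ler1n.
have K1 : 1 <= (K + 1)%:R :> R by rewrite addn1 ler1n.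
set X := 13 * _.
have X0 : 13 <= X.
  rewrite /X -[leLHS]mulr1 ler_pM2l//; apply: ln_lb1.
  rewrite ler_pdivlMr//; apply: (@le_trans _ _ 4); first lra.
  have : 1 <= n%:R * (K + 1)%:R :> R by apply: mulr_ege1.
  by rewrite -mulrA; lra.
have ex : exists q : nat, X <= q%:R.
  have /archi_boundP h : 0 <= X by lra.
  by exists (Num.bound X); exact: ltW.
have [q hq qmin] := ex_minnP ex; exists q; split => //.
- by rewrite lt0n; apply/eqP => q0; move: hq; rewrite q0; lra.
- by move=> k kq; rewrite ltNge; apply/negP => /qmin; rewrite leqNgt kq.
rewrite (max_idPr L1); set Y := ln _; set M := Num.max 1 Y.
have M1 : 1 <= M by rewrite le_max lexx.
have MY : Y <= M by rewrite le_max lexx orbT.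
have XY : X <= 13 * (60 + Y).
  rewrite /X ler_pM2l//; apply: (@le_trans _ _ (ln (60 * (n%:R * L / delta)))).
    have a0 : 0 < 10 * n%:R * (K + 1)%:R / delta by rewrite divr_gt0// !mulr_gt0//; lra.
    have a1 : 0 < 60 * (n%:R * L / delta) by rewrite mulr_gt0// divr_gt0// mulr_gt0//; lra.
    rewrite ler_ln ?posrE// !mulrA ler_pM2r ?invr_gt0//.
    by move: hK; rewrite -addn1 => hK; nra.
  by apply: lnM_le => //; rewrite divr_gt0// mulr_gt0//; lra.
case: q hq qmin => [|q] hq qmin; first by have := hq; lra.
have : q%:R < X by rewrite ltNge; apply/negP => /qmin; rewrite ltnn.
by rewrite -natr1; lra.
Qed.

(** The factor 13 comes from 12/13 <= e^(-1/13). *)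
Lemma shift_failure_le K q n (delta : R) : 0 < delta -> (0 < n)%N ->
  13 * ln (10 * n%:R * (K + 1)%:R / delta) <= q%:R ->
  K.+1%:R * (n%:R * (12 / 13) ^+ q) <= delta / 10.
Proof.
move=> d0 n0; rewrite addn1 => hq; have n1 : 0 < n%:R :> R by rewrite ltr0n.
have K1 : 0 < K.+1%:R :> R by [].
set a := 10 * n%:R * K.+1%:R / delta in hq.
have a0 : 0 < a by rewrite divr_gt0// !mulr_gt0.
have h : (12 / 13) ^+ q <= a^-1 :> R.
  apply: (@le_trans _ _ (expR (- (1 / 13)) ^+ q)).
    apply: lerXn2r; rewrite ?nnegrE ?expR_ge0//.
    by have := @expR_ge1Dx R (- (1 / 13)); lra.
  rewrite -expRM_natr -[a]lnK ?posrE// -expRN ler_expR; lra.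
have -> : delta / 10 = K.+1%:R * (n%:R * a^-1).
  by rewrite /a; field; rewrite !gt_eqF// ltr0n.
by rewrite !ler_pM2l.
Qed.

Lemma em_err_val p K q (delta : R) : 0 < delta -> (0 < q)%N ->
  em_err p (beta_val p.+1 q K delta) K q = delta / 10.
Proof.
move=> d0 q0; rewrite /em_err /beta_val.
have q1 : q%:R != 0 :> R by rewrite pnatr_eq0 -lt0n.
have n1 : p.+1%:R != 0 :> R by rewrite pnatr_eq0.
have e (x y z : R) : x != 0 -> y != 0 -> 10 * z / (x * y) * (x * y / 10) = z.
  by move=> x0 y0; field; rewrite x0 y0.
rewrite e//.
have K1 : 0 < (K + 1)%:R :> R by rewrite addn1.
rewrite expRN lnK ?posrE; last by rewrite divr_gt0// mulr_gt0.
rewrite -[K.+1]addn1; field; rewrite !gt_eqF//.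
Qed.

Lemma beta_ge0 n K q (delta : R) : 0 < delta <= 1 -> 0 <= beta_val n q K delta.
Proof.
move=> /andP[d0 d1]; rewrite /beta_val divr_ge0 ?mulr_ge0//.
apply: ln_ge0; rewrite ler_pdivlMr//.
have K1 : 1 <= (K + 1)%:R :> R by rewrite addn1 ler1n.
lra.
Qed.

Lemma tau_facts d (delta : R) : 0 < delta <= 1 ->
  [/\ 0 < tau_val d delta, 0 < d%:R + ln (10 / delta) &
      tau_val d delta ^+ 2 * (4 * (d%:R + ln (10 / delta))) = 1].
Proof.
move=> /andP[d0 d1].
have x1 : 1 <= ln (10 / delta) by apply: ln_lb1; rewrite ler_pdivlMr//; lra.
have y0 : 0 < d%:R + ln (10 / delta) by rewrite ltr_wpDl//; lra.
have z0 : 0 < 4 * (d%:R + ln (10 / delta)) by rewrite mulr_gt0.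
split => //; first by rewrite /tau_val divr_gt0// sqrtr_gt0.
rewrite /tau_val div1r exprVn sqr_sqrtr ?ltW// mulVf// gt_eqF//.
Qed.

Lemma sample_size_bounds (n d eps delta L : R) : 1 <= L -> 0 < eps <= 1 -> 0 < delta ->
  delta <= 3 / 4 -> 1 <= d ->
  1000 * 1000 * (Num.sqrt d * ln (1 / delta) / eps + ln (L / delta) / eps) <= n ->
  [/\ 1 / 4 <= ln (1 / delta), ln (1 / delta) <= ln (L / delta),
      1000 * 1000 * Num.sqrt d * ln (1 / delta) <= n * eps &
      1000 * 1000 * ln (L / delta) <= n * eps].
Proof.
move=> L1 /andP[e0 e1] d0 d1 dd h; have l4 := ln_inv_ge d0 d1.
have lL : ln (1 / delta) <= ln (L / delta).
  have L0 : 0 < L by lra.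
  by rewrite ler_ln ?posrE ?divr_gt0// ler_pM2r// invr_gt0.
have s0 := sqrtr_ge0 d.
have h' : 1000 * 1000 * (Num.sqrt d * ln (1 / delta) + ln (L / delta)) <= n * eps.
  rewrite -ler_pdivrMr// (le_trans _ h)// le_eqVlt; apply/orP; left; apply/eqP.
  by field; rewrite gt_eqF.
have m0 : 0 <= Num.sqrt d * ln (1 / delta) by rewrite mulr_ge0//; lra.
split=> //; last lra.
by rewrite -mulrA; lra.
Qed.

(** Here q cancels: the left side is 120 ln(20 (K + 1) / delta) / n, and ln(L / delta) >= 1/4
    absorbs the additive constant. *)
Lemma beta_le n q K (eps delta L : R) : (0 < q)%N -> (0 < n)%N -> 1 <= L -> 0 < delta ->
  1 / 4 <= ln (L / delta) -> 1000 * 1000 * ln (L / delta) <= n%:R * eps ->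
  K.+1%:R <= 6 * L -> 12 * beta_val n q K delta * q%:R <= eps / 2.
Proof.
move=> q0 n0 L1 d0 l4 h hK.
have q1 : 0 < q%:R :> R by rewrite ltr0n.
have n1 : 0 < n%:R :> R by rewrite ltr0n.
have e (x y z : R) : x != 0 -> y != 0 -> 12 * (10 * z / (x * y)) * x = 120 * z / y.
  by move=> x0 y0; field; rewrite x0 y0.
rewrite /beta_val e ?gt_eqF// ler_pdivrMr//.
have : ln (20 * (K + 1)%:R / delta) <= 120 + ln (L / delta).
  apply: (@le_trans _ _ (ln (120 * (L / delta)))); last first.
    by apply: lnM_le => //; rewrite divr_gt0//; lra.
  rewrite addn1; have K1 : 0 < K.+1%:R :> R by [].
  have a0 : 0 < 20 * K.+1%:R / delta by rewrite divr_gt0// mulr_gt0.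
  have a1 : 0 < 120 * (L / delta) by rewrite mulr_gt0// divr_gt0//; lra.
  rewrite ler_ln ?posrE//.
  by rewrite mulrA ler_pM2r ?invr_gt0//; lra.
move=> hl; lra.
Qed.

(** With lam = 4B/eps >= 1 and v the [noise_ratio], lam (1 + lam)/2 <= lam^2, so the exponent is at
    most lam^2 v^2 - 2B. The sample size makes 16 B v^2 <= eps^2, that is lam^2 v^2 <= B, which
    leaves -B = ln(delta/4). *)
Lemma gauss_err_le p d (eps delta : R) : 0 < eps <= 1 -> 0 < delta <= 1 -> (0 < d)%N ->
  1 / 4 <= ln (1 / delta) ->
  1000 * 1000 * Num.sqrt d%:R * ln (1 / delta) <= p.+1%:R * eps ->
  gauss_err p (tau_val d delta) eps (4 * ln (4 / delta) / eps) <= delta / 4.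
Proof.
move=> /andP[e0 e1] d01 dgt0 l4 h; have /andP[d0 d1] := d01.
have [t0 y0 ty] := tau_facts d d01.
set tau := tau_val d delta in t0 ty *; set x := ln (10 / delta) in y0 ty.
set l := ln (1 / delta) in l4 h; set B := ln (4 / delta).
have B1 : 1 <= B by apply: ln_lb1; rewrite ler_pdivlMr//; lra.
have Bl : B <= 17 * l.
  have : B <= 4 + l by rewrite /B -[4 / delta]mulr1 mulrAC -mulrA; apply: lnM_le; rewrite ?divr_gt0.
  lra.
have xl : x <= 41 * l.
  have : x <= 10 + l by rewrite /x -[10 / delta]mulr1 mulrAC -mulrA; apply: lnM_le; rewrite ?divr_gt0.
  lra.
have n0 : 0 < p.+1%:R :> R by [].
have dR : 1 <= d%:R :> R by rewrite ler1n.
(* From d <= 4 d l and x <= 41 l <= 41 d l: the lower bound 1/4 on [l] turns the sum d + x into the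
   product of the sample-size condition. *)
have dx : d%:R + x <= 45 * (d%:R * l) by nra.
have v2 : noise_ratio p tau ^+ 2 = (200 * 200 * 4) * (d%:R + x) / p.+1%:R ^+ 2.
  have e (u v n : R) : u != 0 -> n != 0 -> u ^+ 2 * (4 * v) = 1 ->
      (200 / (n * u)) ^+ 2 = 200 * 200 * 4 * v / n ^+ 2.
    move=> u0 nn0 uv; have u4 : 4 * u ^+ 2 != 0 by rewrite mulf_neq0// expf_neq0.
    have -> : v = (4 * u ^+ 2)^-1.
      apply: (mulIf u4); rewrite mulVf// -[RHS]uv; ring.
    by field; rewrite u0 nn0.
  by apply: e => //; rewrite gt_eqF.
have sqr_le (u v : R) : 0 <= u -> u <= v -> u ^+ 2 <= v ^+ 2.
  by move=> u0 uv; apply: lerXn2r; rewrite ?nnegrE// (le_trans u0).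
have c0 : 0 <= 1000 * 1000 * Num.sqrt d%:R * l.
  have sl : 0 <= Num.sqrt d%:R * l by rewrite mulr_ge0 ?sqrtr_ge0//; lra.
  rewrite -mulrA; lra.
have h2 : 1000 * 1000 * (1000 * 1000) * (d%:R * l ^+ 2) <= (p.+1%:R * eps) ^+ 2.
  apply: (@le_trans _ _ ((1000 * 1000 * Num.sqrt d%:R * l) ^+ 2)).
    by rewrite !exprMn sqr_sqrtr ?ler0n// le_eqVlt; apply/orP; left; apply/eqP; ring.
  exact: sqr_le c0 h.
have key : 16 * B * noise_ratio p tau ^+ 2 <= eps ^+ 2.
  have nn0 : 0 < p.+1%:R ^+ 2 :> R by rewrite exprn_gt0.
  have hB : B * (d%:R + x) <= 17 * l * (45 * (d%:R * l)).
    by apply: ler_pM => //; [lra | exact: ltW].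
  have dl0 : 0 <= d%:R * l ^+ 2 by rewrite mulr_ge0// sqr_ge0.
  rewrite v2 [leLHS]mulrA (ler_pdivrMr _ _ nn0) -exprMn [eps * _]mulrC.
  apply: le_trans h2; lra.
rewrite /gauss_err.
have -> : delta / 4 = expR (- B) by rewrite expRN lnK ?posrE ?divr_gt0// invf_div.
rewrite ler_expR; set lam := 4 * B / eps.
have lam_e : lam * eps = 4 * B by rewrite /lam divfK// gt_eqF.
have lam1 : 1 <= lam by rewrite /lam ler_pdivlMr//; lra.
have lam2 : lam ^+ 2 * noise_ratio p tau ^+ 2 <= B.
  rewrite /lam exprMn exprVn mulrAC ler_pdivrMr ?exprn_gt0//.
  have -> : (4 * B) ^+ 2 * noise_ratio p tau ^+ 2 = B * (16 * B * noise_ratio p tau ^+ 2) by ring.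
  by rewrite ler_pM2l//; lra.
have v0 : 0 <= noise_ratio p tau ^+ 2 by exact: sqr_ge0.
have : lam * (1 + lam) / 2 * noise_ratio p tau ^+ 2 <= lam ^+ 2 * noise_ratio p tau ^+ 2.
  by apply: ler_wpM2r => //; nra.
lra.
Qed.
End Estimates.


(** * The complete program *)

Definition default_cmd : cmd := setrv 6 (rv 2).

(** The draw from four values is made for every delta when radius > 5r, but consulted only if delta
    >= 3/4; the value 0 then forces the default answer. *)
Definition program : cmd :=
  If (BRealLe (rv 1) (RMul (rnat 5) (rv 2)))
    default_cmd
    (SampleIndex 2 (NLit 0) (NLit 3) ;;
     If (BAnd (BRealLe (RDiv (rnat 3) (rnat 4)) (rv 4)) (BNatLe (nv 2) (NLit 0)))
       default_cmd main_cmd).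

Section Program.
Variables (R : realType) (p d : nat) (radius r eps delta : R).
Local Notation n := p.+1.
Hypotheses (dgt0 : (0 < d)%N) (r0 : 0 < r).
Implicit Type D : dataset R n d.

Definition default_law (E : set (d.-tuple R * R)) : \bar R := (\1_E (origin R d, r))%:E.

Lemma is_prob_default : is_prob default_law.
Proof. by exists \d_(origin R d, r) => E _. Qed.

Lemma runs_default D v :
  runs 1 ([:: default_cmd], setn (input D radius r eps delta) 2 0 v) default_law.
Proof.
split; first exact: r0.
by apply/funext => E; congr (\1_E (_, _))%:E.
Qed.

Lemma runs_program_small D : radius <= 5 * r ->
  runs 2 ([:: program], input D radius r eps delta) default_law.
Proof.
move=> h; rewrite /= h /=; split; first exact: r0.
by apply/funext => E; congr (\1_E (_, _))%:E.
Qed.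

Variables (K q : nat).
Hypotheses (qgt0 : (0 < q)%N) (Rr : 5 * r < radius).
Hypotheses (hK : 2 * radius <= r * 2 ^+ K)
  (hK' : forall k, (k < K)%N -> r * 2 ^+ k < 2 * radius)
  (hq : 13 * ln (10 * n%:R * (K + 1)%:R / delta) <= q%:R)
  (hq' : forall k, (k < q)%N -> k%:R < 13 * ln (10 * n%:R * (K + 1)%:R / delta)).

Definition coin_law (V : set (d.-tuple R * R) -> \bar R) : set (d.-tuple R * R) -> \bar R :=
  fun E => eavg 3 1 (fun T => if (3 / 4 <= delta) && (head 0%N T <= 0)%N
                              then default_law E else V E).

Lemma runs_program D : runs (main_time p d K q + 4) ([:: program], input D radius r eps delta)
  (coin_law (main_law r delta K q D)).
Proof.
rewrite addnC /= leNgt Rr /=.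
exists (fun v E => if (3 / 4 <= delta) && (v <= 0)%N then default_law E
  else main_law r delta K q D E) => // v _ /=.
case: ifP => _.
  by apply: (@runs_mono R d 1); [rewrite /main_time !muln_gt0 qgt0 dgt0 | exact: runs_default].
exact: runs_main.
Qed.

Let tau := tau_val d delta.
Let b := beta_val n q K delta.

Definition full_law D := coin_law (mech r tau b K q D).

Lemma full_lawE D E : measurable E -> full_law D E = coin_law (main_law r delta K q D) E.
Proof.
by move=> mE; rewrite /full_law /coin_law; apply: eq_eavg => T _ _; rewrite main_lawE.
Qed.

Lemma is_prob_full_law D : is_prob (full_law D).
Proof.
apply: (@is_prob_eavg _ _ _ 3 1 (fun T E => if (3 / 4 <= delta) && (head 0%N T <= 0)%N
                              then default_law E else mech r tau b K q D E)) => T.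
by case: ((3 / 4 <= delta) && (head 0%N T <= 0)%N); [exact: is_prob_default | exact: is_prob_mech].
Qed.

Lemma mech_real D E : measurable E ->
  exists2 m, 0 <= m <= 1 & mech r tau b K q D E = m%:E.
Proof.
move=> mE; have [P PE] := is_prob_mech r tau b K q D.
rewrite -PE//; exists (fine (P E)); last by rewrite fineK// fin_num_measure.
rewrite fine_ge0//= -lee_fin fineK ?fin_num_measure//; exact: probability_le1.
Qed.

Lemma coin_lawE (V : set (d.-tuple R * R) -> \bar R) E m : V E = m%:E ->
  coin_law V E = (if 3 / 4 <= delta then (\1_E (origin R d, r) + 3 * m) / 4 else m)%:E.
Proof.
move=> VE; rewrite /coin_law VE.
have -> : (fun T : seq nat => if (3 / 4 <= delta) && (head 0%N T <= 0)%N
    then default_law E else m%:E) =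
  (fun T => (if (3 / 4 <= delta) && (head 0%N T <= 0)%N then \1_E (origin R d, r) else m)%:E).
  by apply/funext => T; case: ifP.
rewrite eavg_EFin /= !big_ord_recl big_ord0/=; congr EFin.
by case: (3 / 4 <= delta) => /=; field.
Qed.

(** The two laws share a quarter of their mass, so they differ by at most 3/4 on any event. *)
Lemma full_law_private_coin D D' E : measurable E -> 3 / 4 <= delta -> 0 <= eps ->
  (full_law D E <= (expR eps)%:E * full_law D' E + delta%:E)%E.
Proof.
move=> mE hd e0.
have [m /andP[m0 m1] mDE] := mech_real D mE; have [m' /andP[m0' m1'] mDE'] := mech_real D' mE.
rewrite /full_law (coin_lawE mDE) (coin_lawE mDE') hd -EFinM -EFinD lee_fin.
have e1 : 1 <= expR eps by have := @expR_ge1Dx R eps; lra.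
have i0 : 0 <= \1_E (origin R d, r) :> R by [].
set i := \1_E _ in i0 *; nra.
Qed.

(** Below 3/4 the budget is delta/10 for the shifts of each data set, delta/10 for the selection and
    delta/4 for the noise. *)
Lemma full_law_private D D' E (L : R) : measurable E -> 0 < delta <= 1 -> 0 < eps <= 1 ->
  1 <= L -> K.+1%:R <= 6 * L ->
  1000 * 1000 * (Num.sqrt d%:R * ln (1 / delta) / eps + ln (L / delta) / eps) <= n%:R ->
  bounded_dataset radius D -> neighboring D D' ->
  (full_law D E <= (expR eps)%:E * full_law D' E + delta%:E)%E.
Proof.
move=> mE d01 e01 L1 KL hn bD DD'; have /andP[d0 d1] := d01; have /andP[e0 e1] := e01.
have [hd|hd] := leP (3 / 4) delta; first exact: full_law_private_coin (ltW e0).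
have [m _ mDE] := mech_real D mE; have [m' _ mDE'] := mech_real D' mE.
rewrite /full_law (coin_lawE mDE) (coin_lawE mDE') (lt_geF hd) -mDE -mDE'.
have dR : 1 <= d%:R :> R by rewrite ler1n.
have [l4 lL h1 h2] := sample_size_bounds L1 e01 d0 (ltW hd) dR hn.
have n50 : (50 <= n)%N.
  rewrite -(ler_nat R); have : n%:R * eps <= n%:R :> R by rewrite ler_piMr.
  lra.
have [t0 y0 ty] := tau_facts d d01.
have B0 : 0 <= 4 * ln (4 / delta) / eps.
  by rewrite divr_ge0 ?(ltW e0)// mulr_ge0// ln_ge0// ler_pdivlMr//; lra.
apply: (@mech_private R p d r tau b K q r0 t0 (beta_ge0 n K q d01) qgt0 radius hK
  eps delta (4 * ln (4 / delta) / eps) n50 B0) => //.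
  by apply: beta_le (ltn0Sn p) L1 d0 _ h2 KL => //; apply: le_trans lL.
have := @gauss_err_le R p d eps delta e01 d01 dgt0 l4 h1.
have := @shift_failure_le R K q n delta d0 (ltn0Sn p) hq.
rewrite /b em_err_val//; lra.
Qed.

(** Shifts, selection and noise fail with probability delta/10 each. With the coin, (3/4)(1 - 3
    delta/10) still exceeds 1 - delta since delta >= 3/4. *)
Lemma full_law_useful D xs : 0 < delta <= 1 -> bounded_dataset radius D ->
  geometric_median D xs -> r <= 4 * quantile_radius (9 / 10) D xs ->
  ((1 - delta)%:E <= full_law D (good_output D xs))%E.
Proof.
move=> d01 bD med rq; have /andP[d0 d1] := d01.
have [t0 y0 ty] := tau_facts d d01.
have ty' : tau ^+ 2 * (4 * (d%:R + ln (10 / delta))) <= 1 by rewrite ty.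
have mg := measurable_good_output D xs.
have := @mech_utility R p d D xs r tau b (ln (10 / delta)) K q radius r0 t0
  (beta_ge0 n K q d01) qgt0 hK bD med rq ty'.
have [m /andP[m0 m1] mDE] := mech_real D mg.
rewrite /full_law (coin_lawE mDE) mDE !lee_fin /b em_err_val//.
have := @shift_failure_le R K q n delta d0 (ltn0Sn p) hq.
have -> : expR (- ln (10 / delta)) = delta / 10.
  by rewrite expRN lnK ?posrE ?divr_gt0// invf_div.
move=> h1 h2; have i0 : 0 <= \1_(good_output D xs) (origin R d, r) :> R by [].
case: ifP => hd; last lra.
by set i := \1_(_) _ in i0 *; lra.
Qed.

End Program.

(** 400 * 6 * 800 = 1920000; the remaining room covers the four extra steps. *)
Lemma runtime_le (R : realType) (p d K q : nat) (L M : R) : (0 < d)%N -> (0 < q)%N ->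
  1 <= L -> 1 <= M -> K.+1%:R <= 6 * L -> q%:R <= 800 * M ->
  (main_time p d K q + 4)%:R <= 2000 * 1000 * (p.+1%:R * d%:R * L * M).
Proof.
move=> d0 q0 L1 M1 KL qM; rewrite /main_time natrD !natrM.
have n1 : 1 <= p.+1%:R :> R by rewrite ler1n.
have d1 : 1 <= d%:R :> R by rewrite ler1n.
have nd1 : 1 <= p.+1%:R * d%:R :> R by exact: mulr_ege1.
have LM1 : 1 <= L * M by exact: mulr_ege1.
have h : K.+1%:R * q%:R <= 6 * L * (800 * M) by apply: ler_pM.
have h2 : p.+1%:R * d%:R * (K.+1%:R * q%:R) <= p.+1%:R * d%:R * (6 * L * (800 * M)).
  by rewrite ler_wpM2l//; lra.
have h3 : 1 <= p.+1%:R * d%:R * (L * M) by exact: mulr_ege1.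
have -> : 400 * (K.+1%:R * (p.+1%:R * (q%:R * d%:R))) = 400 * (p.+1%:R * d%:R * (K.+1%:R * q%:R)) :> R.
  by ring.
lra.
Qed.

Theorem theorem3p6 (R : realType) :
  exists (C C' K : R) (P : cmd),
    [/\ 0 < C, 0 < C', 0 < K &
    forall (n d : nat) (radius r eps delta : R),
      (0 < n)%N -> (0 < d)%N -> 0 < radius -> 0 < r ->
      0 < eps <= 1 -> 0 < delta <= 1 ->
      C * (Num.sqrt d%:R * ln (1 / delta) / eps
           + ln (ln (radius / r) / delta) / eps) <= n%:R ->
    exists (T : nat)
           (A : dataset R n d -> probability (d.-tuple R * R)%type R),
      [/\ implements P radius r eps delta T A,
          T%:R <= K * (n%:R * d%:R * Num.max 1 (ln (radius / r))
             * Num.max 1 (ln (n%:R * Num.max 1 (ln (radius / r)) / delta))),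
          differentially_private radius eps delta A &
          forall (D : dataset R n d) (xstar : d.-tuple R),
            bounded_dataset radius D ->
            geometric_median D xstar ->
            r <= 4 * quantile_radius (9 / 10) D xstar ->
            let good := [set o : d.-tuple R * R |
              [/\ gm_objective D o.1 <= (40 * C' + 1) * gm_objective D xstar,
                  o.2 <= 4 * quantile_radius (9 / 10) D xstar &
                  euclid_dist xstar o.1 <= C' * o.2]] in
            ((1 - delta)%:E <= A D good)%E]].
Proof.
exists (1000 * 1000), 12, (2000 * 1000), program; split; [lra|lra|lra|].
move=> [//|p] d radius r eps delta _ d0 R0 r0 e01 d01 hn; have /andP[dl0 dl1] := d01.
have n1 : 1 <= p.+1%:R :> R by rewrite ler1n.
have dR : 1 <= d%:R :> R by rewrite ler1n.
(* In the small case the answer ignores the data, hence is private, and the median is within 2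
   radius <= 10 r <= 12 r of the origin. *)
have [small|large] := leP radius (5 * r).
  have [A AE] := @is_prob_default R d r.
  exists 2%N, (fun=> A); split.
  - move=> D bD cf; have [h1 h2] := runs_sound (runs_program_small eps delta r0 D small).
    by split => // E mE; rewrite AE// h2.
  - set a := Num.max _ _; set b := Num.max _ _.
    have a1 : 1 <= a by rewrite le_max lexx.
    have b1 : 1 <= b by rewrite le_max lexx.
    have : 1 <= p.+1%:R * d%:R * a * b :> R by do 3! apply: mulr_ege1 => //.
    lra.
  - move=> D D' _ _ _ E mE; have e1 : 1 <= expR eps.
      by have := @expR_ge1Dx R eps; case/andP: e01; lra.
    rewrite AE// /default_law -EFinM -EFinD lee_fin.
    by rewrite -[leLHS]mul1r (le_trans (ler_wpM2r _ e1))// lerDl ltW.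
  - move=> D xs bD med rq; have mg := measurable_good_output D xs.
    suff : ((1 - delta)%:E <= A (good_output D xs))%E by [].
    rewrite AE// /default_law lee_fin indicE.
    rewrite mem_set /=; first by lra.
    apply: good_outputP => //=.
    by have := median_norm (ltn0Sn p) bD med; lra.
have L1 := log_ratio_ge1 r0 large.
have [K [hK hK' KL]] := exists_scales r0 large.
have [q [q0 hq hq' qM]] := exists_shift_count L1 d01 (ltn0Sn p) KL.
have [A AE] := choice (fun D : dataset R p.+1 d => is_prob_full_law r delta K q D).
exists (main_time p d K q + 4)%N, A; split.
- move=> D bD cf; have [h1 h2] := runs_sound (runs_program eps d0 r0 q0 large hK hK' hq hq' D).
  by split => // E mE; rewrite AE// h2 full_lawE.
- rewrite (max_idPr L1) in qM *.
  by apply: runtime_le => //; rewrite le_max lexx.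
- move=> D D' bD bD' DD' E mE; rewrite !AE//.
  exact: (full_law_private d0 r0 q0 hK hq mE d01 e01 L1 KL hn bD DD').
- move=> D xs bD med rq; suff : ((1 - delta)%:E <= A D (good_output D xs))%E by [].
  rewrite AE; last exact: measurable_good_output.
  exact: (full_law_useful r0 q0 hK hq d01 bD med rq).
Qed.
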